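(* For any integer $n \ge 0$, \[ \sum_{\lambda \in OP(n)} \psi_{S_n}^\lambda = \eta_{B_{\lfloor n/2 \rfloor}} \uparrow_{B_{\lfloor n/2 \rfloor}}^{S_{n}}, \] where, for $m\ge 0$, $\eta_{B_m} := \sum_{\lambda \vdash m} \psi_{B_m}^{(\lambda,\varnothing)}$ is the sum of the type $B$ higher Lie characters of $B_m$ corresponding to conjugacy classes with positive cycles only.
   Context: $OP(n)$ is the set of all partitions of $n$ with odd parts only ($OP(0)$ consists of the empty partition). Higher Lie characters of $S_n$: let $\lambda \vdash n$ have $a_i$ parts of size $i$ ($i\ge 1$), and let $x \in S_n$ have cycle type $\lambda$. Write $x=\prod_i x_i$ where $x_i$ is the product of the $a_i$ cycles of $x$ of length $i$. The centralizer is $Z_x = Z_{S_n}(x) = \prod_i Z_{S_{ia_i}}(x_i) \cong \prod_i G_i \wr S_{a_i}$, with $G_i$ cyclic of order $i$. Concretely, label the $ia_i$ points lying in cycles of length $i$ by $(r,t)$, $1\le r\le a_i$, $t \in \mathbb{Z}/i\mathbb{Z}$, so that $x(r,t)=(r,t+1)$; every element $z_i\in Z_{S_{ia_i}}(x_i)$ has the form $z_i(r,t)=(\sigma(r),t+k_r)$ with $\sigma\in S_{a_i}$, $k_r\in\mathbb{Z}/i\mathbb{Z}$. Let $\omega_i(z_i)=\prod_r \zeta_i^{k_r}$ with $\zeta_i$ a primitive complex $i$-th root of unity (a primitive character on $G_i$, trivial on $S_{a_i}$). Let $\omega^x := \bigotimes_i \omega_i$, a linear character of $Z_x$. The higher Lie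 character is $\psi_{S_n}^\lambda := \omega^x\uparrow_{Z_x}^{S_n}$; it depends only on $\lambda$. The group $B_m = \mathbb{Z}_2 \wr S_m$ of signed permutations consists of the bijections $\sigma$ of $\{\pm1,\ldots,\pm m\}$ with $\sigma(-i)=-\sigma(i)$ for all $i$. It is embedded in $S_{2m}$ as the centralizer of a fixed-point-free involution (cycle type $(2^m)$), and in $S_{2m+1}$ as the centralizer of a permutation of cycle type $(2^m,1)$ (i.e. via $B_m\subset S_{2m}\subset S_{2m+1}$). Conjugacy classes of $B_m$ are indexed by pairs of partitions $(\lambda^+,\lambda^-)$ of total size $m$; the class $(\lambda,\varnothing)$ with $\lambda\vdash m$ is the class of those signed permutations $x$ with no cycle containing both $v$ and $-v$ (all cycles positive), conjugate in $B_m$ to an ordinary permutation in $S_m\subset B_m$ of cycle type $\lambda$. Let $\lambda$ have $a_i$ parts of size $i$, and let $x$ be in this class. Label the elements of $\{\pm1,\dots,\pm m\}$ by $(i,r,t,\varepsilon)$ with $i\ge1$, $1\le r\le a_i$, $t\in\mathbb{Z}/i\mathbb{Z}$, $\varepsilon\in\{\pm1\}$, so that negation sends $(i,r,t,\varepsilon)$ to $(i,r,t,-\varepsilon)$ and $x(i,r,t,\varepsilon)=(i,r,t+1,\varepsilon)$. The centralizer $Z_{B_m}(x)\cong\prod_i(\mathbb{Z}_2\times\mathbb{Z}_i)\wr S_{a_i}$ consists of the elements $z(i,r,t,\varepsilon)=(i,\sigma_i(r),t+k_{i,r},\delta_{i,r}\varepsilon)$ with $\sigma_i\in S_{a_i}$,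 $k_{i,r}\in\mathbb{Z}/i\mathbb{Z}$, $\delta_{i,r}\in\{\pm1\}$. Let $\omega^x$ be the linear character that is trivial on each $\mathbb{Z}_2$, a primitive irreducible character on each $\mathbb{Z}_i$, and trivial on each $S_{a_i}$: $\omega^x(z)=\prod_{i,r}\zeta_i^{k_{i,r}}$. Then $\psi_{B_m}^{(\lambda,\varnothing)}:=\omega^x\uparrow_{Z_{B_m}(x)}^{B_m}$. For $m=0$, $B_0$ is the trivial group and $\eta_{B_0}$ is its trivial character. *)

(* Defs.v *)
From HB Require Import structures.
From mathcomp Require Import all_boot all_order all_algebra all_fingroup.
From mathcomp Require Import all_solvable all_field all_character.

Set Implicit Arguments.
Unset Strict Implicit.
Unset Printing Implicit Defensive.

Import GroupScope GRing.Theory.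
Local Open Scope ring_scope.

(* A partition of n has at most n parts, each at most n; hence the finite
   carrier n.-bseq 'I_n.+1. *)
Definition is_intpart (n : nat) (s : seq nat) :=
  [&& sorted geq s, all (leq 1) s & sumn s == n].

Record intpart (n : nat) := Intpart {
  intpart_val : n.-bseq 'I_n.+1;
  _ : is_intpart n (map val intpart_val)
}.

HB.instance Definition _ n := [isSub for @intpart_val n].
HB.instance Definition _ n := [Finite of intpart n by <:].

Definition parts n (l : intpart n) : seq nat := map val (intpart_val l).

Definition odd_parts n (l : intpart n) := all odd (parts l).

(* porbits s contains the fixed points of s as cycles of length 1. *)
Definition has_cycle_type n (s : 'S_n) (l : intpart n) :=
  perm_eq [seq #|C| | C : {set 'I_n} <- enum (porbits s)] (parts l).

Definition prim_roots (zeta : nat -> algC) :=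
  forall i, (0 < i)%N -> i.-primitive_root (zeta i).

(* The point froot x p is taken as the point labelled t = 0 in the cycle of x
   through p, so that the point labelled t in the cycle of a root q is x^t q;
   if p is a root, z p is the point labelled k_p := findex x q (z p) in the
   cycle of q := froot x (z p). *)
Definition omegaS (T : finType) (zeta : nat -> algC) (x z : {perm T}) : algC :=
  \prod_(p in froots x)
     zeta #|porbit x p| ^+ findex x (froot x (z p)) (z p).

(* (i, false) stands for i + 1 and (i, true) for - (i + 1). *)
Definition spoint (m : nat) := ('I_m * bool)%type.

Definition neg m (p : spoint m) : spoint m := (p.1, ~~ p.2).

Definition signed_perms m : {set {perm spoint m}} :=
  [set s : {perm spoint m} | [forall p, s (neg p) == neg (s p)]].

(* sroot x p is the base point, with label (t, e) = (0, +), of the union of the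
   cycles of x through p and - p; the point with label (t, e) is e x^t q, where
   q is the base point. *)
Definition sroot m (x : {perm spoint m}) : spoint m -> spoint m :=
  fingraph.root (relU (frel x) (frel (@neg m))).

(* The label t of v = e x^t q, where all cycles of x are positive. *)
Definition slabel m (x : {perm spoint m}) (q v : spoint m) : nat :=
  findex x q (if v \in porbit x q then v else neg v).

Definition omegaB m (zeta : nat -> algC) (x z : {perm spoint m}) : algC :=
  \prod_(p | sroot x p == p)
     zeta #|porbit x p| ^+ slabel x (sroot x (z p)) (z p).

Definition all_positive m (x : {perm spoint m}) :=
  [forall p, neg p \notin porbit x p].

Lemma neg_inv m : involutive (@neg m).
Proof. by case=> i b; rewrite /neg negbK. Qed.

Lemma signed_permsP m (s : {perm spoint m}) :
  reflect (forall p, s (neg p) = neg (s p)) (s \in signed_perms m).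
Proof. by rewrite inE; apply: (iffP forallP) => h p; apply/eqP. Qed.

Lemma group_set_signed_perms m : group_set (signed_perms m).
Proof.
apply/group_setP; split=> [|s t /signed_permsP hs /signed_permsP ht].
  by apply/signed_permsP=> p; rewrite !perm1.
by apply/signed_permsP=> p; rewrite !permM hs ht.
Qed.

Canonical signed_perms_group m := Group (group_set_signed_perms m).
Notation Bgroup m := (signed_perms_group m).

Definition ord_sperm_fun m (s : 'S_m) (p : spoint m) : spoint m := (s p.1, p.2).

Lemma ord_sperm_inj m (s : 'S_m) : injective (ord_sperm_fun s).
Proof. by case=> i b [j c] [] /perm_inj -> ->. Qed.

Definition ord_sperm m (s : 'S_m) : {perm spoint m} := perm (@ord_sperm_inj m s).

(* The conjugacy class of B_m indexed by (l, empty). *)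
Definition in_pos_class m (l : intpart m) (x : {perm spoint m}) :=
  [&& x \in Bgroup m, all_positive x &
      [exists s : 'S_m, has_cycle_type s l && (x \in ord_sperm s ^: Bgroup m)]].

Lemma mem_porbit_fconnect (T : finType) (x : {perm T}) p q :
  (q \in porbit x p) = fconnect x p q.
Proof.
apply/porbitP/idP => [[i ->]|/iter_findex <-].
  by rewrite permX fconnect_iter.
by exists (findex x p q); rewrite permX.
Qed.

Section CycleTypeExists.

Variables (n : nat) (l : intpart n).

Let ss : seq (seq 'I_n) := reshape (parts l) (enum 'I_n).
Let blk p := nth [::] ss (find (fun c : seq 'I_n => p \in c) ss).

Let partsP : is_intpart n (parts l).
Proof. by case: l. Qed.

Let flat_ss : flatten ss = enum 'I_n.
Proof.
apply: reshapeKr; have /and3P[_ _ /eqP->] := partsP.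
by rewrite -cardE card_ord.
Qed.

Let shape_ss : shape ss = parts l.
Proof.
apply: reshapeKl; have /and3P[_ _ /eqP->] := partsP.
by rewrite -cardE card_ord.
Qed.

Let has_blk p : has (fun c : seq 'I_n => p \in c) ss.
Proof.
have: p \in flatten ss by rewrite flat_ss mem_enum.
by case/flattenP=> c sc pc; apply/hasP; exists c.
Qed.

Let mem_blk p : p \in blk p.
Proof. exact: (nth_find [::] (has_blk p)). Qed.

Let blk_ss p : blk p \in ss.
Proof. by rewrite mem_nth // -has_find. Qed.

Let blkE p c : c \in ss -> p \in c -> blk p = c.
Proof.
have: uniq (flatten ss) by rewrite flat_ss enum_uniq.
rewrite /blk; elim: ss => //= d ss' IH; rewrite cat_uniq inE.
case/and3P=> _ /hasPn dis u; case: ifP => [pd|pd] /=.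
  case/orP=> [/eqP->//|sc] pc; have /dis : p \in flatten ss'.
    by apply/flattenP; exists c.
  by rewrite /= pd.
by case/orP=> [/eqP->|sc pc]; [rewrite pd | apply: IH].
Qed.

Let uniq_blk c : c \in ss -> uniq c.
Proof.
have: uniq (flatten ss) by rewrite flat_ss enum_uniq.
elim: ss => //= d ss' IH; rewrite cat_uniq inE => /and3P[ud _ u].
by case/orP=> [/eqP->|/IH->].
Qed.

Let step p := next (blk p) p.

Let step_inj : injective step.
Proof.
have blk_step p : blk (step p) = blk p.
  by apply: blkE; rewrite ?blk_ss ?mem_next ?mem_blk.
move=> p q e; have eb : blk p = blk q by rewrite -blk_step e blk_step.
move: e; rewrite /step eb => /(congr1 (prev (blk q))).
by rewrite !prev_next ?uniq_blk ?blk_ss.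
Qed.

Lemma cycle_type_exists : exists s : 'S_n, has_cycle_type s l.
Proof.
pose s := perm step_inj; exists s.
have orb p : porbit s p = [set q in blk p].
  apply/setP=> q; rewrite mem_porbit_fconnect inE.
  rewrite (@fconnect_cycle _ s (blk p)) ?mem_blk //.
  rewrite (eq_in_cycle (e' := frel (next (blk p))) (P := [in blk p])).
  - by rewrite cycle_next ?uniq_blk.
  - move=> u v ub _; rewrite /= permE /step (@blkE u (blk p)) //.
  - exact/allP.
have: perm_eq (enum (porbits s)) [seq [set q in c] | c <- ss].
  apply: uniq_perm; first exact: enum_uniq.
    rewrite map_inj_in_uniq; last first.
      move=> c d sc sd e; have: (0 < size c)%N.
        have /and3P[_ /allP h _] := partsP; apply: h.
        by rewrite -shape_ss map_f.
      case ec: c => [//|p c'] _; rewrite -ec.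
      have pc : p \in c by rewrite ec mem_head.
      have pd : p \in d by have/setP/(_ p) := e; rewrite !inE pc => <-.
      by rewrite -(blkE sc pc) (blkE sd pd).
    have: all (leq 1) (shape ss).
      by rewrite shape_ss; case/and3P: partsP.
    have: uniq (flatten ss) by rewrite flat_ss enum_uniq.
    elim: ss => //= d ss' IH; rewrite cat_uniq.
    case/and3P=> _ /hasPn dis u /andP[d0 h]; rewrite IH // andbT.
    case: d d0 dis => //= p d' _ dis; apply/negP=> sd.
    have /dis : p \in flatten ss' by apply/flattenP; exists (p :: d'); rewrite ?mem_head.
    by rewrite /= mem_head.
  move=> C; rewrite mem_enum; apply/imsetP/mapP => [[p _ ->]|[c sc ->]].
    by exists (blk p); rewrite ?orb.
  have: (0 < size c)%N.
    have /and3P[_ /allP h _] := partsP; apply: h.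
    by rewrite -shape_ss map_f.
  case ec: c => [//|p c'] _; exists p => //; rewrite orb -ec.
  by rewrite (blkE sc) // ec mem_head.
move/(perm_map (fun C : {set 'I_n} => #|C|)); rewrite /has_cycle_type.
move/perm_trans; apply; rewrite -map_comp -shape_ss.
rewrite (_ : map _ ss = shape ss) //; apply/eq_in_map => c sc /=.
by rewrite cardsE; apply/card_uniqP/uniq_blk.
Qed.

End CycleTypeExists.

Lemma pos_class_exists m (l : intpart m) : exists x, in_pos_class l x.
Proof.
have [s hs] := cycle_type_exists l; exists (ord_sperm s); apply/and3P; split.
- by apply/signed_permsP=> p; rewrite !permE.
- apply/forallP=> p; apply/negP=> /porbitP[i].
  have: ((ord_sperm s ^+ i)%g p).2 = p.2.
    by rewrite permX; elim: i => //= i IHi; rewrite permE.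
  by move=> e1 /(congr1 snd) /=; rewrite e1; case: p.2.
- by apply/existsP; exists s; rewrite hs class_refl.
Qed.

Lemma card_porbit_order (T : finType) (x : {perm T}) p :
  #|porbit x p| = fingraph.order x p.
Proof. by apply: eq_card => q; rewrite mem_porbit_fconnect. Qed.

Lemma card_porbit_comm (T : finType) (x : {perm T}) (s : T -> T) p :
  injective s -> (forall v, s (x v) = x (s v)) ->
  #|porbit x (s p)| = #|porbit x p|.
Proof.
move=> s_inj sx; rewrite -(card_imset (porbit x p) s_inj); apply: eq_card => q.
have sxn n v : s ((x ^+ n)%g v) = (x ^+ n)%g (s v).
  by rewrite !permX; elim: n => //= n <-.
apply/porbitP/imsetP => [[i ->]|[v /porbitP[i ->] ->]].
  by exists ((x ^+ i)%g p); rewrite ?mem_porbit ?sxn.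
by exists i; rewrite sxn.
Qed.

Lemma findex_iter_mod (T : finType) (x : {perm T}) q n :
  findex x q (iter n x q) = (n %% #|porbit x q|)%N.
Proof.
rewrite card_porbit_order {1}(divn_eq n (fingraph.order x q)) addnC iterD.
rewrite (_ : iter (_ * _) _ _ = q).
  by rewrite findex_iter // ltn_mod fingraph.order_gt0.
elim: (n %/ _)%N => //= k IHk; rewrite mulSn iterD IHk.
by apply: iter_order; apply: perm_inj.
Qed.

Lemma porbit_iter (T : finType) (x : {perm T}) q n :
  #|porbit x (iter n x q)| = #|porbit x q|.
Proof. by rewrite -permX porbit_perm. Qed.

Section Multiplicativity.

Variables (T : finType) (zeta : nat -> algC) (x : {perm T}).
Variables (s r : T -> T) (K : T -> nat).

Hypotheses (s_inj : injective s) (s_x : forall v, s (x v) = x (s v)).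
Hypotheses (r_idem : forall v, r (r v) = r v).
Hypotheses (r_x : forall v, r (x v) = r v) (r_s : forall v, r (s v) = r v).
Hypothesis r_span : forall v, exists b n, v = iter b s (iter n x (r v)).
Hypothesis K_span : forall q b n, r q = q ->
  zeta #|porbit x q| ^+ K (iter b s (iter n x q)) = zeta #|porbit x q| ^+ n.

Let compat (z : {perm T}) :=
  (forall v, z (x v) = x (z v)) /\ (forall v, z (s v) = s (z v)).

Let om (z : {perm T}) :=
  \prod_(p | r p == p) zeta #|porbit x p| ^+ K (z p).

Let r_iter b n v : r (iter b s (iter n x v)) = r v.
Proof.
elim: b => [|b IHb] /=; last by rewrite r_s.
by elim: n => //= n IHn; rewrite r_x.
Qed.

Let s_iter b n v : iter b s (iter n x v) = iter n x (iter b s v).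
Proof.
elim: b => //= b ->; elim: n => //= n IHn; by rewrite s_x IHn.
Qed.

Let len_iter b n v : #|porbit x (iter b s (iter n x v))| = #|porbit x v|.
Proof.
elim: b => [|b IHb] /=; first exact: porbit_iter.
by rewrite (card_porbit_comm _ s_inj).
Qed.

Let z_iter z b n v : compat z ->
  z (iter b s (iter n x v)) = iter b s (iter n x (z v)).
Proof.
case=> zx zs; elim: b => [|b IHb] /=; last by rewrite zs IHb.
by elim: n => //= n <-.
Qed.

Let compatV z : compat z -> compat z^-1%g.
Proof.
by case=> zx zs; split=> v; apply: (@perm_inj _ z); rewrite ?zx ?zs !permKV.
Qed.

Let r_z z v : compat z -> r (z v) = r (z (r v)).
Proof.
by move=> hz; have [b [n {1}->]] := r_span v; rewrite z_iter // r_iter.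
Qed.

Let r_z_inj z u v : compat z -> r (z u) = r (z v) -> r u = r v.
Proof.
move=> hz e; have hV := compatV hz.
by rewrite -[u](permK z) -[v](permK z) (r_z _ hV) e -(r_z _ hV).
Qed.

Let len_z z v : compat z -> #|porbit x (z v)| = #|porbit x v|.
Proof. by case=> zx _; apply: card_porbit_comm => //; apply: perm_inj. Qed.

Let f_z z v : compat z ->
  zeta #|porbit x v| ^+ K (z v) =
  zeta #|porbit x v| ^+ K (z (r v)) * zeta #|porbit x v| ^+ K v.
Proof.
move=> hz; have [b [n e]] := r_span v; set q := r v in e *.
have rq : r q = q by apply: r_idem.
have eN : #|porbit x v| = #|porbit x q| by rewrite e len_iter.
have [c [k e']] := r_span (z q); set q' := r (z q) in e'.
have rq' : r q' = q' by apply: r_idem.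
have eN' : #|porbit x q| = #|porbit x q'| by rewrite -(len_z q hz) e' len_iter.
have ezv : z v = iter (b + c) s (iter (n + k) x q').
  by rewrite e z_iter // e' !iterD !s_iter.
rewrite eN {2}e (K_span _ _ rq) eN' ezv e' !K_span //.
by rewrite -exprD addnC.
Qed.

Lemma omega_mul z w : compat z -> compat w -> om (w * z)%g = om w * om z.
Proof.
move=> hz hw; rewrite mulrC /om.
transitivity (\prod_(p | r p == p)
   (zeta #|porbit x p| ^+ K (z (r (w p))) * zeta #|porbit x p| ^+ K (w p))).
  by apply: eq_bigr => p _; rewrite permM -(len_z p hw) f_z.
rewrite big_split /=; congr (_ * _).
pose A := [pred p | r p == p]; pose h p := r (w p).
have h_inj : {in A &, injective h}.
  by move=> p q /eqP rp /eqP rq /(r_z_inj hw); rewrite rp rq.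
have -> : \prod_(p | r p == p) zeta #|porbit x p| ^+ K (z p) =
          \prod_(p in [set h p | p in A]) zeta #|porbit x p| ^+ K (z p).
  apply: eq_bigl => p; have/subset_cardP eqA: #|[set h p | p in A]| = #|A|.
    by rewrite card_in_imset.
  rewrite -[RHS]/(p \in [set h u | u in A]) [RHS](_ : _ = (p \in A)) //.
  apply: (eqA _ p); apply/subsetP=> _ /imsetP[u _ ->].
  by rewrite inE /= r_idem.
rewrite big_imset //=; apply: eq_bigr => p _; congr (zeta _ ^+ _).
rewrite /h -(len_z p hw); have [b [n e]] := r_span (w p).
by rewrite {1}e len_iter.
Qed.

End Multiplicativity.

Lemma perm_commP (T : finType) (x z : {perm T}) :
  reflect (forall v, z (x v) = x (z v)) (z \in 'C[x]).
Proof.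
apply: (iffP cent1P) => [h v|h]; first by rewrite -!permM h.
by apply/permP=> v; rewrite !permM h.
Qed.

Lemma prim_roots_mod zeta (n k : nat) : prim_roots zeta -> (0 < n)%N ->
  zeta n ^+ (k %% n)%N = zeta n ^+ k.
Proof. by move=> hz n0; rewrite prim_expr_mod //; apply: hz. Qed.

Lemma card_porbit_gt0 (T : finType) (x : {perm T}) q : (0 < #|porbit x q|)%N.
Proof. by rewrite lt0n card_porbit_neq0. Qed.

Lemma omegaSM (T : finType) zeta (x z w : {perm T}) : prim_roots zeta ->
  z \in 'C[x] -> w \in 'C[x] ->
  omegaS zeta x (z * w)%g = omegaS zeta x z * omegaS zeta x w.
Proof.
move=> hz /perm_commP zx /perm_commP wx.
have csym : connect_sym (frel x) by apply: fconnect_sym; apply: perm_inj.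
apply: (@omega_mul T zeta x id (froot x) (fun v => findex x (froot x v) v)) => //.
- exact: fingraph.root_root.
- by move=> v; apply/esym/fingraph.rootP => //; apply: fconnect1.
- move=> v; exists 0%N, (findex x (froot x v) v) => /=.
  by rewrite iter_findex // csym connect_root.
- move=> q b n rq; have -> : iter b id (iter n x q) = iter n x q by elim: b.
  have -> : froot x (iter n x q) = q.
    by rewrite -[RHS]rq; apply/esym/fingraph.rootP => //; apply: fconnect_iter.
  by rewrite findex_iter_mod prim_roots_mod // card_porbit_gt0.
Qed.

Lemma omegaBM m zeta (x z w : {perm spoint m}) : prim_roots zeta ->
    x \in Bgroup m -> all_positive x ->
    z \in 'C_(Bgroup m)[x] -> w \in 'C_(Bgroup m)[x] ->
  omegaB zeta x (z * w)%g = omegaB zeta x z * omegaB zeta x w.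
Proof.
move=> hz /signed_permsP xB /forallP xp.
move=> /setIP[/signed_permsP zB /perm_commP zx].
move=> /setIP[/signed_permsP wB /perm_commP wx].
set e := relU (frel x) (frel (@neg m)).
have ninj := inv_inj (@neg_inv m).
have csym : connect_sym e.
  by apply: relU_sym; apply: fconnect_sym => //; apply: perm_inj.
have xn v : neg (x v) = x (neg v) by rewrite xB.
have itn b v : iter b (@neg m) v = if odd b then neg v else v.
  by elim: b => //= b ->; case: odd => //=; rewrite neg_inv.
have nxn n v : neg (iter n x v) = iter n x (neg v).
  by elim: n => //= n <-.
apply: (@omega_mul _ zeta x (@neg m) (sroot x) (fun v => slabel x (sroot x v) v))
  => //.
- exact: fingraph.root_root.
- move=> v; apply/esym/fingraph.rootP => //; apply: connect1.
  by rewrite /e /= eqxx.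
- move=> v; apply/esym/fingraph.rootP => //; apply: connect1.
  by rewrite /e /= eqxx orbT.
- move=> v; have /connectP[p] : connect e (sroot x v) v.
    by rewrite csym connect_root.
  elim/last_ind: p v (sroot x v) => [|p u IHp] v q /=.
    by move=> _ ->; exists 0%N, 0%N.
  rewrite rcons_path last_rcons => /andP[pp /orP /= lu] ->.
  have [b [n eq_l]] := IHp _ q pp erefl.
  case: lu => /eqP <-; rewrite eq_l; last by exists b.+1, n.
  exists b, n.+1 => /=; elim: b {eq_l} => //= b IHb.
  by rewrite -IHb xn.
- move=> q b n rq.
  have -> : sroot x (iter b (@neg m) (iter n x q)) = q.
    rewrite -[RHS]rq; apply/esym/fingraph.rootP => //.
    apply: (@connect_trans _ _ (iter n x q)).
      elim: n => //= n IHn; apply: connect_trans IHn _.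
      by apply: connect1; rewrite /e /= eqxx.
    elim: b => //= b IHb; apply: connect_trans IHb _.
    by apply: connect1; rewrite /e /= eqxx orbT.
  have xnq : iter n x q \in porbit x q by rewrite -permX mem_porbit.
  have -> : slabel x q (iter b (@neg m) (iter n x q)) = (n %% #|porbit x q|)%N.
    rewrite -findex_iter_mod /slabel itn; case: odd; last by rewrite xnq.
    rewrite neg_inv ifN // nxn; apply: contra (xp q).
    rewrite -!eq_porbit_mem => /eqP <-.
    by rewrite -permX porbit_perm.
  by rewrite prim_roots_mod // card_porbit_gt0.
Qed.

Lemma mul_is_class_fun (gT : finGroupType) (G : {group gT}) (f : gT -> algC) :
    {in G &, forall u v, f (u * v)%g = f u * f v} -> f 1%g = 1 ->
  is_class_fun <<G>> [ffun u => f u *+ (u \in G)].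
Proof.
rewrite genGid => fM f1; apply: intro_class_fun => [u v Gu Gv|u /negPf->//].
rewrite groupJ // Gu conjgE !fM ?groupM ?groupV //.
by rewrite mulrC -mulrA -fM ?groupV // mulgV f1 mulr1.
Qed.

Lemma omegaS1 (T : finType) zeta (x : {perm T}) : omegaS zeta x 1%g = 1.
Proof.
by apply: big1 => p /eqP e; rewrite perm1 e findex0 expr0.
Qed.

Lemma omegaB1 m zeta (x : {perm spoint m}) : omegaB zeta x 1%g = 1.
Proof.
by apply: big1 => p /eqP e; rewrite perm1 e /slabel porbit_id findex0 expr0.
Qed.

Definition cf_omegaS n zeta (hz : prim_roots zeta) (x : 'S_n) : 'CF('C[x]) :=
  Cfun 0 (mul_is_class_fun (fun z w => @omegaSM _ zeta x z w hz)
                           (omegaS1 zeta x)).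

Definition psiS n zeta (hz : prim_roots zeta) (x : 'S_n) : 'CF([set: 'S_n]) :=
  'Ind[[set: 'S_n]] (cf_omegaS hz x).

Lemma pos_class_signed m (l : intpart m) x : in_pos_class l x -> x \in Bgroup m.
Proof. by case/and3P. Qed.

Lemma pos_class_positive m (l : intpart m) x : in_pos_class l x -> all_positive x.
Proof. by case/and3P. Qed.

Definition cf_omegaB m zeta (hz : prim_roots zeta) (l : intpart m) x
    (hx : in_pos_class l x) : 'CF('C_(Bgroup m)[x]) :=
  Cfun 0 (mul_is_class_fun
    (fun z w => @omegaBM m zeta x z w hz (pos_class_signed hx)
                         (pos_class_positive hx))
    (omegaB1 zeta x)).

Definition psiB m zeta (hz : prim_roots zeta) (l : intpart m) x
    (hx : in_pos_class l x) : 'CF(Bgroup m) :=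
  'Ind[Bgroup m] (cf_omegaB hz hx).

(* y l is a representative of the class (l, empty). *)
Definition etaB m zeta (hz : prim_roots zeta) (y : intpart m -> {perm spoint m})
    (hy : forall l, in_pos_class l (y l)) : 'CF(Bgroup m) :=
  \sum_(l : intpart m) psiB hz (hy l).

(* s acts on the image of iota through iota, and fixes all other points. *)
Definition extend_fun n m (iota : spoint m -> 'I_n) (s : {perm spoint m})
    (p : 'I_n) : 'I_n :=
  if [pick q | iota q == p] is Some q then iota (s q) else p.

Section Embedding.

Variables (n m : nat) (iota : spoint m -> 'I_n) (iota_inj : injective iota).

Lemma extend_fun_iota s q : extend_fun iota s (iota q) = iota (s q).
Proof.
rewrite /extend_fun; case: pickP => [u /eqP/iota_inj-> // |/(_ q)].
by rewrite eqxx.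
Qed.

Lemma extend_fun_out s p : p \notin codom iota -> extend_fun iota s p = p.
Proof.
move=> hp; rewrite /extend_fun; case: pickP => // u /eqP e.
by rewrite -e codom_f in hp.
Qed.

Lemma extend_inj s : injective (extend_fun iota s).
Proof.
move=> p q.
have [/codomP[u ->]|hp] := boolP (p \in codom iota);
have [/codomP[v ->]|hq] := boolP (q \in codom iota);
  rewrite ?extend_fun_iota ?extend_fun_out //.
- by move=> /iota_inj/perm_inj->.
- by move=> e; rewrite -e codom_f in hq.
- by move=> e; rewrite e codom_f in hp.
Qed.

Definition extend (s : {perm spoint m}) : 'S_n := perm (@extend_inj s).

Lemma extendM : {in Bgroup m &, {morph extend : s t / (s * t)%g}}.
Proof.
move=> s t _ _; apply/permP=> p; rewrite permM !permE.
have [/codomP[u ->]|hp] := boolP (p \in codom iota).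
  by rewrite !extend_fun_iota permM.
by rewrite !extend_fun_out.
Qed.

Canonical extend_morphism := Morphism extendM.

Lemma injm_extend : 'injm extend_morphism.
Proof.
apply/injmP=> s t _ _ /permP e; apply/permP=> q; apply: iota_inj.
by have:= e (iota q); rewrite !permE !extend_fun_iota.
Qed.

Lemma extend_isom :
  isom (Bgroup m) (extend_morphism @* Bgroup m) extend_morphism.
Proof. exact/isomP/(conj injm_extend). Qed.

Definition neg_perm : {perm spoint m} := perm (inv_inj (@neg_inv m)).

(* For n = 2m and n = 2m + 1 the image of B_m is the centralizer of an
   involution with cycle type (2^m), resp. (2^m, 1). *)
Lemma im_extend : m = n./2 ->
  extend_morphism @* Bgroup m = 'C[extend neg_perm].
Proof.
move=> def_m; apply/eqP; rewrite eqEsubset; apply/andP; split.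
  apply/subsetP=> _ /morphimP[s sB _ ->]; have nB : neg_perm \in Bgroup m.
    by apply/signed_permsP=> p; rewrite !permE.
  apply/cent1P; rewrite /commute -!extendM //; congr extend.
  by apply/permP=> p; rewrite !permM !permE; have/signed_permsP-> := sB.
apply/subsetP=> t /perm_commP ht; set tau := extend neg_perm in ht.
have tau_iota q : tau (iota q) = iota (neg q).
  by rewrite permE extend_fun_iota permE.
have tauP p : (p \in codom iota) = (tau p != p).
  have [/codomP[q ->]|hp] := boolP (p \in codom iota).
    by rewrite tau_iota (inj_eq iota_inj) /neg -pair_eqE /= andbC; case: (q.2).
  by rewrite permE extend_fun_out // eqxx.
have t_codom p : (t p \in codom iota) = (p \in codom iota).
  by rewrite !tauP -ht (inj_eq perm_inj).
have tq q : exists u, iota u == t (iota q).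
  have /codomP[u ->] : t (iota q) \in codom iota by rewrite t_codom codom_f.
  by exists u.
pose g q := xchoose (tq q); have gE q : iota (g q) = t (iota q).
  exact/eqP/(xchooseP (tq q)).
have g_inj : injective g.
  by move=> u v /(congr1 iota); rewrite !gE => /perm_inj/iota_inj.
have sB : perm g_inj \in Bgroup m.
  apply/signed_permsP=> p; rewrite !permE; apply: iota_inj.
  by rewrite gE -!tau_iota ht gE.
have -> : t = extend (perm g_inj); last exact: (mem_morphim extend_morphism).
apply/permP=> p; rewrite permE.
have [/codomP[q ->]|hp] := boolP (p \in codom iota).
  by rewrite extend_fun_iota permE gE.
rewrite extend_fun_out //; apply/eqP; apply: contraT => ne.
have: (#|[set p; t p]| <= #|[predC codom iota]|)%N.
  apply/subset_leq_card/subsetP=> u; rewrite !inE => /orP[]/eqP-> //.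
  by rewrite t_codom.
rewrite cards2 eq_sym ne -(leq_add2l #|codom iota|) cardC card_ord.
rewrite card_codom // card_prod card_ord card_bool muln2 def_m addn2.
by rewrite -{2}(odd_double_half n) ltnNge -add1n leq_add2r; case: odd.
Qed.

Definition embed_cfun (phi : 'CF(Bgroup m)) :
    'CF(extend_morphism @* Bgroup m) :=
  cfIsom extend_isom phi.

End Embedding.

(* Main.v *)
Require Import Defs.
From HB Require Import structures.
From mathcomp Require Import all_boot all_order all_algebra all_fingroup.
From mathcomp Require Import all_solvable all_field all_character.
From mathcomp Require Import ring.

Set Implicit Arguments.
Unset Strict Implicit.
Unset Printing Implicit Defensive.

Import GroupScope GRing.Theory.
Local Open Scope ring_scope.

(** By the formula for induced characters, the left-hand side at g is the sum of
    omega^x(g) over the x in C(g) all of whose cycles are odd, and the right-hand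
    side is the sum of omega(g) over the pairs (t, x) of commuting elements of
    C(g), where t is an involution with at most one fixed point and x has
    positive cycles relative to t.

    If x is multiplied by the powers of g restricted to one cycle of g of length
    l, then omega^x(g) runs, up to a constant factor, exactly once through the
    l-th roots of unity, and the sum vanishes; twisting by the 2'-part of g only
    keeps the cycles of x odd. On the right-hand side the pairs for which t
    preserves an orbit of <x, g> on which x has cycles of even length i cancel
    first: t and t x^(i/2) contribute with opposite signs. In the end both sides
    vanish unless g is a 2-element, and then both are the number of elements of
    odd order centralizing g on the points moved by g, times the value at the
    identity of the same sum for the symmetric group on the fixed points of g.
    By induction the two sides agree at every g <> 1. They agree at g = 1 as
    well, because both contain the trivial character exactly once: summed over
    all g, each gives n!. *)

(** * Cycles of commuting permutations *)

(** On an orbit of <x, g> whose x-cycles have length i, g first returns to the x-cycle of q after r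
    steps, with a shift k, and the orbit contributes the factor zeta_i^k to omega^x(g). If the
    g-cycles of the orbit have length l, this root has order l / r. Once the number of these
    g-cycles is known, it determines r and i, and also how x closes up the g-cycles. This rigidity
    makes the values along a twist pairwise distinct.

    A twist by g itself may change the parity of the cycles of x. On the right-hand side this does
    no harm when t moves a cycle of g to another cycle: for regular pairs t then moves the whole
    orbit, and positivity and regularity only concern orbits that t preserves. Where t preserves the
    cycle, parity matters and only the 2'-part of g can be used. Hence 2-elements escape the
    cancellation; for them the surviving weights are 1, and what remains is counting.

    Both linear characters are instances of one function, the weight of the action on the sets {v, t
    v}, with t = 1 for the symmetric group. Arbitrary subsets D of the points are carried along
    because the induction passes to the fixed points of g. *)

Lemma porbit_iterP (T : finType) (x : {perm T}) (p q : T) :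
  reflect (exists a, q = iter a x p) (q \in porbit x p).
Proof. by apply: (iffP (porbitP x p q)) => -[a ->]; exists a; rewrite permX. Qed.

Lemma mem_porbit_iter (T : finType) (x : {perm T}) a q :
  iter a x q \in porbit x q.
Proof. by apply/porbit_iterP; exists a. Qed.

Lemma prim_rootX_neq0 zeta i k : prim_roots zeta -> (0 < i)%N -> zeta i ^+ k != 0.
Proof.
move=> hz i0; have e := prim_expr_order (hz i i0).
rewrite expf_neq0 //; apply/eqP=> z0; move/eqP: e.
by rewrite z0 expr0n gtn_eqF // eq_sym oner_eq0.
Qed.

Lemma iter_fixE (T : finType) (x : {perm T}) a q :
  (iter a x q == q) = (#|porbit x q| %| a)%N.
Proof.
apply/eqP/idP => [e|].
  by have := findex_iter_mod x q a; rewrite e findex0 => /esym/eqP.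
case/dvdnP=> k ->; elim: k => //= k IHk; rewrite mulSn iterD IHk.
exact: iter_porbit.
Qed.

Lemma iter_perm_inj (T : finType) (x : {perm T}) a : injective (iter a x).
Proof. by elim: a => //= a IHa u v /perm_inj/IHa. Qed.

Lemma iter_eqE (T : finType) (x : {perm T}) a b q :
  (iter a x q == iter b x q) = (a == b %[mod #|porbit x q|]).
Proof.
wlog ab : a b / (b <= a)%N.
  move=> IH; case/orP: (leq_total a b) => h; last exact: IH.
  by rewrite eq_sym IH // eq_sym.
rewrite -{1}(subnKC ab) iterD (inj_eq (@iter_perm_inj _ _ _)) iter_fixE.
by rewrite eqn_mod_dvd.
Qed.

Lemma iter_comm (T : finType) (g x : T -> T) a b v :
  (forall v, g (x v) = x (g v)) ->
  iter a g (iter b x v) = iter b x (iter a g v).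
Proof.
move=> gx; have gxb w : g (iter b x w) = iter b x (g w).
  by elim: b => //= b <-.
by elim: a => //= a ->.
Qed.

Lemma iter_comm1 (T : finType) (g x : T -> T) b v :
  (forall v, g (x v) = x (g v)) -> g (iter b x v) = iter b x (g v).
Proof. exact: (@iter_comm T g x 1). Qed.

Lemma iter_mul (T : Type) (f : T -> T) a b v :
  iter (a * b) f v = iter a (iter b f) v.
Proof. by elim: a => //= a IHa; rewrite mulSn iterD IHa. Qed.

Lemma return_time (T : finType) (x g : {perm T}) q :
  (forall v, g (x v) = x (g v)) ->
  exists2 r, (0 < r)%N & forall a, (iter a g q \in porbit x q) = (r %| a)%N.
Proof.
move=> gx; pose P a := (0 < a)%N && (iter a g q \in porbit x q).
have exP : exists a, P a.
  exists #|porbit g q|; rewrite /P card_porbit_gt0.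
  by have/eqP-> : iter #|porbit g q| g q == q; rewrite ?iter_fixE ?porbit_id.
case: (ex_minnP exP) => r /andP[r0 rq] rmin; exists r => // a.
have mulr k v : v \in porbit x q -> iter (k * r) g v \in porbit x q.
  case/porbit_iterP=> b ->; elim: k => [|k IHk] /=; first exact: mem_porbit_iter.
  rewrite mulSn iterD; case/porbit_iterP: IHk => c ->.
  rewrite iter_comm //; case/porbit_iterP: rq => d ->.
  by rewrite -iterD mem_porbit_iter.
apply/idP/idP => [aq|/dvdnP[k ->]]; last by rewrite mulr ?porbit_id.
rewrite /dvdn eqn0Ngt; apply/negP=> h.
have := ltn_pmod a r0; rewrite ltnNge rmin // /P h /=.
move: aq; rewrite {1}(divn_eq a r) addnC iterD iter_mul.
have [b eb] : exists b, iter (a %/ r) (iter r g) q = iter b x q.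
  by apply/porbit_iterP; rewrite -iter_mul mulr ?porbit_id.
rewrite eb iter_comm //.
rewrite -!eq_porbit_mem => /eqP e; apply/eqP; rewrite -e.
by apply/esym/eqP; rewrite eq_porbit_mem mem_porbit_iter.
Qed.

(* The orbit of q under x and g consists of r cycles of x and of c cycles of g. *)
Lemma orbit_count (T : finType) (x g : {perm T}) q r c j :
  (forall v, g (x v) = x (g v)) -> (0 < c)%N ->
  (forall a, (iter a g q \in porbit x q) = (r %| a)%N) ->
  (forall a, (iter a x q \in porbit g q) = (c %| a)%N) ->
  iter c x q = iter j g q ->
  (#|porbit x q| * r = c * #|porbit g q|)%N.
Proof.
move=> gx c0 hr hc ej; set i := #|porbit x q|; set l := #|porbit g q|.
have l0 : (0 < l)%N by apply: card_porbit_gt0.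
have i0 : (0 < i)%N by apply: card_porbit_gt0.
have rl : (r %| l)%N.
  by rewrite -hr; have/eqP-> : iter l g q == q; rewrite ?iter_fixE ?porbit_id.
have ci : (c %| i)%N.
  by rewrite -hc; have/eqP-> : iter i x q == q; rewrite ?iter_fixE ?porbit_id.
have rj : (r %| j)%N by rewrite -hr -ej mem_porbit_iter.
have xcb b : iter (b * c) x q = iter (b * j) g q.
  elim: b => //= b IHb; rewrite !mulSn !iterD IHb.
  by rewrite -iter_comm // ej -!iterD addnC.
have dv b : (i %| b * c)%N = (l %| b * j)%N by rewrite -!iter_fixE xcb.
have [k ek] : exists k, iter r g q = iter k x q.
  by apply/porbit_iterP; rewrite hr.
have /dvdnP[u ku] : (c %| k)%N by rewrite -hc -ek mem_porbit_iter.
(* From g^r q = x^(u c) q = g^(u j) q one gets r = u j modulo l, so the gcd of l and j divides r;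
   conversely r divides both. *)
have gr : gcdn l j = r.
  apply/eqP; rewrite eqn_dvd dvdn_gcd rl rj !andbT.
  have : r = u * j %[mod l].
    by apply/eqP; rewrite -iter_eqE ek ku xcb.
  have gl : (gcdn l j %| l)%N by apply: dvdn_gcdl.
  move/(congr1 (modn^~ (gcdn l j))); rewrite !modn_dvdm // => e.
  by rewrite /dvdn e -/(dvdn _ _) dvdn_mull ?dvdn_gcdr.
have r0 : (0 < r)%N by rewrite -gr gcdn_gt0 l0.
have dv2 b : (i %/ c %| b)%N = (l %/ r %| b)%N.
  transitivity (i %| b * c)%N.
    by rewrite -{2}(divnK ci) dvdn_pmul2r.
  rewrite dv -{1}(divnK rl) -{1}(divnK rj) mulnA dvdn_pmul2r //.
  rewrite Gauss_dvdl //.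
  by rewrite /coprime -(eqn_pmul2r r0) muln_gcdl !divnK // gr mul1n.
have e : (i %/ c = l %/ r)%N.
  by apply/eqP; rewrite eqn_dvd dv2 dvdnn -dv2 dvdnn.
by rewrite -(divnK ci) e -{2}(divnK rl) mulnAC mulnC.
Qed.

Section OrbitRoot.

Variables (T : finType) (zeta : nat -> algC) (hz : prim_roots zeta).
Variables (x g : {perm T}) (q : T) (r k : nat).
Hypothesis gx : forall v, g (x v) = x (g v).
Hypothesis hr : forall a, (iter a g q \in porbit x q) = (r %| a)%N.
Hypothesis hk : iter r g q = iter k x q.

Let orbit_root := zeta #|porbit x q| ^+ k.

Lemma return_iter b : iter (b * r) g q = iter (b * k) x q.
Proof.
elim: b => //= b IHb; rewrite !mulSn !iterD IHb.
by rewrite iter_comm // hk -!iterD addnC.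
Qed.

(** As r divides the length l of the cycle of g, the root attached to the orbit has order exactly l
    / r. *)
Lemma orbit_root_expr_eq1 b : (orbit_root ^+ b == 1) = (#|porbit g q| %| b * r)%N.
Proof.
rewrite -iter_fixE return_iter iter_fixE /orbit_root -exprM mulnC.
by rewrite (prim_order_dvd (hz (card_porbit_gt0 x q))).
Qed.

Lemma orbit_root_expr c j : (r %| j)%N -> iter c x q = iter j g q ->
  orbit_root ^+ (j %/ r) = zeta #|porbit x q| ^+ c.
Proof.
move=> rj e; rewrite /orbit_root -exprM mulnC; apply/eqP.
rewrite (eq_prim_root_expr (hz (card_porbit_gt0 x q))) -iter_eqE.
by rewrite -return_iter divnK // e.
Qed.

End OrbitRoot.

(* The root of unity attached to an orbit of two commuting permutations
   determines how the cycles of g are glued by x. *)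
Lemma orbit_root_inj (T : finType) (zeta : nat -> algC) (x x' g : {perm T})
    q r r' k k' c j a :
  prim_roots zeta ->
  (forall v, g (x v) = x (g v)) -> (forall v, g (x' v) = x' (g v)) ->
  (0 < c)%N ->
  (forall a, (iter a g q \in porbit x q) = (r %| a)%N) ->
  (forall a, (iter a g q \in porbit x' q) = (r' %| a)%N) ->
  (forall a, (iter a x q \in porbit g q) = (c %| a)%N) ->
  (forall a, (iter a x' q \in porbit g q) = (c %| a)%N) ->
  iter r g q = iter k x q -> iter r' g q = iter k' x' q ->
  iter c x q = iter j g q -> iter c x' q = iter (j + a) g q ->
  zeta #|porbit x q| ^+ k = zeta #|porbit x' q| ^+ k' ->
  iter a g q = q.
Proof.
move=> hz gx gx' c0 hr hr' hc hc' hk hk' hj hj' ek.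
have rl : (r %| #|porbit g q|)%N.
  by rewrite -hr; have/eqP-> : iter #|porbit g q| g q == q;
     rewrite ?iter_fixE ?porbit_id.
have rl' : (r' %| #|porbit g q|)%N.
  by rewrite -hr'; have/eqP-> : iter #|porbit g q| g q == q;
     rewrite ?iter_fixE ?porbit_id.
have l0 := card_porbit_gt0 g q.
have r0 : (0 < r)%N by apply: dvdn_gt0 rl.
have r0' : (0 < r')%N by apply: dvdn_gt0 rl'.
(* The root has order l / r for x and l / r' for x', so equal roots force r = r'; then [orbit_count]
   gives equal cycle lengths. Finally the root raised to j / r and to (j + a) / r is the same power
   of zeta, so its order l / r divides a / r. *)
have dv b : (#|porbit g q| %| b * r)%N = (#|porbit g q| %| b * r')%N.
  by rewrite -(orbit_root_expr_eq1 hz gx hk) ek (orbit_root_expr_eq1 hz gx' hk').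
have rr : r = r'.
  apply/eqP; rewrite eqn_dvd; apply/andP; split.
    have := dv (#|porbit g q| %/ r)%N; rewrite divnK // dvdnn => /esym.
    rewrite -{1}(divnK rl) dvdn_pmul2l //.
    by rewrite divn_gt0 // dvdn_leq.
  have := dv (#|porbit g q| %/ r')%N; rewrite divnK // dvdnn.
  rewrite -{1}(divnK rl') dvdn_pmul2l //.
  by rewrite divn_gt0 // dvdn_leq.
subst r'.
have ii : #|porbit x q| = #|porbit x' q|.
  apply/eqP; rewrite -(eqn_pmul2r r0) (orbit_count gx c0 hr hc hj).
  by rewrite (orbit_count gx' c0 hr' hc' hj').
have rj : (r %| j)%N by rewrite -hr -hj mem_porbit_iter.
have rja : (r %| j + a)%N by rewrite -hr' -hj' mem_porbit_iter.
have ra : (r %| a)%N by rewrite -(dvdn_addr _ rj).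
have e1 := orbit_root_expr hz gx hk rj hj.
have e2 := orbit_root_expr hz gx' hk' rja hj'.
have z0 := prim_rootX_neq0 k hz (card_porbit_gt0 x q).
move: e2; rewrite -ek -ii -e1 divnDl // exprD.
rewrite -[RHS]mulr1 => /(mulfI (expf_neq0 _ z0)) /eqP.
by rewrite (orbit_root_expr_eq1 hz gx hk) divnK // -iter_fixE => /eqP.
Qed.

(** * The weight of a pair of commuting permutations *)

(* A choice of base points in the cycles of x turns an element commuting with x
   into a collection of shifts; [phase] encodes the base points, and [weight]
   is independent of them (see [weightE]). *)
Definition phase (T : finType) (zeta : nat -> algC) (x : {perm T}) v : algC :=
  zeta #|porbit x v| ^+ findex x (froot x v) v.

Definition weight (T : finType) (zeta : nat -> algC) (D : {set T})
    (x g : {perm T}) : algC :=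
  \prod_(p in D | froot x p == p) (phase zeta x (g p) / phase zeta x p).

Section Weight.

Variables (T : finType) (zeta : nat -> algC) (hz : prim_roots zeta).
Implicit Types (x g h : {perm T}) (D U : {set T}).

Lemma perm_connect_sym x : connect_sym (frel x).
Proof. by apply: fconnect_sym; apply: perm_inj. Qed.

Lemma froot_step x v : froot x (x v) = froot x v.
Proof.
by apply/esym/(fingraph.rootP (perm_connect_sym x)); apply: fconnect1.
Qed.

Lemma froot_iter x a v : froot x (iter a x v) = froot x v.
Proof. by elim: a => //= a <-; rewrite froot_step. Qed.

Lemma froot_idem x v : froot x (froot x v) = froot x v.
Proof. exact/fingraph.root_root/perm_connect_sym. Qed.

Lemma froot_porbit x v : froot x v \in porbit x v.
Proof. by rewrite mem_porbit_fconnect connect_root. Qed.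

Lemma froot_eqP x u v : (froot x u == froot x v) = (v \in porbit x u).
Proof.
by rewrite mem_porbit_fconnect (root_connect (perm_connect_sym x)).
Qed.

Lemma card_porbit_in x u v : u \in porbit x v -> #|porbit x u| = #|porbit x v|.
Proof. by rewrite -eq_porbit_mem => /eqP->. Qed.

Lemma porbit_step x v : #|porbit x (x v)| = #|porbit x v|.
Proof. exact: (porbit_iter x v 1). Qed.

Lemma phase_neq0 x v : phase zeta x v != 0.
Proof. by rewrite prim_rootX_neq0 ?card_porbit_gt0. Qed.

Lemma phase_step x v : phase zeta x (x v) = zeta #|porbit x v| * phase zeta x v.
Proof.
rewrite /phase froot_step porbit_step -exprS; set r := froot x v.
have ev : iter (findex x r v) x r = v.
  by rewrite iter_findex // (perm_connect_sym x) connect_root.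
have -> : x v = iter (findex x r v).+1 x r by rewrite /= ev.
rewrite findex_iter_mod (card_porbit_in (froot_porbit _ _)) prim_expr_mod //.
by apply/hz/card_porbit_gt0.
Qed.

Lemma phase_root x v : froot x v = v -> phase zeta x v = 1.
Proof. by move=> e; rewrite /phase e findex0 expr0. Qed.

Definition preserves (f : T -> T) D := forall v, v \in D -> f v \in D.

Lemma preserves_iter (f : T -> T) D a v : preserves f D -> v \in D -> iter a f v \in D.
Proof. by move=> fD vD; elim: a => //= a; apply: fD. Qed.

Lemma preserves_sub_porbit x D u v : preserves x D -> u \in porbit x v -> v \in D -> u \in D.
Proof. by move=> xD /porbit_iterP[a ->] vD; apply: preserves_iter. Qed.

(** The functions that a choice of base points can produce, up to a factor constant on the cycles of
    x; such a factor cancels in the weight. *)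
Definition is_phase x D (theta : T -> algC) := forall v, v \in D ->
  theta v != 0 /\ theta (x v) = zeta #|porbit x v| * theta v.

Lemma phaseP x D : is_phase x D (phase zeta x).
Proof. by move=> v _; rewrite phase_neq0 phase_step. Qed.

Lemma is_phase_iter x D theta a v : preserves x D -> is_phase x D theta -> v \in D ->
  theta (iter a x v) = zeta #|porbit x v| ^+ a * theta v.
Proof.
move=> xD ph vD; elim: a => [|a IHa] /=; first by rewrite mul1r.
have [_ ->] := ph _ (preserves_iter a xD vD); rewrite IHa porbit_iter.
by rewrite exprS mulrA.
Qed.

Lemma card_porbit_commg x g v : (forall v, g (x v) = x (g v)) ->
  #|porbit x (g v)| = #|porbit x v|.
Proof. by move=> gx; apply: card_porbit_comm => //; apply: perm_inj. Qed.

Lemma reindex_roots (P : finType) x D (R : {pred P}) (e : P -> T) (f : T -> algC) :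
  preserves x D ->
  (forall p, p \in R -> e p \in D) ->
  {in R &, forall p p', e p' \in porbit x (e p) -> p = p'} ->
  (forall v, v \in D -> exists2 p, p \in R & e p \in porbit x v) ->
  \prod_(p in D | froot x p == p) f p = \prod_(p in R) f (froot x (e p)).
Proof.
move=> xD eD einj esurj; pose h p := froot x (e p).
have hinj : {in R &, injective h}.
  by move=> p p' Rp Rp' /eqP; rewrite froot_eqP; apply: einj.
rewrite -(big_imset f hinj); apply: eq_bigl => v.
apply/andP/imsetP => [[vD /eqP rv]|[p Rp ->]].
  have [p Rp ep] := esurj v vD; exists p => //; apply/eqP; rewrite -{1}rv.
  by rewrite froot_eqP.
split; last by rewrite /h froot_idem.
exact: (preserves_sub_porbit xD (froot_porbit x _) (eD _ Rp)).
Qed.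

(** The quotient [rat] of two phases is constant on the cycles of x. As g permutes these cycles, the
    factors [rat p / rat (g p)] multiply to 1. Moreover theta (g v) / theta v depends only on the
    cycle of v, so any transversal [e] of the cycles will do. *)
Lemma weightE (P : finType) x g D (R : {pred P}) (e : P -> T) theta :
  (forall v, g (x v) = x (g v)) -> preserves x D -> preserves g D ->
  is_phase x D theta ->
  (forall p, p \in R -> e p \in D) ->
  {in R &, forall p p', e p' \in porbit x (e p) -> p = p'} ->
  (forall v, v \in D -> exists2 p, p \in R & e p \in porbit x v) ->
  weight zeta D x g = \prod_(p in R) (theta (g (e p)) / theta (e p)).
Proof.
move=> gx xD gD ph eD einj esurj; pose rat v := theta v / phase zeta x v.
have hth v : v \in D -> theta v = rat v * phase zeta x v.
  by move=> vD; rewrite divfK // phase_neq0.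
have ratx v : v \in D -> rat (x v) = rat v.
  move=> vD; rewrite /rat; have [_ ->] := ph v vD; rewrite phase_step -mulf_div.
  rewrite divff ?mul1r //.
  by have := prim_rootX_neq0 1 hz (card_porbit_gt0 x v); rewrite expr1.
have rat_orb u v : v \in D -> u \in porbit x v -> rat u = rat v.
  move=> vD /porbit_iterP[a ->]; elim: a => //= a <-.
  by rewrite ratx // preserves_iter.
have rat0 v : v \in D -> rat v != 0.
  by move=> vD; have [t0 _] := ph v vD; rewrite mulf_neq0 // invr_eq0 phase_neq0.
pose f v := theta (g v) / theta v.
have f_orb u v : v \in D -> u \in porbit x v -> f u = f v.
  move=> vD /porbit_iterP[a ->]; rewrite /f iter_comm1 //.
  rewrite !(is_phase_iter a xD ph) ?gD // card_porbit_commg // -mulf_div divff ?mul1r //.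
  by rewrite prim_rootX_neq0 ?card_porbit_gt0.
transitivity (\prod_(p in D | froot x p == p) f p); last first.
  rewrite (reindex_roots f xD eD einj esurj); apply: eq_bigr => p Rp.
  by apply: f_orb; rewrite ?eD // froot_porbit.
transitivity (\prod_(p in D | froot x p == p)
   (f p * (rat p / rat (g p)))).
  apply: eq_bigr => p /andP[pD _]; rewrite /f (hth p) // (hth (g p)) ?gD //.
  have := rat0 _ pD; have := rat0 _ (gD _ pD).
  have := phase_neq0 x p; set c := phase _ _ p; set d := phase _ _ _.
  set u := rat (g p); set w := rat p => c0 u0 w0.
  by field; rewrite c0 u0 w0.
rewrite big_split /= -[RHS]mulr1; congr (_ * _).
rewrite big_split /= prodfV.
pose h p := g p; pose A := [pred p in D | froot x p == p].
suff e1 : \prod_(p in D | froot x p == p) rat p =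
   \prod_(p in D | froot x p == p) rat (g p).
  by rewrite e1 divff // prodf_seq_neq0; apply/allP=> p _; apply/implyP=> /andP[pD _];
     rewrite rat0 // gD.
rewrite (@reindex_roots _ x D A g rat) //.
- apply: eq_big => [p|p /andP[pD _]]; first by rewrite inE.
  by apply: rat_orb; rewrite ?gD // froot_porbit.
- by move=> p /andP[pD _]; apply: gD.
- move=> p p' /andP[/= _ /eqP rp] /andP[/= _ /eqP rp'] /porbit_iterP[a].
  by rewrite -iter_comm1 // => /perm_inj E; rewrite -rp -rp' E froot_iter.
move=> v vD; have [b eb] : exists b, v = iter b g (iter 1 g v).
  exists #|porbit g v|.-1; rewrite -iterD addn1 prednK ?card_porbit_gt0 //.
  by rewrite iter_porbit.
(* The iterate is the preimage of v under g, written as a power of g so that it stays in D. *)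
exists (froot x (iter #|porbit g v|.-1 g v)).
  rewrite inE /= froot_idem eqxx andbT.
  by rewrite (preserves_sub_porbit xD (froot_porbit x _)) // preserves_iter.
have /porbit_iterP[a ->] := froot_porbit x (iter #|porbit g v|.-1 g v).
rewrite iter_comm1 // -iterS prednK ?card_porbit_gt0 // iter_porbit.
exact: mem_porbit_iter.
Qed.

Lemma weight_neq0 D x g : weight zeta D x g != 0.
Proof.
rewrite prodf_seq_neq0; apply/allP=> p _; apply/implyP=> _.
by rewrite mulf_neq0 ?invr_eq0 ?phase_neq0.
Qed.

Lemma weight1 D x : weight zeta D x 1%g = 1.
Proof. by apply: big1 => p _; rewrite perm1 divff // phase_neq0. Qed.

Lemma weight_id D g : weight zeta D 1%g g = 1.
Proof.
apply: big1 => p _; suff e v : phase zeta (1%g : {perm T}) v = 1.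
  by rewrite !e divr1.
apply: phase_root; have /porbit_iterP[a ->] := froot_porbit 1%g v.
by elim: a => //= a ->; rewrite perm1.
Qed.

(** If the weight of g is computed on the transversal h p, its denominators cancel the numerators of
    the weight of h. *)
Lemma weightM D x g h :
  (forall v, g (x v) = x (g v)) -> (forall v, h (x v) = x (h v)) ->
  preserves x D -> preserves g D -> preserves h D ->
  weight zeta D x (h * g)%g = weight zeta D x h * weight zeta D x g.
Proof.
move=> gx hx xD gD hD; pose A := [pred p in D | froot x p == p].
rewrite [weight zeta D x g](@weightE T x g D A h (phase zeta x)) //.
- rewrite mulrC /weight.
  have -> : \prod_(p in A) (phase zeta x (g (h p)) / phase zeta x (h p)) =
     \prod_(p in D | froot x p == p) (phase zeta x (g (h p)) / phase zeta x (h p)).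
    by apply: eq_bigl => p; rewrite inE.
  rewrite -big_split /=; apply: eq_bigr => p _; rewrite permM.
  by rewrite mulrA divfK // phase_neq0.
- exact: phaseP.
- by move=> p /andP[pD _]; apply: hD.
- move=> p p' /andP[/= _ /eqP rp] /andP[/= _ /eqP rp'] /porbit_iterP[a].
  by rewrite -iter_comm1 // => /perm_inj E; rewrite -rp -rp' E froot_iter.
move=> v vD.
exists (froot x (iter #|porbit h v|.-1 h v)).
  rewrite inE /= froot_idem eqxx andbT.
  by rewrite (preserves_sub_porbit xD (froot_porbit x _)) // preserves_iter.
have /porbit_iterP[a ->] := froot_porbit x (iter #|porbit h v|.-1 h v).
rewrite iter_comm1 // -iterS prednK ?card_porbit_gt0 // iter_porbit.
exact: mem_porbit_iter.
Qed.

Lemma weight_split D U x g : U \subset D ->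
  weight zeta D x g = weight zeta U x g * weight zeta (D :\: U) x g.
Proof.
move=> /subsetP UD; rewrite /weight (bigID [in U]) /=; congr (_ * _); apply: eq_bigl => p.
  by rewrite andbAC; case: (boolP (p \in U)) => [/UD->|]; rewrite ?andbT ?andbF.
by rewrite inE andbAC [(_ \in D) && _]andbC.
Qed.

Lemma eq_weight D x x' g :
  (forall v, g (x v) = x (g v)) -> (forall v, g (x' v) = x' (g v)) ->
  preserves x D -> preserves g D -> (forall v, v \in D -> x' v = x v) ->
  weight zeta D x' g = weight zeta D x g.
Proof.
move=> gx gx' xD gD e.
have x'D : preserves x' D by move=> v vD; rewrite e // xD.
have it a v : v \in D -> iter a x' v = iter a x v.
  by move=> vD; elim: a => //= a ->; rewrite e // preserves_iter.
have orb v : v \in D -> porbit x' v = porbit x v.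
  move=> vD; apply/setP=> u; apply/porbit_iterP/porbit_iterP=> -[a ->].
    by exists a; rewrite it.
  by exists a; rewrite it.
pose A := [pred p in D | froot x p == p].
rewrite (@weightE T x' g D A id (phase zeta x)) //.
- by move=> v vD; rewrite phase_neq0 orb // e // phase_step.
- by move=> p /andP[].
- move=> p p' /andP[/= pD /eqP rp] /andP[/= _ /eqP rp'].
  by rewrite orb // -froot_eqP rp rp' => /eqP.
move=> v vD; exists (froot x v); last by rewrite orb // froot_porbit.
by rewrite inE /= froot_idem eqxx andbT (preserves_sub_porbit xD (froot_porbit x _)).
Qed.

(** For commuting x and g this is the orbit of q under the group they generate. *)
Definition biorbit x g q := \bigcup_(w in porbit g q) porbit x w.

Lemma biorbitP x g q v :
  reflect (exists a b, v = iter a x (iter b g q)) (v \in biorbit x g q).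
Proof.
apply: (iffP (bigcupP)) => [[w /porbit_iterP[b ->] /porbit_iterP[a ->]]|].
  by exists a, b.
case=> a [b ->]; exists (iter b g q); exact: mem_porbit_iter.
Qed.

(** The points g^t q with t < r form a transversal of the x-cycles in the orbit, and on it the
    product telescopes to phase (g^r q) / phase q. *)
Lemma weight_biorbit x g q r k :
  (forall v, g (x v) = x (g v)) ->
  (forall a, (iter a g q \in porbit x q) = (r %| a)%N) -> (0 < r)%N ->
  iter r g q = iter k x q ->
  weight zeta (biorbit x g q) x g = zeta #|porbit x q| ^+ k.
Proof.
move=> gx hr r0 hk; set U := biorbit x g q.
have xU : preserves x U.
  by move=> v /biorbitP[a [b ->]]; apply/biorbitP; exists a.+1, b.
have gU : preserves g U.
  move=> v /biorbitP[a [b ->]]; apply/biorbitP; exists a, b.+1.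
  by rewrite iter_comm1.
have qU : q \in U by apply/biorbitP; exists 0%N, 0%N.
have gqU a : iter a g q \in U by apply/biorbitP; exists 0%N, a.
have gg (a b : nat) : iter a g q \in porbit x (iter b g q) -> a = b %[mod r].
  wlog ab : a b / (b <= a)%N.
    move=> IH; case/orP: (leq_total b a) => ab h; first exact: IH.
    by apply/esym/IH => //; rewrite porbit_sym.
  rewrite -{1}(subnKC ab) iterD => /porbit_iterP[c].
  rewrite -(iter_comm b c q gx) => /(@iter_perm_inj _ _ _) E; apply/eqP; rewrite eqn_mod_dvd //.
  by rewrite -hr E mem_porbit_iter.
rewrite (@weightE 'I_r x g U predT (fun t => iter t g q) (phase zeta x)) //.
- rewrite -(big_mkord predT (fun t => phase zeta x (g (iter t g q)) /
     phase zeta x (iter t g q))).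
  rewrite (telescope_prodf (f := fun t => phase zeta x (iter t g q))) //=.
  + rewrite hk (is_phase_iter k xU (@phaseP x U)) //.
    by rewrite mulfK // phase_neq0.
  by move=> t _; exact: phase_neq0.
- exact: phaseP.
- move=> t t' _ _ /gg /eqP; rewrite !modn_small // => /eqP e.
  exact/val_inj/esym.
move=> _ /biorbitP[a [b ->]]; exists (Ordinal (ltn_pmod b r0)) => //=.
rewrite -eq_porbit_mem.
have -> : porbit x (iter a x (iter b g q)) = porbit x (iter b g q).
  by apply/eqP; rewrite eq_porbit_mem mem_porbit_iter.
rewrite eq_porbit_mem porbit_sym {1}(divn_eq b r) addnC iterD.
have /porbit_iterP[d ->] : iter (b %/ r * r) g q \in porbit x q.
  by rewrite hr dvdn_mull.
by rewrite iter_comm // mem_porbit_iter.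
Qed.

End Weight.

(** The values are all the roots of X^N - c, so their sum is minus the coefficient of X^(N-1), which
    is 0 for N > 1. *)
Lemma sum_distinct_roots (N : nat) (f : 'I_N -> algC) (c : algC) :
  (1 < N)%N -> injective f -> (forall t, f t ^+ N = c) -> \sum_t f t = 0.
Proof.
move=> N1 finj fN; have N0 : (0 < N)%N by apply: ltnW.
pose rs := [seq f t | t <- enum 'I_N].
have szrs : size rs = N by rewrite size_map size_enum_ord.
have sz : size ('X^N - c%:P : {poly algC}) = N.+1 by rewrite size_XnsubC.
have := @all_roots_prod_XsubC _ ('X^N - c%:P) rs.
rewrite szrs sz => /(_ erefl) h.
have {h} : 'X^N - c%:P = \prod_(z <- rs) ('X - z%:P).
  rewrite h ?(monicP (monicXnsubC c N0)) ?scale1r //.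
    by apply/allP=> _ /mapP[t _ ->]; rewrite rootE !hornerE fN subrr.
  by rewrite uniq_rootsE map_inj_uniq ?enum_uniq.
move/(congr1 (fun p : {poly algC} => p`_N.-1)).
have := @coefPn_prod_XsubC _ rs; rewrite szrs -lt0n => /(_ N0) -> .
rewrite coefB coefXn coefC.
rewrite ltn_eqF ?prednK // -[_ == 0%N]negbK -lt0n -ltnS prednK // N1 subr0.
by move/esym/eqP; rewrite oppr_eq0 /rs big_map big_enum => /eqP.
Qed.

Lemma preserves_setD (T : finType) (x : {perm T}) (D U : {set T}) :
  preserves x D -> preserves x U -> preserves x (D :\: U).
Proof.
move=> xD xU v /setDP[vD vU]; apply/setDP; split; first exact: xD.
apply: contra vU => xvU; rewrite -(iter_porbit x v) -[#|_|]prednK ?card_porbit_gt0 //.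
by rewrite iterSr preserves_iter.
Qed.

(** * Twisting x by a power of g along one cycle of g *)

Section Twist.

Variables (T : finType) (zeta : nat -> algC) (hz : prim_roots zeta).
Variables (D : {set T}) (g : {perm T}).
Implicit Types (x : {perm T}).

Lemma preserves_biorbitl x q :
  preserves x (biorbit x g q).
Proof. by move=> v /biorbitP[a [b ->]]; apply/biorbitP; exists a.+1, b. Qed.

Lemma preserves_biorbitr x q : (forall v, g (x v) = x (g v)) ->
  preserves g (biorbit x g q).
Proof.
move=> gx v /biorbitP[a [b ->]]; apply/biorbitP; exists a, b.+1.
by rewrite iter_comm1.
Qed.

Lemma biorbit_id x q : q \in biorbit x g q.
Proof. by apply/biorbitP; exists 0%N, 0%N. Qed.

Lemma sub_biorbit x q : preserves x D -> preserves g D -> q \in D ->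
  biorbit x g q \subset D.
Proof.
by move=> xD gD qD; apply/subsetP=> v /biorbitP[a [b ->]]; rewrite !preserves_iter.
Qed.

Lemma iter_mod_porbit x x' v t :
  (forall v, g (x v) = x (g v)) -> preserves x D -> preserves g D ->
  (forall v, v \in D -> x' v \in porbit g (x v)) ->
  v \in D -> iter t x' v \in porbit g (iter t x v).
Proof.
move=> gx xD gD hx vD; elim: t => [|t IHt] /=; first exact: porbit_id.
have wD : iter t x v \in D by apply: preserves_iter.
have [b eb] : exists b, iter t x' v = iter b g (iter t x v) by apply/porbit_iterP.
have /hx : iter t x' v \in D by rewrite eb preserves_iter.
have xg u : x (g u) = g (x u) by [].
by case/porbit_iterP=> d ->; rewrite eb (iter_comm1 _ _ xg) -iterD mem_porbit_iter.
Qed.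

Lemma sub_biorbit_mod x x' q :
  (forall v, g (x v) = x (g v)) -> preserves x D -> preserves g D -> q \in D ->
  (forall v, v \in D -> x' v \in porbit g (x v)) ->
  biorbit x' g q \subset biorbit x g q.
Proof.
move=> gx xD gD qD hx; apply/subsetP=> v /biorbitP[a [b ->]].
have := @iter_mod_porbit x x' (iter b g q) a gx xD gD hx (preserves_iter b gD qD).
case/porbit_iterP=> d ->; apply/biorbitP; exists a, (d + b)%N.
by rewrite -iter_comm // -iterD.
Qed.

(** The twist leaves the orbit of q unchanged as a set and does not touch x elsewhere, so the two
    weights share the factor R of the complement. The factors k and k' of the orbit are separated by
    [orbit_root_inj]; their orders divide the lengths of the cycles of both permutations. *)
Lemma weight_twist x x' q a :
  (forall v, g (x v) = x (g v)) -> (forall v, g (x' v) = x' (g v)) ->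
  preserves x D -> preserves x' D -> preserves g D -> q \in D ->
  (forall v, v \in porbit g q -> x' v = x (iter a g v)) ->
  (forall v, v \in D -> v \notin porbit g q -> x' v = x v) ->
  exists R k k' : algC,
   [/\ weight zeta D x g = R * k, weight zeta D x' g = R * k', R != 0 &
     [/\ k ^+ #|porbit g q| = 1, k ^+ #|porbit x q| = 1,
         k' ^+ #|porbit g q| = 1, k' ^+ #|porbit x' q| = 1 &
         k = k' -> iter a g q = q]].
Proof.
move=> gx gx' xD x'D gD qD xC xO.
have xg v : x (g v) = g (x v) by [].
have hx v : v \in D -> x' v \in porbit g (x v).
  move=> vD; have [/xC->|/xO->//] := boolP (v \in porbit g q).
    by rewrite (iter_comm1 _ _ xg) mem_porbit_iter.
  exact: porbit_id.
have hx' v : v \in D -> x v \in porbit g (x' v) by move=> vD; rewrite porbit_sym hx.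
have UU : biorbit x' g q = biorbit x g q.
  by apply/eqP; rewrite eqEsubset !sub_biorbit_mod.
have [r r0 hr] := return_time q gx.
have [r' r'0 hr'] := return_time q gx'.
have [c c0 hc] := @return_time _ g x q xg.
have hc' t : (iter t x' q \in porbit g q) = (c %| t)%N.
  rewrite -hc -!eq_porbit_mem; congr (_ == _); apply/eqP.
  by rewrite eq_porbit_mem iter_mod_porbit.
have [k hk] : exists k, iter r g q = iter k x q by apply/porbit_iterP; rewrite hr.
have [k' hk'] : exists k, iter r' g q = iter k x' q by apply/porbit_iterP; rewrite hr'.
have [j hj] : exists j, iter c x q = iter j g q by apply/porbit_iterP; rewrite hc.
(* The path from q to its first return x^c q meets the twisted cycle only at its start, so the twist
   enters exactly once and shifts the return by a. *)
have hj' : iter c x' q = iter (j + a) g q.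
  suff e t : (t < c)%N -> iter t.+1 x' q = iter t.+1 x (iter a g q).
    rewrite -[c]prednK // e ?prednK // -iter_comm // hj -iterD addnC //.
  elim: t => [|t IHt] tc /=; first by rewrite xC ?porbit_id.
  rewrite -/(iter t.+1 x' q) IHt; last exact: ltnW.
  rewrite xO //; first by rewrite !preserves_iter.
  rewrite -iter_comm // -eq_porbit_mem.
  have -> : porbit g (iter a g (iter t.+1 x q)) = porbit g (iter t.+1 x q).
    by apply/eqP; rewrite eq_porbit_mem mem_porbit_iter.
  by rewrite eq_porbit_mem hc gtnNdvd.
have UD := sub_biorbit xD gD qD.
have UxD := preserves_setD xD (@preserves_biorbitl x q).
have UgD := preserves_setD gD (preserves_biorbitr (q := q) gx).
exists (weight zeta (D :\: biorbit x g q) x g).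
exists (zeta #|porbit x q| ^+ k), (zeta #|porbit x' q| ^+ k').
split; last split.
- by rewrite (weight_split _ _ _ UD) (weight_biorbit hz gx hr r0 hk) // mulrC.
- rewrite (weight_split _ _ _ UD) -{1}UU (weight_biorbit hz gx' hr' r'0 hk') // mulrC.
  congr (_ * _); apply: eq_weight => // v /setDP[vD vU]; apply: xO => //.
  apply: contra vU => /porbit_iterP[b ->].
  by apply/biorbitP; exists 0%N, b.
- exact: weight_neq0.
- by apply/eqP; rewrite (orbit_root_expr_eq1 hz gx hk) dvdn_mulr.
- by rewrite exprAC (prim_expr_order (hz (card_porbit_gt0 x q))) expr1n.
- by apply/eqP; rewrite (orbit_root_expr_eq1 hz gx' hk') dvdn_mulr.
- by rewrite exprAC (prim_expr_order (hz (card_porbit_gt0 x' q))) expr1n.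
- exact: (orbit_root_inj hz gx gx' c0 hr hr' hc hc' hk hk' hj hj').
Qed.

End Twist.

(** * Restriction of permutations *)

Section Restr.

Variable T : finType.
Implicit Types (x y z g h : {perm T}) (S : {set T}).

Lemma perm_preserves z S : preserves z S -> forall v, (z v \in S) = (v \in S).
Proof.
move=> zS v; apply/idP/idP => [zv|]; last exact: zS.
rewrite -(iter_porbit z v) -[#|_|]prednK ?card_porbit_gt0 // iterSr.
exact: preserves_iter.
Qed.

Lemma restrE z S v : preserves z S ->
  restr_perm S z v = if v \in S then z v else v.
Proof.
move=> zS; have nz : z \in 'N(S | 'P)%g.
  by apply/astabsP=> w; rewrite /= apermE perm_preserves.
case: ifP => [vS|/negbT vS]; first by rewrite restr_permE.
by rewrite (out_perm (restr_perm_on S z)).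
Qed.

Lemma iter_restr z S v a : preserves z S ->
  iter a (restr_perm S z) v = if v \in S then iter a z v else v.
Proof.
move=> zS; case: ifP => vS; elim: a => //= a ->; rewrite restrE ?vS //.
by rewrite preserves_iter.
Qed.

Lemma preserves_restr z S : preserves z S -> preserves (restr_perm S z) S.
Proof. by move=> zS v vS; rewrite restrE // vS zS. Qed.

Lemma restr_comm h z S : preserves h S -> preserves z S ->
  (forall v, h (z v) = z (h v)) ->
  forall v, h (restr_perm S z v) = restr_perm S z (h v).
Proof.
move=> hS zS hz v; rewrite !restrE // perm_preserves //.
by case: ifP.
Qed.

Lemma preserves_porbit x q : preserves x (porbit x q).
Proof.
by move=> v /porbit_iterP[a ->]; rewrite -iterS mem_porbit_iter.
Qed.

End Restr.

(** * Weights relative to an involution *)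

Section Hat.

Variable T : finType.
Implicit Types (x y z g h t : {perm T}) (S A : {set T}).

Definition hat x : {perm {set T}} := perm (imset_inj (@perm_inj _ x)).

Lemma hatE x A : hat x A = x @: A.
Proof. by rewrite permE. Qed.

Lemma hatM x y : hat (x * y)%g = (hat x * hat y)%g.
Proof.
apply/permP=> A; rewrite permM !hatE -imset_comp.
by apply: eq_imset => v; rewrite /= permM.
Qed.

Lemma hat1 : hat 1%g = 1%g.
Proof.
by apply/permP=> A; rewrite perm1 hatE (eq_imset (g := id)) ?imset_id // => v; rewrite perm1.
Qed.

Lemma hat_comm x g : (forall v, g (x v) = x (g v)) ->
  forall A, hat g (hat x A) = hat x (hat g A).
Proof.
by move=> gx A; rewrite -!permM -!hatM; congr (hat _ _); apply/permP=> v; rewrite !permM.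
Qed.

(* The quotient of T by an involution t is modelled by the sets {v, t v}, on
   which a permutation x commuting with t acts through [hat x]. *)
Definition blk t v : {set T} := [set v; t v].

Definition blocks t S := [set blk t v | v in S].

Lemma hat_blk t x v : (forall v, t (x v) = x (t v)) ->
  hat x (blk t v) = blk t (x v).
Proof. by move=> tx; rewrite hatE imsetU1 imset_set1 -tx. Qed.

Lemma iter_hat_blk t x v a : (forall v, t (x v) = x (t v)) ->
  iter a (hat x) (blk t v) = blk t (iter a x v).
Proof. by move=> tx; elim: a => //= a ->; rewrite hat_blk. Qed.

Lemma blk_eqP t u v : involutive t ->
  reflect (u = v \/ u = t v) (blk t u == blk t v).
Proof.
move=> tt; apply: (iffP eqP) => [/setP/(_ u)|[->|->]] //.
  by rewrite !inE eqxx => /esym/orP[]/eqP; [left|right].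
by rewrite /blk tt setUC.
Qed.

Lemma hat_preserves t x S : (forall v, t (x v) = x (t v)) -> preserves x S ->
  preserves (hat x) (blocks t S).
Proof.
by move=> tx xS _ /imsetP[v vS ->]; rewrite hat_blk // imset_f // xS.
Qed.

Lemma blk_in t v : blk t v \in blocks t [set: T].
Proof. by rewrite imset_f. Qed.

Lemma hat_preservesT t x : (forall v, t (x v) = x (t v)) ->
  preserves (hat x) (blocks t [set: T]).
Proof. by move=> tx; apply: hat_preserves. Qed.

(** For t = 1 the blocks are singletons and this is the character of the symmetric group; for t the
    negation it is the character of B_m, which is trivial on the sign factors ([omegaS_wt],
    [omegaB_wt]). *)
Definition wt (zeta : nat -> algC) t x g :=
  weight zeta (blocks t [set: T]) (hat x) (hat g).

Lemma dvdn_card_porbit_blk t x v : (forall v, t (x v) = x (t v)) ->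
  (#|porbit (hat x) (blk t v)| %| #|porbit x v|)%N.
Proof. by move=> tx; rewrite -iter_fixE iter_hat_blk // iter_porbit. Qed.

Variables (zeta : nat -> algC) (hz : prim_roots zeta).

Lemma wtM t x g h : (forall v, t (x v) = x (t v)) ->
  (forall v, t (g v) = g (t v)) -> (forall v, t (h v) = h (t v)) ->
  (forall v, g (x v) = x (g v)) -> (forall v, h (x v) = x (h v)) ->
  wt zeta t x (h * g)%g = wt zeta t x h * wt zeta t x g.
Proof.
move=> tx tg th gx hx; rewrite /wt hatM weightM //; try exact: hat_comm.
all: exact: hat_preservesT.
Qed.

Lemma wt1 t x : wt zeta t x 1%g = 1.
Proof. by rewrite /wt hat1 weight1. Qed.

Lemma wt_id t g : wt zeta t 1%g g = 1.
Proof. by rewrite /wt hat1 weight_id. Qed.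

Lemma expr_gcd_eq1 (k : algC) a b : (0 < a)%N ->
  k ^+ a = 1 -> k ^+ b = 1 -> k ^+ gcdn a b = 1.
Proof.
move=> a0 ka kb; have [m km _] := prim_order_exists a0 ka.
apply/eqP; rewrite -(prim_order_dvd km) dvdn_gcd !(prim_order_dvd km) ka kb.
by rewrite !eqxx.
Qed.

Lemma expr_dvd_eq1 (k : algC) a b : k ^+ a = 1 -> (a %| b)%N -> k ^+ b = 1.
Proof. by move=> ka /dvdnP[c ->]; rewrite mulnC exprM ka expr1n. Qed.

(** * Averages over twists that commute with an involution *)

Section Average.

Variables (t g u x : {perm T}) (q : T) (E N : nat).
Hypotheses (tt : involutive t) (tg : forall v, t (g v) = g (t v)).
Hypotheses (gx : forall v, g (x v) = x (g v)) (tx : forall v, t (x v) = x (t v)).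
Hypothesis uE : forall v, u v = iter E g v.

(** The twist has to commute with t, so it is made on a cycle of g and on its image under t at once;
    on the blocks these form a single cycle of [hat g]. *)
Definition two_cycles := porbit g q :|: t @: porbit g q.
Let y := restr_perm two_cycles u.

Lemma two_cycles_g : preserves g two_cycles.
Proof.
move=> v /setUP[vC|/imsetP[w wC ->]]; apply/setUP; [left|right].
  exact: preserves_porbit.
by rewrite -tg imset_f // preserves_porbit.
Qed.

Lemma two_cycles_t : preserves t two_cycles.
Proof.
move=> v /setUP[vC|/imsetP[w wC ->]]; apply/setUP; [right|left].
  exact: imset_f.
by rewrite tt.
Qed.

Lemma two_cycles_u : preserves u two_cycles.
Proof. by move=> v vS; rewrite uE; apply: preserves_iter => //; apply: two_cycles_g. Qed.

Lemma twist_g v : g (y v) = y (g v).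
Proof.
apply: restr_comm; [exact: two_cycles_g|exact: two_cycles_u|].
by move=> w; rewrite !uE -iterS iterSr.
Qed.

Lemma twist_t v : t (y v) = y (t v).
Proof.
apply: restr_comm; [exact: two_cycles_t|exact: two_cycles_u|].
by move=> w; rewrite !uE iter_comm1.
Qed.

Lemma twistE v : y v = if v \in two_cycles then u v else v.
Proof. by rewrite restrE //; apply: two_cycles_u. Qed.

Lemma iter_twistE a v : iter a y v = if v \in two_cycles then iter a u v else v.
Proof. by rewrite iter_restr //; apply: two_cycles_u. Qed.

Lemma iter_u a v : iter a u v = iter (a * E) g v.
Proof. by elim: a => //= a ->; rewrite uE mulSn iterD. Qed.

Hypotheses (N1 : (1 < N)%N) (uN : forall a, iter a u q \in blk t q -> (N %| a)%N).
Hypothesis gcdN : forall a : nat,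
  (gcdn #|porbit g q| #|porbit (y ^+ a * x)%g q| %| N)%N.

(** Only one factor of the weight varies with a. By [uN] its N values are distinct. Its order
    divides the lengths of the cycles of g and of the twisted x at q, so by [gcdN] its N-th power is
    1 and [sum_distinct_roots] applies. The gcd condition covers both the full twist by g and the
    twist by its 2'-part, where N can be smaller than the cycle length. *)
Lemma wt_average : \sum_(a < N) wt zeta t (y ^+ a * x)%g g = 0.
Proof.
pose f a := wt zeta t (y ^+ a * x)%g g; pose X a := (y ^+ a * x)%g.
have XE a v : X a v = x (iter a y v) by rewrite /X permM permX.
have gX a v : g (X a v) = X a (g v).
  by rewrite !XE gx iter_comm1 //; apply: twist_g.
have tX a v : t (X a v) = X a (t v).
  by rewrite !XE tx iter_comm1 //; apply: twist_t.
have key (s a : nat) : (s <= a)%N -> exists R k k' : algC,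
    [/\ f s = R * k, f a = R * k', R != 0 & [/\ k ^+ N = 1, k' ^+ N = 1 &
      k = k' -> (N %| a - s)%N]].
  move=> sa.
  have [||||||||R [k [k' [e1 e2 R0 [h1 h2 h3 h4 h5]]]]] :=
    @weight_twist _ zeta hz (blocks t [set: T]) (hat g) (hat (X s)) (hat (X a))
      (blk t q) ((a - s) * E).
  - exact: hat_comm.
  - exact: hat_comm.
  - exact: hat_preservesT.
  - exact: hat_preservesT.
  - exact: hat_preservesT.
  - exact: blk_in.
  - move=> _ /porbit_iterP[b ->]; rewrite -iterD !iter_hat_blk // !hat_blk //.
    congr blk; have inS d : iter d g q \in two_cycles.
      by rewrite inE mem_porbit_iter.
    rewrite !XE !iter_twistE !inS !iter_u -!iterD; congr (x (iter _ g q)).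
    by rewrite addnA -mulnDl subnKC.
  - move=> _ /imsetP[v _ ->] nv; rewrite !hat_blk //; congr blk.
    have vS : v \notin two_cycles.
      apply: contra nv => /setUP[/porbit_iterP[b ->]|/imsetP[_ /porbit_iterP[b ->] ->]].
        by apply/porbit_iterP; exists b; rewrite iter_hat_blk.
      apply/porbit_iterP; exists b; rewrite iter_hat_blk //.
      by apply/eqP/blk_eqP => //; right.
    by rewrite !XE !iter_twistE (negPf vS).
  exists R, k, k'; split=> //; split.
  - apply: expr_dvd_eq1 (gcdN s); apply: expr_gcd_eq1; rewrite ?card_porbit_gt0 //.
      exact: expr_dvd_eq1 h1 (dvdn_card_porbit_blk _ _).
    by apply: expr_dvd_eq1 h2 (dvdn_card_porbit_blk _ _).
  - apply: expr_dvd_eq1 (gcdN a); apply: expr_gcd_eq1; rewrite ?card_porbit_gt0 //.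
      exact: expr_dvd_eq1 h3 (dvdn_card_porbit_blk _ _).
    by apply: expr_dvd_eq1 h4 (dvdn_card_porbit_blk _ _).
  move=> /h5; rewrite iter_hat_blk // => e; apply: uN.
  by rewrite iter_u -e !inE eqxx.
apply: (@sum_distinct_roots N (fun a : 'I_N => f a) (f 0%N ^+ N)) => //.
- move=> a b /= eab; wlog ba : a b eab / (b <= a)%N.
    by move=> IH; case/orP: (leq_total a b) => h; [apply/esym|]; apply: IH.
  have [R [k [k' [e1 e2 R0 [_ _ h]]]]] := key _ _ ba.
  have /h : k = k' by apply: (mulfI R0); rewrite -e1 -e2 eab.
  rewrite -eqn_mod_dvd // !modn_small // => /eqP e; exact: val_inj.
move=> a; have [R [k [k' [e1 e2 R0 [h1 h2 _]]]]] := key _ _ (leq0n a).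
by rewrite e1 e2 !exprMn h1 h2.
Qed.

End Average.

(** X is finite and stable under the injective left multiplication by y, so each of the N translated
    sums equals the sum over X. *)
Lemma sum_translate0 (X : {set {perm T}}) (f : {perm T} -> algC) y N :
  (0 < N)%N -> {in X, forall x, (y * x)%g \in X} ->
  {in X, forall x, \sum_(a < N) f (y ^+ a * x)%g = 0} ->
  \sum_(x in X) f x = 0.
Proof.
move=> N0 yX h; have eX a x : ((y ^+ a * x)%g \in X) = (x \in X).
  elim: a => [|a IHa]; first by rewrite expg0 mul1g.
  rewrite expgS -mulgA -IHa; set z := (_ * x)%g.
  suff /setP/(_ (y * z)%g) <- : [set (y * w)%g | w in X] = X.
    by apply/imsetP/idP => [[w wX /mulgI->//]|zX]; exists z.
  apply/eqP; rewrite eqEcard card_imset ?leqnn ?andbT; last exact: mulgI.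
  by apply/subsetP=> _ /imsetP[w wX ->]; apply: yX.
have : \sum_(a < N) \sum_(x in X) f (y ^+ a * x)%g = 0.
  by rewrite exchange_big big1.
rewrite (eq_bigr (fun=> \sum_(x in X) f x)) => [|a _]; last first.
  rewrite [RHS](reindex_inj (mulgI (y ^+ a)%g)) /=.
  by apply: eq_bigl => x; rewrite eX.
rewrite sumr_const card_ord => /eqP.
by rewrite Num.Theory.mulrn_eq0 gtn_eqF // => /eqP.
Qed.

End Hat.

(** * Orbits of commuting pairs and the sign-reversing flip *)

Section Biorbit.

Variable T : finType.
Implicit Types (x g t : {perm T}) (v w : T).

Lemma iter_undo x a v : exists b, iter b x (iter a x v) = v.
Proof.
exists (a * #|porbit x v|.-1)%N; rewrite -iterD -{2}[a]muln1 -mulnDr addn1.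
by rewrite prednK ?card_porbit_gt0 //; apply/eqP; rewrite iter_fixE dvdn_mull.
Qed.

Lemma biorbit_sub x g v w : (forall v, g (x v) = x (g v)) ->
  w \in biorbit x g v -> biorbit x g w \subset biorbit x g v.
Proof.
move=> gx /biorbitP[a [b ->]]; apply/subsetP=> _ /biorbitP[c [d ->]].
apply/biorbitP; exists (c + a)%N, (d + b)%N.
by rewrite [iter d g _]iter_comm // -!iterD.
Qed.

Lemma biorbit_sym x g v w : (forall v, g (x v) = x (g v)) ->
  w \in biorbit x g v -> v \in biorbit x g w.
Proof.
move=> gx /biorbitP[a [b ->]]; have [c ec] := iter_undo x a (iter b g v).
have [d ed] := iter_undo g b v; apply/biorbitP; exists c, d.
by rewrite -iter_comm // ec ed.
Qed.

Lemma biorbit_eq x g v w : (forall v, g (x v) = x (g v)) ->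
  w \in biorbit x g v -> biorbit x g w = biorbit x g v.
Proof.
move=> gx wU; apply/eqP; rewrite eqEsubset !biorbit_sub //.
exact: biorbit_sym.
Qed.

Lemma porbit_sub_biorbit x g v w : w \in porbit x v -> w \in biorbit x g v.
Proof. by case/porbit_iterP=> a ->; apply/biorbitP; exists a, 0%N. Qed.

Lemma porbit_sub_biorbitr x g v w : w \in porbit g v -> w \in biorbit x g v.
Proof. by case/porbit_iterP=> a ->; apply/biorbitP; exists 0%N, a. Qed.

Lemma card_porbit_biorbit x g v w : (forall v, g (x v) = x (g v)) ->
  w \in biorbit x g v -> #|porbit x w| = #|porbit x v|.
Proof.
move=> gx /biorbitP[a [b ->]]; rewrite porbit_iter.
by elim: b => //= b <-; rewrite card_porbit_commg.
Qed.

Lemma preserves_biorbit x g t v :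
  (forall v, t (x v) = x (t v)) -> (forall v, t (g v) = g (t v)) ->
  (forall v, g (x v) = x (g v)) ->
  t v \in biorbit x g v -> preserves t (biorbit x g v).
Proof.
move=> tx tg gx tv w /biorbitP[a [b ->]]; rewrite (iter_comm1 _ _ tx) (iter_comm1 _ _ tg).
apply: preserves_iter; first exact: preserves_biorbitl.
by apply: preserves_iter => //; apply: preserves_biorbitr.
Qed.

Lemma card_porbit_blk x t v : involutive t -> (forall v, t (x v) = x (t v)) ->
  t v \notin porbit x v -> #|porbit (hat x) (blk t v)| = #|porbit x v|.
Proof.
move=> tt tx tv; apply/eqP; rewrite eqn_dvd dvdn_card_porbit_blk //=.
rewrite -iter_fixE; have := iter_porbit (hat x) (blk t v).
rewrite iter_hat_blk // => /eqP/(blk_eqP _ _ tt)[->//|e].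
by rewrite -e mem_porbit_iter in tv.
Qed.

Lemma mem_porbit_blk x g t v a : involutive t ->
  (forall v, t (x v) = x (t v)) -> (forall v, t (g v) = g (t v)) ->
  reflect (exists b, iter a g v = iter b x v \/ iter a g v = t (iter b x v))
    (iter a (hat g) (blk t v) \in porbit (hat x) (blk t v)).
Proof.
move=> tt tx tg; apply: (iffP (porbit_iterP _ _ _)) => -[b e]; exists b.
  by move: e; rewrite !iter_hat_blk // => /eqP/(blk_eqP _ _ tt).
by rewrite !iter_hat_blk //; apply/eqP/blk_eqP.
Qed.

End Biorbit.

Section Flip.

Variables (T : finType) (zeta : nat -> algC) (hz : prim_roots zeta).
Variables (x g : {perm T}) (gx : forall v, g (x v) = x (g v)).
Implicit Types (t : {perm T}) (v w : T).

(* The cycles of x are positive relative to t; a fixed point of t is allowed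
   provided that x fixes it, as for the odd point of S_(2m+1). *)
Definition positive t := [forall v, (t v \in porbit x v) ==> (x v == v)].

(** All cycles of x in the orbit of v have the same length, so one exponent serves the whole orbit;
    when that length is even, this is an involution without fixed points on the orbit. *)
Definition flip v : {perm T} :=
  restr_perm (biorbit x g v) (x ^+ (#|porbit x v|./2))%g.

Lemma flipE v w : flip v w =
  if w \in biorbit x g v then iter (#|porbit x v|./2) x w else w.
Proof.
rewrite restrE ?permX // => {}w wU; rewrite permX.
by apply: preserves_iter => //; apply: preserves_biorbitl.
Qed.

Variables (t : {perm T}) (v : T).
Hypotheses (tt : involutive t) (tx : forall v, t (x v) = x (t v)).
Hypotheses (tg : forall v, t (g v) = g (t v)) (tpos : positive t).
Hypotheses (tv : t v \in biorbit x g v) (ev : ~~ odd #|porbit x v|).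

Let U := biorbit x g v.
Let h := (#|porbit x v|./2)%N.
Let t' := (t * flip v)%g.

Let tU w : (t w \in U) = (w \in U).
Proof. exact/perm_preserves/preserves_biorbit. Qed.

Lemma flip_tE w : t' w = if w \in U then t (iter h x w) else t w.
Proof. by rewrite permM flipE tU; case: ifP => // _; rewrite iter_comm1. Qed.

Let gU w : (g w \in U) = (w \in U).
Proof. exact/perm_preserves/preserves_biorbitr. Qed.

Let xU w : (x w \in U) = (w \in U).
Proof. exact/perm_preserves/preserves_biorbitl. Qed.

Let iterU a w : (iter a x w \in U) = (w \in U).
Proof. by elim: a => //= a <-; apply: xU. Qed.

Let hh w : w \in U -> iter h x (iter h x w) = w.
Proof.
move=> wU; rewrite -iterD addnn; have:= odd_double_half #|porbit x v|.
rewrite (negPf ev) add0n -/h => ->; apply/eqP.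
by rewrite iter_fixE (card_porbit_biorbit gx wU).
Qed.

Lemma flip_invol : involutive t'.
Proof.
move=> w; rewrite [t' w]flip_tE; case: (boolP (w \in U)) => wU.
  by rewrite flip_tE tU iterU wU -iter_comm1 // tt hh.
by rewrite flip_tE tU (negPf wU) tt.
Qed.

Lemma flip_comm_x w : t' (x w) = x (t' w).
Proof.
by rewrite !flip_tE xU; case: ifP => _; rewrite -?iterSr ?iterS tx.
Qed.

Lemma flip_comm_g w : t' (g w) = g (t' w).
Proof.
rewrite !flip_tE gU; case: ifP => _; rewrite -?tg //.
by rewrite [g (iter h x w)]iter_comm1.
Qed.

Let porbit_even w : w \in U -> x w != w.
Proof.
move=> wU; apply: contra ev; rewrite -(card_porbit_biorbit gx wU).
by move/eqP=> e; have := iter_fixE x 1 w; rewrite /= e eqxx dvdn1 => /esym/eqP->.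
Qed.

Let t_porbit w : w \in U -> t w \notin porbit x w.
Proof.
move=> wU; apply/negP=> h1; have := forallP tpos w; rewrite h1 /=.
by apply/negP/porbit_even.
Qed.

Lemma flip_porbit w : (t' w \in porbit x w) = (t w \in porbit x w).
Proof.
rewrite flip_tE; case: ifP => // _; rewrite iter_comm1 // -!eq_porbit_mem.
by congr (_ == _); apply/eqP; rewrite eq_porbit_mem mem_porbit_iter.
Qed.

Lemma flip_positive : positive t'.
Proof. by apply/forallP=> w; rewrite flip_porbit; apply: (forallP tpos). Qed.

Lemma flip_fix w : (t' w == w) = (t w == w).
Proof.
rewrite flip_tE; case: ifP => // wU.
have := t_porbit wU; rewrite -flip_porbit flip_tE wU => h1.
have h2 := t_porbit wU.
by apply/eqP/eqP=> e; [rewrite e porbit_id in h1|rewrite e porbit_id in h2].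
Qed.

Lemma flip_mem_biorbit w : (t' w \in biorbit x g w) = (t w \in biorbit x g w).
Proof.
rewrite flip_tE; case: ifP => // wU.
by rewrite (biorbit_eq gx wU) -/U !tU iterU.
Qed.

Lemma flip_flip : (t' * flip v)%g = t.
Proof.
apply/permP=> w; rewrite permM flipE -/U.
rewrite flip_tE; case: (boolP (w \in U)) => wU.
  by rewrite tU iterU wU -iter_comm1 // hh.
by rewrite tU (negPf wU).
Qed.

Let hat_U (s : {perm T}) : involutive s -> (forall v, s (x v) = x (s v)) ->
  (forall v, s (g v) = g (s v)) ->
  biorbit (hat x) (hat g) (blk s v) = blocks s U.
Proof.
move=> ss sx sg; apply/setP=> A; apply/biorbitP/imsetP => [[a [b ->]]|[w]].
  by exists (iter a x (iter b g v)); rewrite ?iter_hat_blk //; apply/biorbitP; exists a, b.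
case/biorbitP=> a [b ->] ->; exists a, b.
by rewrite !iter_hat_blk.
Qed.

Let blocksD (s : {perm T}) : involutive s -> (forall w, (s w \in U) = (w \in U)) ->
  blocks s [set: T] :\: blocks s U = blocks s (~: U).
Proof.
move=> ss sU; apply/setP=> A; apply/setDP/imsetP => [[/imsetP[w _ ->] wU]|[w wU ->]].
  by exists w => //; rewrite inE; apply: contra wU => wU; apply: imset_f.
split; first exact: blk_in; apply: contraL wU => /imsetP[u uU /eqP].
by case/(blk_eqP _ _ ss)=> ->; rewrite inE negbK ?sU.
Qed.

(* Replacing t by t x^(i/2) on one orbit, where i is the even length of the
   cycles of x there, multiplies the weight by zeta_i^(i/2) = -1. *)
Lemma wt_flip : wt zeta t' x g = - wt zeta t x g.
Proof.
have t't' := flip_invol; have t'x := flip_comm_x; have t'g := flip_comm_g.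
have sub s : blocks s U \subset blocks s [set: T].
  by apply/subsetP=> _ /imsetP[w _ ->]; apply: blk_in.
have t'U w : (t' w \in U) = (w \in U).
  by rewrite flip_tE; case: (boolP (w \in U)) => wU; rewrite tU ?iterU ?wU ?(negPf wU).
rewrite /wt (weight_split _ _ _ (sub t)) (weight_split _ _ _ (sub t')).
rewrite !blocksD //.
have <- : blocks t (~: U) = blocks t' (~: U).
  apply: eq_in_imset => w; rewrite inE => wU.
  by rewrite /blk flip_tE (negPf wU).
rewrite -mulNr; congr (_ * _); rewrite -!hat_U //.
have hgx := hat_comm gx.
have [r r0 hr] := @return_time _ (hat x) (hat g) (blk t v) hgx.
have vU : v \in U by apply: biorbit_id.
have [k hk] : exists b, iter r g v = iter b x v \/ iter r g v = t (iter b x v).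
  by apply/(mem_porbit_blk _ _ tt tx tg); rewrite hr.
(* The return of g to the cycle of blocks must land in the t-image of the x-cycle of v. Otherwise
   g^r would preserve that x-cycle, and t v, which is x^a g^b v with r dividing b, would lie in it,
   against positivity. *)
have {}hk : iter r g v = t (iter k x v).
  case: hk => // hk; case/biorbitP: tv => a [b eb].
  have rb : (r %| b)%N.
    have [c hc] := iter_undo x a (iter b g v).
    rewrite -hr; apply/mem_porbit_blk => //; exists c; right.
    by rewrite -hc -eb iter_comm1.
  have/negP[] := t_porbit vU; rewrite eb -(divnK rb) -eq_porbit_mem.
  have -> : porbit x (iter a x (iter (b %/ r * r) g v)) =
            porbit x (iter (b %/ r * r) g v).
    by apply/eqP; rewrite eq_porbit_mem mem_porbit_iter.
  rewrite eq_porbit_mem; elim: (b %/ r)%N => [|c IHc] /=; first exact: porbit_id.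
  rewrite mulSn addnC iterD hk iter_comm //; case/porbit_iterP: IHc => d ->.
  by rewrite -iterD mem_porbit_iter.
have hr' a : (iter a (hat g) (blk t' v) \in porbit (hat x) (blk t' v)) = (r %| a)%N.
  have t'it c : t' (iter c x v) = t (iter h x (iter c x v)).
    by rewrite flip_tE iterU vU.
  rewrite -hr; apply/(mem_porbit_blk _ _ t't' t'x t'g)/(mem_porbit_blk _ _ tt tx tg).
    case=> c [e|e]; first by exists c; left.
    by exists (h + c)%N; right; rewrite e t'it iterD.
  case=> c [e|e]; first by exists c; left.
  by exists (h + c)%N; right; rewrite e t'it !iterD hh // iterU.
have hk1 : iter r (hat g) (blk t v) = iter k (hat x) (blk t v).
  by rewrite !iter_hat_blk //; apply/eqP/blk_eqP => //; right.
(* On the orbit t' is t x^h and x^(2h) = 1, so t (x^k v) = t' (x^(h + k) v): the shift grows by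
   h. *)
have hk2 : iter r (hat g) (blk t' v) = iter (h + k) (hat x) (blk t' v).
  rewrite !iter_hat_blk //; apply/eqP/blk_eqP => //; right.
  by rewrite hk flip_tE iterU vU iterD hh // iterU.
rewrite (weight_biorbit hz hgx hr' r0 hk2) (weight_biorbit hz hgx hr r0 hk1).
have tv' := t_porbit vU; rewrite !card_porbit_blk ?flip_porbit // exprD.
set i := #|porbit x v|; rewrite -mulN1r; congr (_ * _).
have i0 : (0 < i)%N by apply: card_porbit_gt0.
have ei : (h.*2 = i)%N.
  by have := odd_double_half i; rewrite (negPf ev) add0n.
have h0 : (0 < h)%N by rewrite -double_gt0 ei.
have : (zeta i ^+ h) ^+ 2 == 1.
  by rewrite -exprM muln2 ei (prim_expr_order (hz i0)).
rewrite sqrf_eq1 => /orP[|/eqP//].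
rewrite -(prim_order_dvd (hz i0)) => /(dvdn_leq h0).
by rewrite -ei -addnn -{3}[h]addn0 leq_add2l leqNgt h0.
Qed.

End Flip.

Lemma sum_sign_involution (I : finType) (A : {pred I}) (f : I -> algC) (phi : I -> I) :
  {in A, forall i, phi i \in A} -> {in A, forall i, phi (phi i) = i} ->
  {in A, forall i, f (phi i) = - f i} -> \sum_(i in A) f i = 0.
Proof.
move=> pA pp pf; have e : \sum_(i in A) f i = - \sum_(i in A) f i.
  rewrite {1}(reindex_onto phi phi) /=; last by move=> i /pp.
  rewrite -sumrN; apply: eq_big => [i|i /andP[Ai /eqP <-]]; last first.
    by rewrite -(pf _ (pA _ Ai)) !pp // pA.
  apply/andP/idP => [[Ai /eqP <-]|Ai]; first exact: pA.
  by rewrite pA // pp // eqxx.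
apply/eqP; have := Num.Theory.mulrn_eq0 (\sum_(i in A) f i) 2 => /= <-.
by rewrite mulr2n {1}e addNr.
Qed.

(** * The two index sets and the cancellation of irregular pairs *)

Section Sums.

Variable T : finType.
Implicit Types (x g t u y : {perm T}) (D : {set T}).

Definition odd_cycles D g : {set {perm T}} :=
  [set x | [&& perm_on D x, x \in 'C[g] & [forall v, odd #|porbit x v|]]].

(** The involutions of cycle type (2^m) or (2^m, 1) on D, whose centralizers are the copies of
    B_m. *)
Definition pairing D t :=
  [&& perm_on D t, [forall v, t (t v) == v] & (#|[set v in D | t v == v]| <= 1)%N].

Definition pairs D g : {set {perm T} * {perm T}} :=
  [set p | [&& pairing D p.1, p.1 \in 'C[g], perm_on D p.2, p.2 \in 'C[g],
     p.2 \in 'C[p.1] & positive p.2 p.1]].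

(** The pairs that admit no flip: on an orbit preserved by t the cycles of x have odd length. *)
Definition regular_pair g t x :=
  [forall v, (t v \in biorbit x g v) ==> odd #|porbit x v|].

Definition regular_over D g t : {set {perm T}} :=
  [set x | ((t, x) \in pairs D g) && regular_pair g t x].

Lemma perm_commC x g : (forall v, g (x v) = x (g v)) <-> x \in 'C[g].
Proof. by split=> [h|/perm_commP h v]; [apply/perm_commP|rewrite h]. Qed.

Lemma pairsP D g t x :
  reflect [/\ perm_on D t, involutive t, (#|[set v in D | t v == v]| <= 1)%N &
      [/\ forall v, t (g v) = g (t v), perm_on D x, forall v, g (x v) = x (g v),
          forall v, t (x v) = x (t v) & positive x t]]
    ((t, x) \in pairs D g).
Proof.
rewrite inE; apply: (iffP and5P) => /=.
  case=> /and3P[h1 /forallP h2 h3] /perm_commP h4 h5 /perm_commC h6.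
  case/andP=> /perm_commC h7 h8; split=> //.
  by move=> v; apply/eqP.
case=> h1 h2 h3 [h4 h5 h6 h7 h8]; split=> //.
- by apply/and3P; split=> //; apply/forallP=> v; rewrite h2.
- exact/perm_commP.
- exact/perm_commC.
by apply/andP; split=> //; apply/perm_commC.
Qed.

Lemma odd_cyclesP D g x :
  reflect [/\ perm_on D x, forall v, g (x v) = x (g v) &
     forall v, odd #|porbit x v|] (x \in odd_cycles D g).
Proof.
rewrite inE; apply: (iffP and3P) => [[h1 /perm_commC h2 /forallP h3]|[h1 h2 h3]].
  by split.
by split=> //; [apply/perm_commC|apply/forallP].
Qed.

Variables (zeta : nat -> algC) (hz : prim_roots zeta).

(** On irregular pairs, flipping the orbit of a bad point is a sign-reversing involution. The flip
    changes neither the set of bad points nor x, so [pick] selects the same point again and the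
    second flip undoes the first. *)
Lemma pairs_regular D g :
  \sum_(p in pairs D g) wt zeta p.1 p.2 g =
  \sum_(p in pairs D g | regular_pair g p.1 p.2) wt zeta p.1 p.2 g.
Proof.
rewrite (bigID (fun p => regular_pair g p.1 p.2)) /=.
rewrite [X in _ + X](_ : _ = 0) ?addr0 //.
pose bad t x v := (t v \in biorbit x g v) && ~~ odd #|porbit x v|.
pose phi (p : {perm T} * {perm T}) := if [pick v | bad p.1 p.2 v] is Some v
  then ((p.1 * flip p.2 g v)%g, p.2) else p.
pose A := [pred p | (p \in pairs D g) && ~~ regular_pair g p.1 p.2].
have badP p : p \in A -> exists2 v, [pick v | bad p.1 p.2 v] = Some v & bad p.1 p.2 v.
  case/andP=> _ /forallPn[v]; rewrite negb_imply => bv.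
  case: pickP => [w bw|/(_ v)]; first by exists w.
  by rewrite /bad bv.
have main t x : (t, x) \in A -> exists v,
   [/\ [pick w | bad t x w] = Some v, phi (t, x) = ((t * flip x g v)%g, x) &
   [/\ (t * flip x g v * flip x g v)%g = t,
       (forall w, bad (t * flip x g v)%g x w = bad t x w),
       (t * flip x g v, x)%g \in pairs D g &
       wt zeta (t * flip x g v)%g x g = - wt zeta t x g]].
  move=> tA; have [v e /andP[tv ev]] := badP _ tA; exists v.
  case/andP: tA => /pairsP[tD tt t1 [tg xD gx tx pos]] _.
  have hbad w : bad (t * flip x g v)%g x w = bad t x w.
    by rewrite /bad flip_mem_biorbit.
  split; rewrite ?e //; last split; rewrite ?flip_flip ?wt_flip //.
    by rewrite /phi e.
  apply/pairsP; split; last split=> //.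
  - apply: perm_onM => //; apply/subsetP=> w; rewrite inE flipE.
    case: ifP => [wU|_]; last by rewrite eqxx.
    apply: contraR => wD; rewrite -[X in _ == X](iter_fix (#|porbit x v|./2)%N (out_perm xD wD)).
    by rewrite eqxx.
  - exact: flip_invol.
  - by rewrite (eq_card (B := [set v in D | t v == v])) // => w; rewrite !inE flip_fix.
  - exact: flip_comm_g.
  - exact: flip_comm_x.
  exact: flip_positive.
have phiA p : p \in A -> phi p \in A.
  case: p => t x tA; have [v [_ -> [_ hb h _]]] := main _ _ tA.
  rewrite inE /= h /=; case/andP: tA => _ /forallPn[w]; rewrite negb_imply => bw.
  by apply/forallPn; exists w; rewrite negb_imply -/(bad _ x w) hb.
apply: (@sum_sign_involution _ A _ phi) => // -[t x] tA.
  have [v [e -> [ff hb _ _]]] := main _ _ tA.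
  by rewrite /phi /= (eq_pick hb) e ff.
by have [v [_ -> [_ _ _ e]]] := main _ _ tA.
Qed.

End Sums.

(** * Twists that preserve positivity, regularity and odd cycles *)

Section Vanish.

Variable T : finType.
Variables (zeta : nat -> algC) (hz : prim_roots zeta).
Implicit Types (x g t u y : {perm T}) (D S : {set T}).

Lemma perm_on_restr D S z : perm_on D z -> preserves z S ->
  perm_on D (restr_perm S z).
Proof.
move=> zD zS; apply/subsetP=> v; rewrite inE restrE //.
by case: ifP => [_ nv|_]; [apply: (subsetP zD); rewrite inE|rewrite eqxx].
Qed.

Lemma iter_eq x y w a :
  (forall b, y (iter b x w) = x (iter b x w)) -> iter a y w = iter a x w.
Proof. by move=> h; elim: a => //= a ->; rewrite h. Qed.

Lemma eq_porbit_iter x y w :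
  (forall b, y (iter b x w) = x (iter b x w)) -> porbit y w = porbit x w.
Proof.
move=> h; apply/setP=> v; apply/porbit_iterP/porbit_iterP=> -[a ->]; exists a.
  exact: iter_eq.
by apply/esym/iter_eq.
Qed.

Lemma iter_commute_gen x g t q a b n :
  (forall v, g (x v) = x (g v)) ->
  (forall v, t (x v) = x (t v)) -> (forall v, t (g v) = g (t v)) ->
  t q = iter a x (iter b g q) ->
  iter n t q = iter (n * a) x (iter (n * b) g q).
Proof.
move=> gx tx tg e; elim: n => //= n ->; rewrite !mulSn.
rewrite (iter_comm1 _ _ tx) (iter_comm1 _ _ tg) e (iter_comm _ _ _ gx) -!iterD.
by rewrite [(a + _)%N]addnC [(b + _)%N]addnC.
Qed.

Lemma iter_odd_invol t n v : involutive t -> odd n -> iter n t v = t v.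
Proof.
move=> tt on; rewrite -(odd_double_half n) on add1n iterS; congr (t _).
by elim: (n./2) => [//|k IHk]; rewrite doubleS !iterS tt.
Qed.

(** If t q = x^a g^b q and the x-cycle has odd length i, then t q = t^i q = x^(i a) g^(i b) q = g^(i
    b) q. *)
Lemma odd_swap_porbit x g t q :
  (forall v, g (x v) = x (g v)) -> involutive t ->
  (forall v, t (x v) = x (t v)) -> (forall v, t (g v) = g (t v)) ->
  t q \in biorbit x g q -> odd #|porbit x q| -> t q \in porbit g q.
Proof.
move=> gx tt tx tg /biorbitP[a [b e]] oi.
rewrite -(iter_odd_invol q tt oi) (iter_commute_gen _ gx tx tg e).
rewrite -(iter_comm _ _ _ gx); set i := #|porbit x q|.
have/eqP-> : iter (i * a) x q == q by rewrite iter_fixE dvdn_mulr.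
exact: mem_porbit_iter.
Qed.

(** By [odd_swap_porbit] the orbit of q is not preserved by t. Positivity and regularity only
    involve orbits that t preserves, and x is unchanged on the cycles concerned. *)
Lemma twist_regular_pair x g t q : let S := two_cycles t g q in
  let y := restr_perm S g in
  involutive t -> (forall v, t (g v) = g (t v)) ->
  (forall v, g (x v) = x (g v)) -> (forall v, t (x v) = x (t v)) ->
  t q \notin porbit g q -> positive x t -> regular_pair g t x ->
  positive (y * x)%g t /\ regular_pair g t (y * x)%g.
Proof.
move=> S y tt tg gx tx tq pos reg; set x' := (y * x)%g.
have SE v : y v = if v \in S then g v else v.
  exact: (@twistE T t g g q 1 tg (fun=> erefl)).
have x'E v : x' v = if v \in S then g (x v) else x v.
  by rewrite permM SE gx; case: ifP.
have tqU : t q \notin biorbit x g q.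
  apply: contra tq => tU; apply: (@odd_swap_porbit x) => //.
  by have /implyP := forallP reg q; apply.
have sub w : biorbit x' g w \subset biorbit x g w.
  apply: (@sub_biorbit_mod T [set: T]) => // v _; rewrite x'E; case: ifP => _.
    exact/preserves_porbit/porbit_id.
  exact: porbit_id.
have key w : t w \in biorbit x' g w -> forall b, x' (iter b x w) = x (iter b x w).
  move/(subsetP (sub w)) => twU b; rewrite x'E ifN //.
  apply: contra tqU => wS.
  have h v : v \in porbit g q -> v \in biorbit x g w -> t q \in biorbit x g q.
    move=> vq vw; have qw : q \in biorbit x g w.
      by apply: (subsetP (biorbit_sub gx vw)); rewrite porbit_sub_biorbitr // porbit_sym.
    by rewrite (biorbit_eq gx qw); apply: (preserves_biorbit tx tg gx twU).
  have wU : iter b x w \in biorbit x g w.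
    by apply/porbit_sub_biorbit/mem_porbit_iter.
  case/setUP: wS => [|/imsetP[v vq e]]; first by move/h; apply.
  by apply: (h v vq); rewrite -[v]tt -e; apply: (preserves_biorbit tx tg gx twU).
split; apply/forallP=> w; apply/implyP=> tw.
  have k := key _ (porbit_sub_biorbit g tw); rewrite (eq_porbit_iter k) in tw.
  by rewrite (k 0%N); have /implyP := forallP pos w; apply.
rewrite (eq_porbit_iter (key _ tw)); have /implyP := forallP reg w; apply.
exact: (subsetP (sub w)).
Qed.

Lemma regular_overP D g t x :
  reflect [/\ perm_on D t, involutive t, (#|[set v in D | t v == v]| <= 1)%N &
      [/\ forall v, t (g v) = g (t v), perm_on D x, forall v, g (x v) = x (g v),
          forall v, t (x v) = x (t v) & positive x t && regular_pair g t x]]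
    (x \in regular_over D g t).
Proof.
rewrite inE; apply: (iffP andP) => [[/pairsP[? ? ? [? ? ? ? ->]] ->] //|].
by case=> ? ? ? [? ? ? ? /andP[? ?]]; split=> //; apply/pairsP.
Qed.

(* Twisting x by g on the cycles of q and t q preserves regularity and moves
   the weight through a full coset of roots of unity. *)
Lemma regular_over_swap0 D g t q : perm_on D g ->
  g q != q -> t q \notin porbit g q ->
  \sum_(x in regular_over D g t) wt zeta t x g = 0.
Proof.
move=> gD gq tq; set S := two_cycles t g q; pose y := restr_perm S g.
have gE v : g v = iter 1 g v by [].
apply: (@sum_translate0 _ _ _ y #|porbit g q|); first exact: card_porbit_gt0.
  move=> x /regular_overP[tD tt t1 [tg xD gx tx /andP[pos reg]]].
  have [pos' reg'] := twist_regular_pair tt tg gx tx tq pos reg.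
  apply/regular_overP; split=> //; split=> //; last exact/andP.
  - by apply: perm_onM => //; apply: perm_on_restr => //; apply: two_cycles_g.
  - by move=> v; rewrite !permM gx; congr (x _); apply: (twist_g q tg gE).
  by move=> v; rewrite !permM tx; congr (x _); apply: (twist_t q tt tg gE).
move=> x /regular_overP[tD tt t1 [tg xD gx tx _]].
apply: (wt_average hz (E := 1)) => //.
- rewrite ltn_neqAle card_porbit_gt0 andbT eq_sym; apply: contra gq => /eqP e.
  by have := iter_fixE g 1 q; rewrite e dvdnn.
- move=> a; rewrite !inE => /orP[|/eqP e]; first by rewrite iter_fixE.
  by rewrite -e mem_porbit_iter in tq.
by move=> a; rewrite dvdn_gcdl.
Qed.

(** Every iterate of the twisted permutation has the form u^s x^a w. For an odd common multiple m of
    the cycle lengths of x it is u^s w, and since u^n = 1 the power n m, still odd, fixes w. *)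
Lemma odd_twist S x y g u n :
  (forall v, g (x v) = x (g v)) -> (forall v, g (y v) = y (g v)) ->
  (exists E, forall v, u v = iter E g v) ->
  preserves x S -> preserves g S ->
  (forall v, y v = u v \/ y v = v) ->
  odd n -> (forall v, iter n u v = v) ->
  {in S, forall v, odd #|porbit x v|} ->
  {in S, forall v, odd #|porbit (y * x)%g v|}.
Proof.
move=> gx gy [E uE] xS gS yu on un ox w wS; set x' := (y * x)%g.
have ux v : u (x v) = x (u v) by rewrite !uE; exact: (@iter_comm T g x E 1 v gx).
have ux' v : u (x' v) = x' (u v).
  rewrite /x' !permM !uE.
  have gx' z : g (x (y z)) = x (y (g z)) by rewrite gx gy.
  by elim: E {uE} => //= E ->; rewrite gx'.
have uS : preserves u S by move=> v vS; rewrite uE preserves_iter.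
pose m := (\prod_(v in S) #|porbit x v|)%N.
have om : odd m.
  apply: (big_ind odd) => //; by move=> a b oa ob; rewrite oddM oa.
have xm v : v \in S -> iter m x v = v.
  by move=> vS; apply/eqP; rewrite iter_fixE /m (bigD1 v) //= dvdn_mulr.
have x's a : exists s, iter a x' w = iter s u (iter a x w).
  elim: a => [|a [s IHa]] /=; first by exists 0%N.
  rewrite IHa permM; case: (yu (iter s u (iter a x w))) => ->.
    by exists s.+1; rewrite -ux /= (iter_comm1 s (iter a x w) (fun v => esym (ux v))).
  by exists s; rewrite (iter_comm1 s (iter a x w) (fun v => esym (ux v))).
have [s es] := x's m; rewrite xm // in es.
have xmk k : iter (k * m) x' w = iter (k * s) u w.
  elim: k => //= k IHk; rewrite mulSn iterD IHk.
  by rewrite -iter_comm // es -!iterD mulSn addnC.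
suff d : (#|porbit x' w| %| n * m)%N by apply: dvdn_odd d _; rewrite oddM on.
rewrite -iter_fixE xmk mulnC; apply/eqP.
by elim: s {es xmk} => //= s IHs; rewrite mulSn iterD IHs un.
Qed.

End Vanish.

(** * Vanishing at elements with nontrivial 2'-part *)

Section Odd.

Variable T : finType.
Variables (zeta : nat -> algC) (hz : prim_roots zeta).
Implicit Types (x g t u y : {perm T}) (D S : {set T}).

Definition odd_part g : {perm T} := (g.`_(2%N^'))%g.

Lemma odd_part_iter g : exists E, forall v, odd_part g v = iter E g v.
Proof.
have /cycleP[E e] : odd_part g \in <[g]>%g by rewrite /odd_part groupX ?cycle_id.
by exists E => v; rewrite e permX.
Qed.

Lemma odd_part_order g : odd #[odd_part g]%g.
Proof. by rewrite odd_2'nat /odd_part order_constt part_pnat. Qed.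

Lemma iter_odd_part_order g v : iter #[odd_part g]%g (odd_part g) v = v.
Proof. by rewrite -permX expg_order perm1. Qed.

Lemma odd_part_pow g : exists b, forall v,
  iter (2 ^ b) g v = iter (2 ^ b) (odd_part g) v.
Proof.
have /p_natP[b e] : 2%N.-nat #[g.`_(2%N)]%g by rewrite order_constt part_pnat.
exists b => v; rewrite -!permX -{1}(consttC 2%N g) expgMn; last first.
  by apply: (centsP (cycle_abelian g)); rewrite ?groupX ?cycle_id.
by rewrite -e expg_order mul1g.
Qed.

Lemma odd_part_move g q : odd_part g q != q -> g q != q.
Proof.
apply: contra => /eqP e; have [E ->] := odd_part_iter g.
by elim: E => //= E /eqP->; apply/eqP.
Qed.

Lemma perm_on_odd_part D g : perm_on D g -> perm_on D (odd_part g).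
Proof.
move=> gD; apply/subsetP=> v; rewrite inE; apply: contraR => vD.
have [E ->] := odd_part_iter g; elim: E => //= E /eqP->.
by apply/eqP/(out_perm gD).
Qed.

(** Some power g^(2^b) agrees with the same power of the 2'-part, so the cycle length of g divides N
    2^b; its gcd with an odd number is odd and hence divides N. This supplies the gcd hypothesis of
    [wt_average]. *)
Lemma gcdn_odd_part g q i : odd i ->
  (gcdn #|porbit g q| i %| #|porbit (odd_part g) q|)%N.
Proof.
move=> oi; have [b hb] := odd_part_pow g; set N := #|porbit (odd_part g) q|.
have ld : (#|porbit g q| %| N * 2 ^ b)%N.
  rewrite -iter_fixE iter_mul; apply/eqP.
  have h k : iter k (iter (2 ^ b) g) q = iter k (iter (2 ^ b) (odd_part g)) q.
    by elim: k => //= k ->; rewrite hb.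
  by rewrite h -iter_mul mulnC iter_mul; apply: iter_fix; rewrite iter_porbit.
have co : coprime (gcdn #|porbit g q| i) (2 ^ b).
  apply: coprimeXr; rewrite coprimen2; apply: dvdn_odd oi.
  exact: dvdn_gcdr.
by rewrite -(Gauss_dvdl _ co) (dvdn_trans (dvdn_gcdl _ _)).
Qed.

Section Twist.

Variables (D : {set T}) (g t : {perm T}) (q : T).
Hypotheses (gD : perm_on D g) (tt : involutive t).
Hypothesis tg : forall v, t (g v) = g (t v).
Hypothesis uq : odd_part g q != q.

Let S := two_cycles t g q.
Let y := restr_perm S (odd_part g).

Lemma odd_twistE v : y v = if v \in S then odd_part g v else v.
Proof. by have [E uE] := odd_part_iter g; apply: (twistE q tg uE). Qed.

Lemma odd_twist_g v : g (y v) = y (g v).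
Proof. by have [E uE] := odd_part_iter g; apply: (twist_g q tg uE). Qed.

Lemma odd_twist_t v : t (y v) = y (t v).
Proof. by have [E uE] := odd_part_iter g; apply: (twist_t q tt tg uE). Qed.

Lemma odd_twist_on : perm_on D y.
Proof.
apply: perm_on_restr; first exact: perm_on_odd_part.
have [E uE] := odd_part_iter g; exact: (two_cycles_u tg uE).
Qed.

Lemma odd_twist_average x :
  (forall v, g (x v) = x (g v)) -> (forall v, t (x v) = x (t v)) ->
  (forall a : nat, odd #|porbit (y ^+ a * x)%g q|) ->
  \sum_(a < #|porbit (odd_part g) q|) wt zeta t (y ^+ a * x)%g g = 0.
Proof.
move=> gx tx ox; have [E uE] := odd_part_iter g; set u := odd_part g in uE *.
have uN a : iter a u q = q -> (#|porbit u q| %| a)%N.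
  by move=> e; rewrite -iter_fixE e.
have tu v : t (u v) = u (t v) by rewrite !uE iter_comm1.
apply: (wt_average hz tt tg gx tx uE) => //.
- rewrite ltn_neqAle card_porbit_gt0 andbT eq_sym; apply: contra uq => /eqP e.
  by have := iter_fixE u 1 q; rewrite e dvdnn.
(* If u^a q = t q, then u^(2a) q = q; as the length N of the cycle is odd, N divides a. *)
- move=> a; rewrite !inE => /orP[/eqP/uN//|/eqP e].
  have : (#|porbit u q| %| 2 * a)%N.
    by apply: uN; rewrite mul2n -addnn iterD e -iter_comm1 // e tt.
  rewrite Gauss_dvdr // coprimen2; apply: (dvdn_odd _ (odd_part_order g)).
  by rewrite -iter_fixE iter_odd_part_order.
by move=> a; apply: gcdn_odd_part.
Qed.

End Twist.

Lemma odd_cycles0 D g q : perm_on D g -> odd_part g q != q ->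
  \sum_(x in odd_cycles D g) wt zeta 1%g x g = 0.
Proof.
move=> gD uq; pose y := restr_perm (two_cycles 1%g g q) (odd_part g).
have tt : involutive (1%g : {perm T}) by move=> v; rewrite !perm1.
have tc z v : (1%g : {perm T}) (z v) = z ((1%g : {perm T}) v) by rewrite !perm1.
have clo : {in odd_cycles D g, forall x, (y * x)%g \in odd_cycles D g}.
  move=> x /odd_cyclesP[xD gx ox]; apply/odd_cyclesP; split.
  - by apply: perm_onM => //; apply: odd_twist_on.
  - by move=> v; rewrite !permM gx odd_twist_g.
  move=> v.
  apply: (@odd_twist _ [set: T] x y g _ _ gx _ (odd_part_iter g) _ _ _
     (odd_part_order g)) => //.
  - by move=> w; apply: odd_twist_g.
  - by move=> w; rewrite odd_twistE //; case: ifP; [left|right].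
  exact: iter_odd_part_order.
apply: (sum_translate0 (card_porbit_gt0 (odd_part g) q) clo).
move=> x xX; have /odd_cyclesP[xD gx _] := xX.
apply: odd_twist_average => // a.
suff /odd_cyclesP[_ _] : (y ^+ a * x)%g \in odd_cycles D g by apply.
by elim: a => [|a IHa]; rewrite ?expg0 ?mul1g // expgS -mulgA clo.
Qed.

(** Here t preserves every nontrivial cycle of g, so regularity makes the cycles of x odd on all
    points moved by g. The twist by the 2'-part keeps them odd, and this in turn secures positivity
    and regularity there. *)
Lemma regular_over_odd0 D g t q : perm_on D g ->
  (forall v, g v != v -> t v \in porbit g v) -> odd_part g q != q ->
  \sum_(x in regular_over D g t) wt zeta t x g = 0.
Proof.
move=> gD tC uq; pose y := restr_perm (two_cycles t g q) (odd_part g).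
pose M := [set v | g v != v].
have odd_on_M x : regular_pair g t x -> {in M, forall v, odd #|porbit x v|}.
  move=> reg v; rewrite inE => gv; have /implyP := forallP reg v; apply.
  exact/porbit_sub_biorbitr/tC.
have clo : {in regular_over D g t, forall x, (y * x)%g \in regular_over D g t}.
  move=> x /regular_overP[tD tt t1 [tg xD gx tx /andP[pos reg]]].
  have yE := odd_twistE q tg; have yg := odd_twist_g q tg.
  have yt := odd_twist_t q tt tg.
  have cM (z : {perm T}) : (forall v, z (g v) = g (z v)) -> preserves z M.
    by move=> zg v; rewrite !inE -zg (inj_eq perm_inj).
  have qM : q \in M by rewrite inE odd_part_move.
  have xM : preserves x M by apply: cM => v; rewrite gx.
  have gM : preserves g M by apply: cM.
  have SM v : v \in two_cycles t g q -> v \in M.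
    case/setUP=> [/porbit_iterP[a ->]|/imsetP[_ /porbit_iterP[a ->] ->]].
      exact: preserves_iter.
    by apply: (cM t tg); apply: preserves_iter.
  set x' := (y * x)%g.
  have gx' v : g (x' v) = x' (g v) by rewrite !permM gx yg.
  have tx' v : t (x' v) = x' (t v) by rewrite !permM tx yt.
  have ox' : {in M, forall v, odd #|porbit x' v|}.
    apply: (@odd_twist _ M x y g _ _ gx yg (odd_part_iter g) xM gM _
     (odd_part_order g)).
    - by move=> w; rewrite yE; case: ifP; [left|right].
    - exact: iter_odd_part_order.
    exact: odd_on_M.
  have eq_off v : v \notin M -> forall b, x' (iter b x v) = x (iter b x v).
    move=> vM b; rewrite permM yE ifN //; apply: contra vM => /SM.
    have := perm_preserves xM; move=> h; elim: b => //= b IHb.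
    by rewrite h.
  have sub w : biorbit x' g w \subset biorbit x g w.
    apply: (@sub_biorbit_mod T [set: T]) => // v _; rewrite permM yE.
    case: ifP => _; last exact: porbit_id.
    have [E ->] := odd_part_iter g.
    have <- : iter E g (x v) = x (iter E g v) by apply: (@iter_comm T g x E 1 v gx).
    exact: mem_porbit_iter.
  apply/regular_overP; split=> //; split=> //.
    by apply: perm_onM => //; apply: odd_twist_on.
  apply/andP; split; apply/forallP=> v; apply/implyP=> tv.
    have [vM|vM] := boolP (v \in M); last first.
      have k := eq_off v vM; rewrite (eq_porbit_iter k) in tv.
      by rewrite (k 0%N); have /implyP := forallP pos v; apply.
    (* If t v = x'^a v on a cycle of odd length i, then t v = t^i v = x'^(a i) v = v. But t commutes
       with g, so g v would be a second fixed point. *)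
    have e : t v = v.
      case/porbit_iterP: tv => a e.
      rewrite -(iter_odd_invol v tt (ox' v vM)) (@iter_commute_gen _ x' g t v a 0) //.
      by rewrite muln0 /= mulnC; apply/eqP; rewrite iter_fixE dvdn_mull.
    have : ([set v; g v] \subset [set w in D | t w == w]).
      have inD w : w \in M -> w \in D by rewrite inE => /(subsetP gD).
      apply/subsetP=> w; rewrite !inE => /orP[]/eqP->.
        by rewrite e eqxx inD.
      by rewrite tg e eqxx inD // gM.
    move/subset_leq_card/leq_trans/(_ t1); rewrite cards2.
    by move: vM; rewrite inE eq_sym => ->.
  have [vM|vM] := boolP (v \in M); first exact: ox'.
  rewrite (eq_porbit_iter (eq_off v vM)); have /implyP := forallP reg v; apply.
  exact: (subsetP (sub v)).
apply: (sum_translate0 (card_porbit_gt0 (odd_part g) q) clo).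
move=> x xX; have /regular_overP[tD tt t1 [tg xD gx tx _]] := xX.
apply: odd_twist_average => // a.
suff /regular_overP[_ _ _ [_ _ _ _ /andP[_ reg]]] : (y ^+ a * x)%g \in regular_over D g t.
  by apply: (odd_on_M _ reg); rewrite inE odd_part_move.
by elim: a => [|a IHa]; rewrite ?expg0 ?mul1g // expgS -mulgA clo.
Qed.

End Odd.

(** * 2-elements and their half turns *)

Section TwoElement.

Variable T : finType.
Variables (zeta : nat -> algC) (hz : prim_roots zeta).
Implicit Types (x t u y : {perm T}) (D S : {set T}).
Variables (g : {perm T}) (b : nat).
Hypothesis gb : forall v, iter (2 ^ b) g v = v.

Let M := [set v | g v != v].

Lemma wt_expg t x k : (forall v, t (x v) = x (t v)) ->
  (forall v, t (g v) = g (t v)) -> (forall v, g (x v) = x (g v)) ->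
  wt zeta t x (g ^+ k)%g = wt zeta t x g ^+ k.
Proof.
move=> tx tg gx; elim: k => [|k IHk]; first by rewrite expg0 expr0 wt1.
rewrite expgSr exprSr wtM ?IHk // => v; rewrite !permX.
  exact: iter_comm1.
exact: (@iter_comm T g x k 1 v gx).
Qed.

(* The weight is both a root of unity of 2-power order and of odd order. *)
Lemma wt_eq1 t x : (forall v, t (x v) = x (t v)) ->
  (forall v, t (g v) = g (t v)) -> (forall v, g (x v) = x (g v)) ->
  {in M, forall v, odd #|porbit x v|} -> wt zeta t x g = 1.
Proof.
move=> tx tg gx ox; pose m := (\prod_(v in M) #|porbit x v|)%N.
have om : odd m by apply: (big_ind odd) => // c d oc od; rewrite oddM oc.
have e2 : wt zeta t x g ^+ (2 ^ b) = 1.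
  rewrite -wt_expg //; have -> : (g ^+ (2 ^ b) = 1)%g; last exact: wt1.
  by apply/permP=> v; rewrite permX gb perm1.
have em : wt zeta t x g ^+ m = 1.
  rewrite /wt /weight -prodrXl; apply: big1 => _ /andP[/imsetP[v _ ->] _].
  rewrite hat_blk //; have [e|gv] := eqVneq (g v) v.
    by rewrite e divff ?expr1n // phase_neq0.
  have dm : (#|porbit (hat x) (blk t v)| %| m)%N.
    apply: dvdn_trans (dvdn_card_porbit_blk _ tx) _.
    by rewrite /m (bigD1 v) ?inE //= dvdn_mulr.
  apply: expr_dvd_eq1 dm; set i := #|_|.
  have i0 : (0 < i)%N by apply: card_porbit_gt0.
  have ph w : #|porbit (hat x) w| = i -> phase zeta (hat x) w ^+ i = 1.
    by rewrite /phase => ->; rewrite exprAC (prim_expr_order (hz i0)) expr1n.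
  rewrite expr_div_n !ph ?divr1 // -hat_blk // card_porbit_commg //.
  exact: hat_comm.
have /eqP co : coprime (2 ^ b) m by rewrite coprimeXl // coprime2n.
have := expr_gcd_eq1 _ e2 em; rewrite co expr1; apply.
by rewrite expn_gt0.
Qed.

Lemma two_cycle_even v : v \in M -> #|porbit g v|./2.*2 = #|porbit g v|.
Proof.
rewrite inE => gv; have := odd_double_half #|porbit g v|.
have : (#|porbit g v| %| 2 ^ b)%N by rewrite -iter_fixE gb.
case/(dvdn_pfactor _ _ (isT : prime 2)) => -[_ e|c _ ->].
  by case/eqP: gv; apply/eqP; rewrite -[g v]/(iter 1 g v) iter_fixE e.
by rewrite oddX /= => {2}<-.
Qed.

Lemma half_turn_inj : injective (fun v => iter (#|porbit g v|./2) g v).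
Proof.
move=> v w e; have : #|porbit g v| = #|porbit g w|.
  by rewrite -(porbit_iter g v (#|porbit g v|./2)) e porbit_iter.
by move=> e'; move: e; rewrite e' => /iter_perm_inj.
Qed.

(** On each cycle of length l this is g^(l/2), with exponent 0 at the fixed points of g. It is the
    only possible action of t on a nontrivial cycle of a 2-element that t preserves without fixed
    points. *)
Definition half_turn : {perm T} := perm half_turn_inj.

Lemma half_turnE v : half_turn v = iter (#|porbit g v|./2) g v.
Proof. by rewrite permE. Qed.

Lemma half_turn_porbit v : half_turn v \in porbit g v.
Proof. by rewrite half_turnE mem_porbit_iter. Qed.

Lemma half_turn_fix v : v \notin M -> half_turn v = v.
Proof.
by rewrite inE negbK half_turnE => /eqP e; elim: (_./2) => //= a ->.
Qed.

Lemma half_turn_move v : v \in M -> half_turn v != v.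
Proof.
move=> vM; rewrite half_turnE iter_fixE.
have e := two_cycle_even vM; have l0 := card_porbit_gt0 g v.
have h0 : (0 < #|porbit g v|./2)%N by rewrite -double_gt0 e.
rewrite gtnNdvd // -{2}e -addnn -{1}[(_./2)%N]addn0 ltn_add2l //.
Qed.

Lemma half_turn_comm x : (forall v, g (x v) = x (g v)) ->
  forall v, half_turn (x v) = x (half_turn v).
Proof.
move=> gx v; rewrite !half_turnE card_porbit_commg //.
by rewrite (@iter_comm T g x _ 1 v gx).
Qed.

Lemma half_turnK : involutive half_turn.
Proof.
move=> v; have [vM|vM] := boolP (v \in M); last by rewrite !half_turn_fix.
rewrite [half_turn v]half_turnE half_turnE porbit_iter -iterD addnn.
by rewrite two_cycle_even // iter_porbit.
Qed.

(** If t v = g^a v, then l divides 2 a but not a, so a is an odd multiple of l / 2. *)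
Lemma half_turn_uniq t v : involutive t -> (forall v, t (g v) = g (t v)) ->
  t v \in porbit g v -> t v != v -> t v = half_turn v.
Proof.
move=> tt tg /porbit_iterP[a e] tv; rewrite half_turnE.
have vM : v \in M.
  rewrite inE; apply: contra tv => /eqP gv; rewrite e.
  by apply/eqP; elim: a {e} => //= a ->.
rewrite e; apply/eqP; rewrite iter_eqE.
have el := two_cycle_even vM; set l := #|porbit g v| in el *.
have l2a : (l %| 2 * a)%N.
  by rewrite -iter_fixE mul2n -addnn iterD -e -iter_comm1 // -e tt.
have la : ~~ (l %| a)%N by rewrite -iter_fixE -e.
have /dvdnP[k ek] : (l./2 %| a)%N.
  by move: l2a; rewrite -{1}el -muln2 mulnC dvdn_pmul2l.
have ok : odd k.
  apply: contraR la => /negPf ok; have k2 : k = k./2.*2.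
    by rewrite -{1}(odd_double_half k) ok.
  by rewrite ek k2 -doubleMl doubleMr el dvdn_mull.
have k2 : k = k./2.*2.+1 by rewrite -{1}(odd_double_half k) ok.
by rewrite ek k2 mulSn -doubleMl doubleMr el addnC modnMDl.
Qed.

End TwoElement.

(** * Splitting permutations into moved and fixed points of a 2-element *)

Section Glue.

Variable T : finType.
Implicit Types (x y a c t : {perm T}) (D M Z : {set T}).

Lemma glueE M Z a c v : perm_on M a -> perm_on Z c -> [disjoint M & Z] ->
  (a * c)%g v = if v \in M then a v else c v.
Proof.
move=> aM cZ MZ; rewrite permM; case: ifP => vM; last first.
  by rewrite (out_perm aM) ?vM.
by rewrite (out_perm cZ) // (disjointFr MZ) // perm_closed.
Qed.

End Glue.

Section GlueRestr.

Variable T : finType.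
Implicit Types (x y a c t : {perm T}) (D M Z S : {set T}).

Lemma card_porbit_fix x v : x v = v -> #|porbit x v| = 1%N.
Proof.
move=> e; apply/eqP; rewrite -dvdn1 -iter_fixE.
exact/eqP.
Qed.

Lemma odd_restr x S : preserves x S -> {in S, forall v, odd #|porbit x v|} ->
  forall v, odd #|porbit (restr_perm S x) v|.
Proof.
move=> xS ox v; have [vS|vS] := boolP (v \in S); last first.
  by rewrite card_porbit_fix // restrE // (negPf vS).
rewrite (@eq_porbit_iter _ x) ?ox // => k.
by rewrite restrE // preserves_iter.
Qed.

Lemma glue_restr D M x : perm_on D x -> preserves x M -> preserves x (D :\: M) ->
  (restr_perm M x * restr_perm (D :\: M) x)%g = x.
Proof.
move=> xD xM xZ; apply/permP=> v.
rewrite (@glueE _ M (D :\: M)) ?restr_perm_on // ?restrE //; last first.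
  by rewrite -setI_eq0 setIDA setIC -setIDA setDv setI0.
case: (boolP (v \in M)) => // vM; rewrite inE vM /=; case: ifP => // /negbT vD.
by rewrite (out_perm xD).
Qed.

Lemma glue_inj M Z a a' c c' : perm_on M a -> perm_on M a' -> perm_on Z c ->
  perm_on Z c' -> [disjoint M & Z] -> (a * c)%g = (a' * c')%g -> a = a' /\ c = c'.
Proof.
move=> aM aM' cZ cZ' MZ e; suff ea : a = a' by split=> //; apply: (mulgI a); rewrite e ea.
apply/permP=> v; move/permP/(_ v): e; rewrite !(@glueE _ M Z) //.
by case: ifP => // vM _; rewrite (out_perm aM) ?(out_perm aM') // vM.
Qed.

Lemma preserves_perm_on D x : perm_on D x -> preserves x D.
Proof. by move=> xD v vD; rewrite perm_closed. Qed.

End GlueRestr.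

Section Factor.

Variable T : finType.
Implicit Types (x y a c t s : {perm T}) (S : {set T}).
Variables (g : {perm T}) (b : nat) (D : {set T}).
Hypothesis gb : forall v, iter (2 ^ b) g v = v.
Hypothesis gD : perm_on D g.

Let M := [set v | g v != v].
Let Z := D :\: M.

Lemma moved_sub : M \subset D.
Proof. by apply/subsetP=> v; rewrite inE; apply: contraR => /(out_perm gD)->. Qed.

Let MZ : [disjoint M & Z].
Proof. by rewrite -setI_eq0 setIDA setIC -setIDA setDv setI0. Qed.

Let ZfM v : v \in Z -> v \notin M.
Proof. by case/setDP. Qed.

Let preservesM x : (forall v, g (x v) = x (g v)) -> preserves x M.
Proof. by move=> gx v; rewrite !inE gx (inj_eq perm_inj). Qed.

Let preservesZ x : perm_on D x -> (forall v, g (x v) = x (g v)) -> preserves x Z.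
Proof.
move=> xD gx; apply: preserves_setD; first exact: preserves_perm_on.
exact: preservesM.
Qed.

Let fixM v : v \notin M -> g v = v.
Proof. by rewrite inE negbK => /eqP. Qed.

Section Glued.

Variables (a c : {perm T}).
Hypotheses (aA : a \in odd_cycles M g) (cZ : perm_on Z c).

Let aM : perm_on M a. Proof. by have /odd_cyclesP[] := aA. Qed.

Let cE v : (a * c)%g v = if v \in M then a v else c v.
Proof. exact: (@glueE _ M Z). Qed.

Lemma glue_on : perm_on D (a * c)%g.
Proof.
apply: perm_onM; first exact: subset_trans aM moved_sub.
by apply: subset_trans cZ _; apply: subsetDl.
Qed.

Lemma glue_notM v : (c v \in M) = (v \in M).
Proof.
have [vM|vM] := boolP (v \in M).
  by rewrite (out_perm cZ) // (disjointFr MZ).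
have [vZ|vZ] := boolP (v \in Z); last by rewrite (out_perm cZ) // (negPf vM).
by rewrite (negPf (ZfM _)) // perm_closed.
Qed.

Lemma glue_aM v : (a v \in M) = (v \in M).
Proof. exact: perm_closed. Qed.

Lemma glue_comm v : g ((a * c)%g v) = (a * c)%g (g v).
Proof.
have gM : (g v \in M) = (v \in M) by rewrite !inE (inj_eq perm_inj).
rewrite !cE gM; case: ifP => vM; first by have /odd_cyclesP[_ ->] := aA.
by rewrite !fixM ?glue_notM ?vM.
Qed.

Lemma glue_porbitM v : v \in M -> porbit (a * c)%g v = porbit a v.
Proof.
move=> vM; apply: eq_porbit_iter => k; rewrite cE.
by rewrite preserves_iter // => w; rewrite glue_aM.
Qed.

Lemma glue_porbitZ v : v \notin M -> porbit (a * c)%g v = porbit c v.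
Proof.
move=> vM; apply: eq_porbit_iter => k; rewrite cE ifN //.
by elim: k => //= k IHk; rewrite glue_notM.
Qed.

End Glued.

Lemma restr_odd_cycles x : perm_on D x -> (forall v, g (x v) = x (g v)) ->
  {in M, forall v, odd #|porbit x v|} -> restr_perm M x \in odd_cycles M g.
Proof.
move=> xD gx ox; apply/odd_cyclesP; split; first exact: restr_perm_on.
  apply: restr_comm => //; last exact: preservesM.
  exact: preservesM.
by apply: odd_restr => //; apply: preservesM.
Qed.

Lemma card_odd_cycles_split :
  #|odd_cycles D g| = (#|odd_cycles M g| * #|odd_cycles Z 1%g|)%N.
Proof.
rewrite -cardsX; pose h (p : {perm T} * {perm T}) := (p.1 * p.2)%g.
have hi : {in setX (odd_cycles M g) (odd_cycles Z 1%g) &, injective h}.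
  move=> [a c] [a' c'] /setXP[/odd_cyclesP[aM _ _] /odd_cyclesP[cZ _ _]].
  move=> /setXP[/odd_cyclesP[aM' _ _] /odd_cyclesP[cZ' _ _]].
  by case/(glue_inj aM aM' cZ cZ' MZ) => -> ->.
rewrite -(card_in_imset hi); apply: eq_card => x; apply/idP/imsetP.
  case/odd_cyclesP=> xD gx ox; exists (restr_perm M x, restr_perm Z x); last first.
    by rewrite /h /= glue_restr //; [apply: preservesM|apply: preservesZ].
  apply/setXP; split; first exact: restr_odd_cycles.
  apply/odd_cyclesP; split; first exact: restr_perm_on.
    by move=> v; rewrite !perm1.
  by apply: odd_restr => //; apply: preservesZ.
case=> -[a c] /setXP[aA /odd_cyclesP[cZ _ oc]] ->; rewrite /h /=.
apply/odd_cyclesP; split; [exact: glue_on|exact: glue_comm|move=> v].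
have [vM|vM] := boolP (v \in M).
  by rewrite glue_porbitM //; have /odd_cyclesP[_ _] := aA.
by rewrite glue_porbitZ.
Qed.

(** The pairs left over after the flips and the twists along cycles of g that t does not
    preserve. *)
Definition fine_pairs := [set p in pairs D g |
  regular_pair g p.1 p.2 && [forall v in M, p.1 v \in porbit g v]].

Lemma pairing_moves t v : (#|[set v in D | t v == v]| <= 1)%N ->
  (forall v, t (g v) = g (t v)) -> v \in M -> t v != v.
Proof.
move=> t1 tg vM; apply/eqP=> e.
have gvM : g v \in M by rewrite inE (inj_eq perm_inj) -[_ == _]negbK; move: vM; rewrite inE => ->.
have : ([set v; g v] \subset [set w in D | t w == w]).
  apply/subsetP=> w; rewrite !inE => /orP[]/eqP->.
    by rewrite e eqxx (subsetP moved_sub).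
  by rewrite tg e eqxx (subsetP moved_sub).
move/subset_leq_card/leq_trans/(_ t1); rewrite cards2.
by move: vM; rewrite inE eq_sym => ->.
Qed.

Lemma half_turnA : perm_on M (half_turn g).
Proof.
apply/subsetP=> v; rewrite inE; apply: contraR => vM.
by rewrite half_turn_fix.
Qed.

(** On M the involution is forced to be the half turn of g, and x is any permutation with odd cycles
    commuting with g. On Z, where g is the identity, t and x restrict to an arbitrary pair. *)
Lemma card_fine_pairs :
  #|fine_pairs| = (#|odd_cycles M g| * #|pairs Z 1%g|)%N.
Proof.
rewrite -cardsX; pose H := half_turn g.
pose h (p : {perm T} * ({perm T} * {perm T})) := ((H * p.2.1)%g, (p.1 * p.2.2)%g).
have HM := half_turnA.
have hi : {in setX (odd_cycles M g) (pairs Z 1%g) &, injective h}.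
  move=> [a [t c]] [a' [t' c']] /setXP[/odd_cyclesP[aM _ _] /pairsP[tZ _ _ [_ cZ _ _ _]]].
  move=> /setXP[/odd_cyclesP[aM' _ _] /pairsP[tZ' _ _ [_ cZ' _ _ _]]].
  case=> /(glue_inj HM HM tZ tZ' MZ)[_ ->].
  by case/(glue_inj aM aM' cZ cZ' MZ) => -> ->.
rewrite -(card_in_imset hi); apply: eq_card => -[s x]; apply/idP/imsetP.
  rewrite inE /= => /and3P[/pairsP[sD ss s1 [sg xD gx sx pos]] reg /forall_inP fin].
  have ox v : v \in M -> odd #|porbit x v|.
    move=> vM; have /implyP := forallP reg v; apply.
    exact/porbit_sub_biorbitr/fin.
  have gs v : g (s v) = s (g v) by rewrite sg.
  have xZ := preservesZ xD gx; have sZ := preservesZ sD gs.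
  exists (restr_perm M x, (restr_perm Z s, restr_perm Z x)).
    apply/setXP; split; first exact: restr_odd_cycles.
    apply/pairsP; split; last split.
    - exact: restr_perm_on.
    - move=> v; rewrite !restrE //; case: (boolP (v \in Z)) => vZ.
        by rewrite perm_preserves // vZ ss.
      by rewrite (negPf vZ).
    - apply: leq_trans s1; apply/subset_leq_card/subsetP=> v.
      rewrite inE restrE // => /andP[vZ]; rewrite vZ inE => ->.
      by case/setDP: vZ => ->.
    - by move=> v; rewrite !perm1.
    - exact: restr_perm_on.
    - by move=> v; rewrite !perm1.
    - apply: restr_comm => //; first exact: preserves_restr.
      move=> v; apply/esym; apply: restr_comm => // w; exact/esym.
    apply/forallP=> v; apply/implyP; rewrite !restrE //.
    case: (boolP (v \in Z)) => // vZ.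
    rewrite (@eq_porbit_iter _ x); last by move=> k; rewrite restrE // preserves_iter.
    by have /implyP := forallP pos v.
  rewrite /h /= glue_restr //; last exact: preservesM.
  congr (_, _); rewrite -{1}(glue_restr sD (preservesM gs) sZ); congr (_ * _)%g.
  apply/permP=> v; rewrite restrE; last exact: preservesM.
  case: ifP => [vM|/negbT vM]; last by rewrite /H half_turn_fix.
  rewrite (half_turn_uniq gb) //; first exact: fin.
  exact: (pairing_moves s1 sg vM).
case=> -[a [t c]] /setXP[aA /pairsP[/= tZ tt t1 [_ cZ _ tc pos]]] ->.
have /odd_cyclesP[aM ga oa] := aA.
have HE v : (H * t)%g v = if v \in M then H v else t v by apply: (@glueE _ M Z).
have xE v : (a * c)%g v = if v \in M then a v else c v by apply: (@glueE _ M Z).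
have tM := glue_notM tZ; have cM := glue_notM cZ.
have Hg := half_turn_comm (fun v => erefl (g (g v))).
have HM' v : (H v \in M) = (v \in M) by rewrite perm_closed.
have gM v : (g v \in M) = (v \in M) by rewrite !inE (inj_eq perm_inj).
have HgE v : (H * t)%g (g v) = g ((H * t)%g v).
  by rewrite !HE gM; case: ifP => [_|/negbT vM]; rewrite ?Hg // !fixM ?tM.
have pp : positive (a * c)%g (H * t)%g.
  apply/forallP=> v; apply/implyP; rewrite HE xE.
  case: ifP => [vM|/negbT vM]; last first.
    by rewrite glue_porbitZ //; have /implyP := forallP pos v.
  rewrite glue_porbitM // => /porbit_iterP[k e].
  have /eqP[] := half_turn_move gb vM; rewrite -/H.
  rewrite -(iter_odd_invol v (half_turnK gb) (oa v)) -/H.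
  rewrite (@iter_commute_gen _ a g H v k 0 #|porbit a v|) //; last exact: half_turn_comm.
  by rewrite muln0 /= mulnC; apply/eqP; rewrite iter_fixE dvdn_mull.
rewrite inE; apply/and3P; split.
- apply/pairsP; split; last split=> //.
  + apply: perm_onM; first exact: subset_trans HM moved_sub.
    by apply: subset_trans tZ _; apply: subsetDl.
  + move=> v; rewrite [(H * t)%g v]HE; case: ifP => [vM|/negbT vM].
      by rewrite HE HM' vM (half_turnK gb).
    by rewrite HE tM (negPf vM) tt.
  + apply: leq_trans t1; apply/subset_leq_card/subsetP=> v.
    rewrite inE HE => /andP[vD]; case: ifP => [/(half_turn_move gb)/negPf->//|/negbT vM].
    by rewrite inE => ->; rewrite andbT inE vM.
  + exact: glue_on.
  + exact: glue_comm.
  move=> v; rewrite [(a * c)%g v]xE [(H * t)%g v]HE.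
  case: (boolP (v \in M)) => vM; rewrite HE xE.
    by rewrite HM' vM (glue_aM aA) vM half_turn_comm.
  by rewrite cM tM (negPf vM) tc.
- apply/forallP=> v /=; apply/implyP; have [vM|vM] := boolP (v \in M).
    by rewrite glue_porbitM.
  (* Off M the orbit is just a cycle of x, so positivity makes x fix v. *)
  case/biorbitP=> k [l]; have -> : iter l g v = v by apply/iter_fix/fixM.
  move=> e; rewrite card_porbit_fix //; apply/eqP; have /implyP := forallP pp v.
  by apply; rewrite e mem_porbit_iter.
by apply/forall_inP=> v vM /=; rewrite HE vM half_turn_porbit.
Qed.

End Factor.

(** * The involutions with at most one fixed point form one class *)

Section PairingClass.

Variable T : finType.
Implicit Types (t h k : {perm T}) (D : {set T}) (a b c d v : T).

Lemma pairingP D t : reflect [/\ perm_on D t, involutive t &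
    (#|[set v in D | t v == v]| <= 1)%N] (pairing D t).
Proof.
apply: (iffP and3P) => [[? /forallP h ?]|[? h ?]]; split=> //.
  by move=> v; apply/eqP.
by apply/forallP=> v; rewrite h.
Qed.

Lemma perm_onJ D t h : perm_on D t -> perm_on D h -> perm_on D (t ^ h)%g.
Proof.
move=> tD hD; suff : (t ^ h)%g \in perm.Sym D by rewrite inE.
by rewrite groupJ ?inE.
Qed.

Lemma pairingJ D t h : perm_on D h -> pairing D t -> pairing D (t ^ h)%g.
Proof.
move=> hD /pairingP[tD tt t1]; apply/pairingP; split.
- exact: perm_onJ.
- by move=> v; rewrite -[v](permKV h) !permJ tt.
apply: leq_trans t1; rewrite -(card_imset [set v in D | t v == v] (@perm_inj _ h)).
apply/subset_leq_card/subsetP=> v; rewrite inE => /andP[vD /eqP e].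
apply/imsetP; exists (h^-1 v)%g; rewrite ?permKV // inE.
rewrite -(perm_closed _ hD) permKV vD /=; apply/eqP/(@perm_inj _ h).
by rewrite -permJ permKV e.
Qed.

Lemma perm_on_card1 D t : (#|D| <= 1)%N -> perm_on D t -> t = 1%g.
Proof.
move=> D1 tD; apply/permP=> v; rewrite perm1; apply/eqP/negPn/negP=> tv.
have vD : v \in D by apply: (subsetP tD).
have tvD : t v \in D by rewrite perm_closed.
by move/eqP: tv; apply; apply: (card_le1_eqP D1).
Qed.

Lemma tperm_onD D a b : a \in D -> b \in D -> perm_on D (tperm a b).
Proof.
move=> aD bD; apply: subset_trans (tperm_on a b) _.
by apply/subsetP=> v /set2P[]->.
Qed.

(** Induction on D: a conjugation moves some 2-cycle of t onto a fixed transposition (a b), and the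
    rest is a pairing of D without a and b. The conjugating element stays supported on D. *)
Lemma pairing_class D : exists2 t0, pairing D t0 &
  forall t, pairing D t -> exists2 h, perm_on D h & t = (t0 ^ h)%g.
Proof.
have [n] := ubnP #|D|; elim: n D => // n IHn D Dn.
have [D1|] := leqP #|D| 1.
  exists 1%g.
    apply/pairingP; split; [exact: perm_on1|by move=> v; rewrite !perm1|].
    by apply: leq_trans D1; apply/subset_leq_card/subsetP=> v; rewrite inE => /andP[].
  move=> t /pairingP[/(perm_on_card1 D1)-> _ _]; exists 1%g; rewrite ?conj1g //.
  exact: perm_on1.
case/card_gt1P=> a [b [aD bD ab]]; pose P := [set a; b]; pose D' := D :\: P.
have PD : P \subset D by apply/subsetP=> v /set2P[]->.
have D'n : (#|D'| < n)%N.
  apply: leq_trans (_ : #|D| <= n)%N => //; apply/proper_card/properP.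
  by split; [apply: subsetDl|exists a => //; rewrite !inE eqxx].
have PD' : [disjoint P & D'].
  by rewrite -setI_eq0 setIDA setIC -setIDA setDv setI0.
have [t0 /pairingP[t0D t00 t01] t0h] := IHn _ D'n.
have ON : perm_on P (tperm a b).
  exact: tperm_on.
have tE s : perm_on D' s -> forall v, (tperm a b * s)%g v =
    if v \in P then tperm a b v else s v.
  by move=> sD v; apply: (@glueE _ P D').
exists (tperm a b * t0)%g.
  apply/pairingP; split.
  - apply: perm_onM; first exact: subset_trans ON PD.
    by apply: subset_trans t0D _; apply: subsetDl.
  - move=> v; rewrite !tE //; case: (boolP (v \in P)) => vP.
      by rewrite perm_closed // vP tpermK.
    suff /negPf-> : t0 v \notin P by rewrite t00.
    have [vD|vD] := boolP (v \in D'); last by rewrite (out_perm t0D).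
    by have := perm_closed v t0D; rewrite vD inE => /andP[].
  apply: leq_trans t01; apply/subset_leq_card/subsetP=> v.
  rewrite inE tE // => /andP[vD]; case: ifP => [|/negbT vP].
    by move/set2P=> [] ->; rewrite ?tpermL ?tpermR ?(negPf ab) // eq_sym (negPf ab).
  by rewrite inE => ->; rewrite inE vP vD.
move=> t tp; have /pairingP[tD tt t1] := tp.
have [c cD tc] : exists2 c, c \in D & t c != c.
  apply/exists_inP; rewrite -negb_forall_in; apply/negP=> /forall_inP h.
  have : (#|P| <= 1)%N.
    apply: leq_trans t1; apply/subset_leq_card/subsetP=> v /(subsetP PD) vD.
    by rewrite inE vD h.
  by rewrite cards2 ab.
(* [k] sends c to a and t c to b: the first transposition takes c to a and t c to e, and the second
   takes e to b while fixing a. *)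
pose e := tperm c a (t c); pose k := (tperm c a * tperm e b)%g.
have eD : e \in D.
  by rewrite perm_closed ?perm_closed //; apply: tperm_onD.
have kD : perm_on D k by apply: perm_onM; apply: tperm_onD.
have ea : e != a by rewrite -[X in _ != X](tpermL c a) (inj_eq perm_inj).
have kc : k c = a by rewrite permM tpermL tpermD // eq_sym.
have ktc : k (t c) = b by rewrite permM -/e tpermL.
have /pairingP[t'D t't' t'1] := pairingJ kD tp; set t' := (t ^ k)%g in t'D t't' t'1.
have t'a : t' a = b by rewrite -kc permJ.
have t'b : t' b = a by rewrite -t'a t't'.
pose s := restr_perm D' t'.
have t'P : preserves t' P.
  by move=> v /set2P[]->; rewrite ?t'a ?t'b !inE eqxx ?orbT.
have t'D' : preserves t' D' by apply: preserves_setD => //; apply: preserves_perm_on.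
have st' : t' = (tperm a b * s)%g.
  rewrite -[LHS](glue_restr t'D t'P t'D'); congr (_ * _)%g.
  apply/permP=> v; rewrite restrE //; case: ifP => [/set2P[]->|/negbT].
  - by rewrite tpermL.
  - by rewrite tpermR.
  by rewrite !inE negb_or => /andP[va vb]; rewrite tpermD // eq_sym.
have /t0h[h hD es] : pairing D' s.
  apply/pairingP; split; first exact: restr_perm_on.
    move=> v; rewrite !restrE //; case: (boolP (v \in D')) => vD'.
      by rewrite perm_preserves // vD' t't'.
    by rewrite (negPf vD').
  apply: leq_trans t'1; apply/subset_leq_card/subsetP=> v.
  rewrite inE restrE // => /andP[vD']; rewrite vD' inE => ->.
  by case/setDP: vD' => ->.
exists (h * k^-1)%g.
  have h1 : h \in perm.Sym D by rewrite inE; apply: subset_trans hD _; apply: subsetDl.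
  have : (h * k^-1)%g \in perm.Sym D by rewrite groupM // groupV inE.
  by rewrite inE.
have hP v : v \in P -> h v = v by move=> vP; rewrite (out_perm hD) // (disjointFr PD').
have e' : ((tperm a b * t0) ^ h = t')%g.
  by rewrite st' es [LHS]conjMg tpermJ !hP ?inE ?eqxx ?orbT.
by rewrite conjgM e' /t' conjgK.
Qed.

(** The pairings form one conjugacy class of Sym(D), and the size of a class times the order of a
    centralizer is the order of the group. *)
Lemma sum_card_cent_pairing D :
  (\sum_(t | pairing D t) #|[set h | perm_on D h & h \in 'C[t]]| = #|D|`!)%N.
Proof.
have [t0 p0 th] := pairing_class D; pose G := [group of perm.Sym D].
have t0G : t0 \in G by rewrite inE; case/pairingP: p0.
have clE t : pairing D t = (t \in t0 ^: G).
  apply/idP/imsetP => [/th[h hD ->]|[h hG ->]]; first by exists h; rewrite ?inE.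
  by apply: pairingJ => //; rewrite inE in hG.
transitivity (\sum_(t in t0 ^: G) #|'C_G[t]|)%N.
  apply: eq_big => [t|t _]; first exact: clE.
  by apply: eq_card => h; rewrite [LHS]inE in_setI; congr (_ && _); rewrite inE.
transitivity (\sum_(t in t0 ^: G) #|'C_G[t0]|)%N.
  apply: eq_bigr => _ /imsetP[h hG ->].
  by rewrite -(cardJg 'C_G[t0] h) conjIg -cent1J conjGid.
by rewrite sum_nat_const -index_cent1 mulnC Lagrange ?subcent1_sub // perm.card_Sym.
Qed.

End PairingClass.

(** * Comparison of the two sums *)

Section Identity.

Variable T : finType.
Implicit Types (t x g h z : {perm T}) (D : {set T}).

Section Nontrivial.

Variables (zeta : nat -> algC) (hz : prim_roots zeta).

(** The witness rotates by x only the cycles of v and t v. Its weight is zeta_i, where i > 1 is the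
    length of the cycle of the block of v. *)
Lemma wt_restr_neq1 t x v : involutive t -> (forall v, t (x v) = x (t v)) ->
  blk t (x v) != blk t v ->
  wt zeta t x (restr_perm (two_cycles t x v) x) != 1.
Proof.
move=> tt tx xv; set S := two_cycles t x v.
have xE w : x w = iter 1 x w by [].
have zE := twistE v tx xE; have zt := twist_t v tt tx xE; rewrite -/S in zE zt.
set z := restr_perm S x in zE zt *.
have hx := iter_hat_blk (x := x) _ _ tx.
rewrite /wt /weight (bigD1 (froot (hat x) (blk t v))) /=; last first.
  rewrite froot_idem eqxx andbT.
  by apply: (preserves_sub_porbit (hat_preservesT tx) (froot_porbit _ _)); apply: blk_in.
rewrite big1 ?mulr1 => [|_ /andP[/andP[/imsetP[w _ ->] /eqP rw] nw]]; last first.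
  rewrite hat_blk // zE ifN ?divff ?phase_neq0 //; apply: contra nw => wS.
  rewrite -rw froot_eqP porbit_sym; case/setUP: wS.
    by case/porbit_iterP=> a ->; apply/porbit_iterP; exists a; rewrite hx.
  case/imsetP=> _ /porbit_iterP[a ->] ->; apply/porbit_iterP; exists a.
  by rewrite hx; apply/eqP/blk_eqP => //; right.
have /porbit_iterP[a e] := froot_porbit (hat x) (blk t v).
rewrite e hx hat_blk // zE inE mem_porbit_iter /=.
rewrite -(hat_blk _ tx) phase_step // mulfK ?phase_neq0 //; set i := #|_|.
have i0 : (0 < i)%N by apply: card_porbit_gt0.
have := prim_order_dvd (hz i0) 1; rewrite expr1 => <-.
rewrite /i -hx porbit_iter -iter_fixE /=.
by rewrite hat_blk.
Qed.

(** In g, the weight is a linear character of the common centralizer of x and t, and [wt_restr_neq1]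
    shows that it is nontrivial. *)
Lemma sum_wt_cent0 t x D : involutive t -> perm_on D t -> perm_on D x ->
  (forall v, t (x v) = x (t v)) -> (exists v, blk t (x v) != blk t v) ->
  \sum_(g | [&& perm_on D g, g \in 'C[x] & g \in 'C[t]]) wt zeta t x g = 0.
Proof.
move=> tt tD xD tx [v xv]; pose z := restr_perm (two_cycles t x v) x.
have xE w : x w = iter 1 x w by [].
have zt := twist_t v tt tx xE; have zx := twist_g v tx xE.
have zD : perm_on D z.
  by apply: perm_on_restr => //; apply: (two_cycles_u tx xE).
pose G := ([group of perm.Sym D] :&: 'C[x] :&: 'C[t])%G.
have GE g : [&& perm_on D g, g \in 'C[x] & g \in 'C[t]] = (g \in G).
  by rewrite /= !in_setI -andbA; congr (_ && _); rewrite inE.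
have zG : z \in G.
  by rewrite -GE; apply/and3P; split=> //; apply/perm_commP => w.
rewrite (eq_bigl _ _ GE); set S := \sum_(g in G) _.
have e : S = wt zeta t x z * S.
  rewrite {1}/S (reindex_inj (mulgI z)) /= /S mulr_sumr.
  apply: eq_big => [g|g]; first by rewrite groupMl.
  rewrite groupMl // -GE => /and3P[_ /perm_commP gx /perm_commP gt].
  by apply: wtM => // w; rewrite ?zt ?zx.
have := wt_restr_neq1 tt tx xv; rewrite -/z => z1.
apply/eqP; move/eqP: e; rewrite -subr_eq0 -{1}[S]mul1r -mulrBl mulf_eq0.
by rewrite subr_eq0 eq_sym (negPf z1).
Qed.

(** When D is the whole set, [odd_sum] and [pair_sum] are the values at g of the two sides of the
    theorem ([sum_psiS], [ind_etaBE]). *)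
Definition odd_sum D g := \sum_(x in odd_cycles D g) wt zeta 1%g x g.

Definition pair_sum D g := \sum_(p in pairs D g) wt zeta p.1 p.2 g.

Lemma pair_sumE D g :
  pair_sum D g = \sum_t \sum_(x in regular_over D g t) wt zeta t x g.
Proof.
rewrite /pair_sum pairs_regular // pair_big_dep /=.
by apply: eq_bigl => -[t x] /=; rewrite [x \in _]inE.
Qed.

(** The sum vanishes for each t separately: the twist by the 2'-part applies if t preserves every
    nontrivial cycle of g, and the full twist by g along a cycle that is not preserved otherwise. *)
Lemma pair_sum_odd_part D g q : perm_on D g -> odd_part g q != q -> pair_sum D g = 0.
Proof.
move=> gD uq; rewrite pair_sumE big1 // => t _.
case: (boolP [forall v, (g v != v) ==> (t v \in porbit g v)]) => [/forallP h|].
  by apply: (regular_over_odd0 hz gD _ uq) => v; apply/implyP.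
by case/forallPn=> v; rewrite negb_imply => /andP[gv tv]; apply: (regular_over_swap0 hz gD gv tv).
Qed.

Lemma odd_sum_two D g b : (forall v, iter (2 ^ b) g v = v) -> perm_on D g ->
  let M := [set v | g v != v] in
  odd_sum D g = (#|odd_cycles M g| * #|odd_cycles (D :\: M) 1%g|)%:R.
Proof.
move=> gb gD M; rewrite -card_odd_cycles_split // /odd_sum -sumr_const.
apply: eq_bigr => x /odd_cyclesP[xD gx ox]; apply: (wt_eq1 hz gb) => //.
- by move=> v; rewrite !perm1.
by move=> v; rewrite !perm1.
Qed.

Lemma pair_sum_two D g b : (forall v, iter (2 ^ b) g v = v) -> perm_on D g ->
  let M := [set v | g v != v] in
  pair_sum D g = (#|odd_cycles M g| * #|pairs (D :\: M) 1%g|)%:R.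
Proof.
move=> gb gD M; rewrite -(card_fine_pairs gb) // pair_sumE.
rewrite (bigID (fun t : {perm T} => [forall v in M, t v \in porbit g v])) /= addrC big1 => [|t].
  rewrite add0r pair_big_dep /= -sumr_const; apply: eq_big => [[t x]|[t x]] /=.
    by rewrite inE [in RHS]inE /= andbC andbA.
  case/andP=> /forall_inP fin /regular_overP[tD tt t1 [tg xD gx tx /andP[pos reg]]].
  apply: (wt_eq1 hz gb) => // v vM; have /implyP := forallP reg v; apply.
  exact/porbit_sub_biorbitr/fin.
case/forallPn=> v; rewrite negb_imply inE => /andP[gv tv].
exact: (regular_over_swap0 hz gD gv tv).
Qed.

(* The inner sums over the centralizer of x are sums of a linear character,
   nontrivial unless x = 1. *)
Lemma sum_odd_sum D : \sum_(g | perm_on D g) odd_sum D g = (#|D|`!)%:R.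
Proof.
rewrite (exchange_big_dep (fun x => perm_on D x && [forall v, odd #|porbit x v|])) /=; last first.
  by move=> g x _ /odd_cyclesP[-> _ ox]; apply/forallP.
have p1 : perm_on D 1%g && [forall v, odd #|porbit (1%g : {perm T}) v|].
  rewrite perm_on1; apply/forallP=> v; rewrite card_porbit_fix // perm1.
  by [].
rewrite (bigD1 1%g) //= [X in _ + X]big1 ?addr0 => [|x /andP[/andP[xD /forallP ox] x1]].
  under eq_bigr do rewrite wt_id.
  rewrite -card_perm -sumr_const; apply: eq_bigl => g.
  rewrite -[RHS]/(perm_on D g); case: (boolP (perm_on D g)) => //= gD.
  apply/odd_cyclesP; split; [exact: perm_on1|by move=> v; rewrite !perm1|].
  by apply/forallP; case/andP: p1.
rewrite -[RHS](@sum_wt_cent0 1%g x D) //.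
- apply: eq_bigl => g; apply: andb_id2l => gD; apply/odd_cyclesP/andP.
    by case=> _ gx _; split; apply/perm_commP => // v; rewrite !perm1.
  by case=> /perm_commP gx _.
- by move=> v; rewrite !perm1.
- exact: perm_on1.
- by move=> v; rewrite !perm1.
have [v xv] : exists v, x v != v.
  apply/existsP; rewrite -negb_forall; apply: contra x1 => /forallP h.
  by apply/eqP/permP=> v; rewrite perm1; apply/eqP.
exists v; apply: contra xv => /blk_eqP h.
have [|-> //|] := h; first by move=> w; rewrite !perm1.
by rewrite perm1 => ->.
Qed.

(** For fixed t and x the element g runs through their common centralizer. Only x = 1 survives and
    gives the order of the centralizer of t; [sum_card_cent_pairing] adds these up. *)
Lemma sum_pair_sum D : \sum_(g | perm_on D g) pair_sum D g = (#|D|`!)%:R.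
Proof.
pose Q t x := [&& pairing D t, perm_on D x, x \in 'C[t] & positive x t].
rewrite (exchange_big_dep (fun p => Q p.1 p.2)) /=; last first.
  move=> g [t x] _ /pairsP[/= tD tt t1 [tg xD gx tx pos]]; apply/and4P; split=> //.
    exact/pairingP.
  exact/perm_commC.
transitivity (\sum_(t | pairing D t) \sum_(x | [&& perm_on D x, x \in 'C[t] & positive x t])
    \sum_(g | perm_on D g && ((t, x) \in pairs D g)) wt zeta t x g).
  by rewrite [in RHS]pair_big_dep; apply: eq_big => [[t x]|[t x] _].
rewrite -sum_card_cent_pairing natr_sum; apply: eq_bigr => t /pairingP[tD tt t1].
have q1 : [&& perm_on D 1%g, 1%g \in 'C[t] & positive 1%g t].
  rewrite perm_on1 group1; apply/forallP=> v; apply/implyP=> _.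
  by rewrite perm1.
have CE x g : perm_on D x -> x \in 'C[t] -> positive x t ->
    perm_on D g && ((t, x) \in pairs D g) = [&& perm_on D g, g \in 'C[x] & g \in 'C[t]].
  move=> xD /perm_commC xt pos; apply: andb_id2l => gD; apply/pairsP/andP.
    case=> _ _ _ [tg _ gx _ _]; by split; apply/perm_commP => // v; rewrite tg.
  by case=> /perm_commP gx /perm_commC tg; split.
rewrite (bigD1 1%g) //= [X in _ + X]big1 ?addr0 => [|x /andP[/and3P[xD xt pos] x1]].
  under eq_bigr do rewrite wt_id.
  rewrite -sumr_const; apply: eq_bigl => g.
  case/and3P: q1 => h1 h2 h3; rewrite CE // inE; congr (_ && _).
  rewrite (_ : g \in 'C[1%g]) //; apply/perm_commP => v; by rewrite !perm1.
rewrite (eq_bigl _ _ (fun g => CE x g xD xt pos)); apply: sum_wt_cent0 => //.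
  exact/perm_commC.
have [v xv] : exists v, x v != v.
  apply/existsP; rewrite -negb_forall; apply: contra x1 => /forallP h.
  by apply/eqP/permP=> v; rewrite perm1; apply/eqP.
exists v; apply: contra xv => /blk_eqP h.
(* If x fixes the block of v, then x v is v or t v; in the second case t v lies in the x-cycle of v,
   and positivity gives x v = v again. *)
have [//|->//|e] := h.
by have /implyP := forallP pos v; apply; rewrite -e -[x v]/(iter 1 x v) mem_porbit_iter.
Qed.

End Nontrivial.

Lemma two_element_iter g : (forall v, odd_part g v = v) ->
  exists b, forall v, iter (2 ^ b) g v = v.
Proof.
move=> h; have [b hb] := odd_part_pow g; exists b => v.
by rewrite hb; apply: iter_fix.
Qed.

(** The two systems of roots of unity may differ, because wherever the sums do not cancel they are
    cardinalities. *)
Lemma odd_sum_pair_sum zeta xi D g : prim_roots zeta -> prim_roots xi ->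
  perm_on D g -> odd_sum zeta D g = pair_sum xi D g.
Proof.
move=> hz hx; have [n] := ubnP #|D|; elim: n D g => // n IHn D g Dn.
have one v : iter (2 ^ 0) (1%g : {perm T}) v = v.
  by rewrite /= perm1.
have M0 : [set v | (1%g : {perm T}) v != v] = set0.
  by apply/setP=> v; rewrite !inE perm1 eqxx.
have c1 : #|odd_cycles set0 (1%g : {perm T})| = 1%N.
  rewrite -(cards1 (1%g : {perm T})); apply: eq_card => x; rewrite in_set1.
  apply/odd_cyclesP/eqP => [[x0 _ _]|->].
    by apply: (perm_on_card1 _ x0); rewrite cards0.
  by split=> [|v|v]; rewrite ?perm_on1 ?perm1 // card_porbit_fix ?perm1.
(* The identity is a 2-element that moves no point, so both sums at 1 are cardinalities, the form in
   which the induction hypothesis is used. *)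
have F1 (E : {set T}) : odd_sum zeta E 1%g = #|odd_cycles E 1%g|%:R.
  by rewrite (odd_sum_two hz one) ?perm_on1 // M0 setD0 c1 mul1n.
have G1 (E : {set T}) : pair_sum xi E 1%g = #|pairs E 1%g|%:R.
  by rewrite (pair_sum_two hx one) ?perm_on1 // M0 setD0 c1 mul1n.
have neq1 h : perm_on D h -> h != 1%g -> odd_sum zeta D h = pair_sum xi D h.
  move=> hD h1; case: (boolP [forall v, odd_part h v == v]) => [/forallP o|]; last first.
    by case/forallPn=> v ov; rewrite [LHS](odd_cycles0 hz hD ov) (pair_sum_odd_part hx hD ov).
  have [b hb] := two_element_iter (fun v => eqP (o v)).
  rewrite (odd_sum_two hz hb) // (pair_sum_two hx hb) //; set M := [set v | _].
  have [v vM] : exists v, v \in M.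
    apply/existsP; rewrite -[X in is_true X]negbK negb_exists; apply: contra h1 => /forallP e.
    by apply/eqP/permP=> v; have := e v; rewrite inE negbK perm1 => /eqP.
  have vD : v \in D by apply: (subsetP hD); rewrite inE in vM.
  have ltZ : (#|D :\: M| < n)%N.
    apply: leq_trans (_ : #|D| <= n)%N => //; apply/proper_card/properP.
    by split; [apply: subsetDl|exists v => //; rewrite inE vM].
  have := IHn _ 1%g ltZ (perm_on1 _); rewrite F1 G1 => e.
  by rewrite !natrM e.
have [->|] := eqVneq g 1%g; last by move=> g1 gD; apply: neq1.
move=> _; have := sum_odd_sum hz D; rewrite -(sum_pair_sum hx D).
rewrite (bigD1 1%g) ?perm_on1 //= [in RHS](bigD1 1%g) ?perm_on1 //=.
rewrite (eq_bigr (pair_sum xi D)); first exact: addIr.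
by move=> h /andP[hD h1]; apply: neq1.
Qed.

End Identity.

(** * Conjugacy classes *)

Section CycleType.

Variable n : nat.
Implicit Types (s x y h : 'S_n) (l : intpart n).

Definition cycle_sizes s := [seq #|C| | C : {set 'I_n} <- enum (porbits s)].

Lemma mem_cycle_sizes s p : #|porbit s p| \in cycle_sizes s.
Proof. by apply: map_f; rewrite mem_enum imset_f. Qed.

Lemma partition_porbits s : partition (porbits s) [set: 'I_n].
Proof.
apply/and3P; split.
- apply/eqP/setP=> p; rewrite inE; apply/bigcupP; exists (porbit s p).
    exact: imset_f.
  exact: porbit_id.
- apply/trivIsetP=> _ _ /imsetP[p _ ->] /imsetP[q _ ->]; apply: contraR => /pred0Pn[v /andP[/= vp vq]].
  by move: vp vq; rewrite -!eq_porbit_mem => /eqP-> /eqP->.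
apply/imsetP=> -[p _ /setP/(_ p)]; by rewrite porbit_id inE.
Qed.

Lemma sumn_cycle_sizes s : sumn (cycle_sizes s) = n.
Proof.
rewrite sumnE big_map big_enum -(card_partition (partition_porbits s)).
by rewrite cardsT card_ord.
Qed.

Lemma cycle_sizes_gt0 s : all (leq 1) (cycle_sizes s).
Proof.
by apply/allP=> _ /mapP[C + ->]; rewrite mem_enum => /imsetP[p _ ->]; apply: card_porbit_gt0.
Qed.

Lemma has_cycle_type_exists s : exists l, has_cycle_type s l.
Proof.
pose ss := sort geq (cycle_sizes s).
have pss : perm_eq ss (cycle_sizes s) by rewrite perm_sort.
have szn : (size ss <= n)%N.
  rewrite size_sort; apply: leq_trans (_ : sumn (cycle_sizes s) <= n)%N; last first.
    by rewrite sumn_cycle_sizes.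
  elim: (cycle_sizes s) (cycle_sizes_gt0 s) => //= a r IHr /andP[a0 /IHr].
  by rewrite -add1n; apply: leq_add.
have ltn c : c \in ss -> (c < n.+1)%N.
  rewrite (perm_mem pss) => /mapP[C _ ->]; rewrite ltnS -[X in (_ <= X)%N]card_ord.
  exact: max_card.
have szi : (size (map (@inord n) ss) <= n)%N by rewrite size_map.
have vi : map val (Bseq szi) = ss.
  rewrite /= -map_comp -[RHS]map_id; apply/eq_in_map => c /ltn cn /=.
  by rewrite inordK.
have ip : is_intpart n (map val (Bseq szi)).
  rewrite vi; apply/and3P; split.
  - by apply: sort_sorted => a c; apply: leq_total.
  - by rewrite (perm_all _ pss) cycle_sizes_gt0.
  by rewrite (perm_sumn pss) sumn_cycle_sizes.
exists (Intpart ip); rewrite /has_cycle_type /parts /= -/(cycle_sizes s).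
by rewrite perm_sym; move: pss; rewrite -{1}vi.
Qed.

Lemma has_cycle_type_uniq s l l' : has_cycle_type s l -> has_cycle_type s l' -> l = l'.
Proof.
rewrite /has_cycle_type perm_sym => h h'; have := perm_trans h h' => {h h'} p.
have sp (k : intpart n) : sorted geq (parts k).
  by have /and3P[] : is_intpart n (parts k) by case: k.
have e : parts l = parts l'.
  apply: (sorted_eq _ _ (sp l) (sp l') p).
    by move=> a c d /= h1 h2; apply: leq_trans h2 h1.
  by move=> a c /= /andP[h1 h2]; apply/eqP; rewrite eqn_leq h1 h2.
by apply/val_inj/val_inj; apply: (inj_map val_inj).
Qed.

Lemma odd_partsE s l : has_cycle_type s l ->
  odd_parts l = [forall p, odd #|porbit s p|].
Proof.
move=> h; rewrite /odd_parts -(perm_all _ h) -/(cycle_sizes s).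
apply/allP/forallP => [o p|o _ /mapP[C + ->]]; first by apply/o/mem_cycle_sizes.
by rewrite mem_enum => /imsetP[p _ ->].
Qed.

Lemma porbitsJ s h :
  porbits (s ^ h)%g = [set h @: (C : {set 'I_n}) | C in porbits s].
Proof.
have e p : porbit (s ^ h)%g (h p) = h @: porbit s p.
  apply/setP=> v; have it a : iter a (s ^ h)%g (h p) = h (iter a s p).
    by elim: a => //= a ->; rewrite permJ.
  apply/porbit_iterP/imsetP => [[a ->]|[_ /porbit_iterP[a ->] ->]].
    by exists (iter a s p); rewrite ?mem_porbit_iter ?it.
  by exists a; rewrite it.
apply/setP=> A; apply/imsetP/imsetP => [[p _ ->]|[_ /imsetP[p _ ->] ->]].
  by exists (porbit s (h^-1 p)%g); rewrite ?imset_f // -e permKV.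
by exists (h p); rewrite ?e.
Qed.

Lemma has_cycle_typeJ s h l : has_cycle_type (s ^ h)%g l = has_cycle_type s l.
Proof.
rewrite /has_cycle_type -/(cycle_sizes _) -/(cycle_sizes s).
suff p : perm_eq (cycle_sizes (s ^ h)%g) (cycle_sizes s) by rewrite (permPl p).
have : perm_eq (enum (porbits (s ^ h)%g)) [seq h @: (C : {set 'I_n}) | C <- enum (porbits s)].
  apply: uniq_perm; first exact: enum_uniq.
    by rewrite map_inj_uniq ?enum_uniq //; apply/imset_inj/perm_inj.
  move=> A; rewrite mem_enum porbitsJ; apply/imsetP/mapP => -[C Cs ->]; exists C => //.
    by rewrite mem_enum.
  by rewrite mem_enum in Cs.
move/(perm_map (fun C : {set 'I_n} => #|C|))/perm_trans; apply.
rewrite -map_comp (@eq_map _ _ _ (fun C : {set 'I_n} => #|C|)) //.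
by move=> C /=; rewrite card_imset //; apply: perm_inj.
Qed.

(** A permutation of indices matches cycles of equal size. With base points r and r' in matched
    cycles, the conjugating permutation [f] sends x^a r to y^a r'. *)
Lemma cycle_sizes_conj x y : perm_eq (cycle_sizes x) (cycle_sizes y) ->
  exists h, y = (x ^ h)%g.
Proof.
case/(perm_iotaP 0%N) => Is pI eI.
pose sx := enum (porbits x); pose sy := enum (porbits y).
have szI : size Is = size sy by rewrite (perm_size pI) size_iota size_map.
have szx : size sx = size Is by have := congr1 size eI; rewrite !size_map.
have uI : uniq Is by rewrite (perm_uniq pI) iota_uniq.
have ltI k : (k < size Is)%N -> (nth 0 Is k < size sy)%N.
  move=> kI; have : nth 0%N Is k \in iota 0 (size (cycle_sizes y)).
    by rewrite -(perm_mem pI) mem_nth.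
  by rewrite mem_iota size_map.
pose B C := nth set0 sy (nth 0%N Is (index C sx)).
have sxP p : porbit x p \in sx by rewrite mem_enum imset_f.
have idx p : (index (porbit x p) sx < size Is)%N by rewrite -szx index_mem.
have Bin p : B (porbit x p) \in porbits y.
  by rewrite -mem_enum mem_nth // ltI.
have Bcard p : #|B (porbit x p)| = #|porbit x p|.
  have := congr1 (fun r => nth 0%N r (index (porbit x p) sx)) eI.
  rewrite (nth_map set0) ?index_mem // nth_index // (nth_map 0%N) // => ->.
  by rewrite (nth_map set0) // ltI.
have Binj p q : B (porbit x p) = B (porbit x q) -> porbit x p = porbit x q.
  move/eqP; rewrite nth_uniq ?enum_uniq ?ltI // nth_uniq // => /eqP e.
  by rewrite -(nth_index set0 (sxP p)) e nth_index.
pose r p := froot x p; pose r' p := odflt p [pick q in B (porbit x p)].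
have r'P p : B (porbit x p) = porbit y (r' p).
  rewrite /r'; case: pickP => [q|e] /=.
    by case/imsetP: (Bin p) => w _ ->; rewrite -eq_porbit_mem => /eqP->.
  have := card_porbit_gt0 x p; rewrite -Bcard card_gt0 => /set0Pn[w].
  by rewrite e.
have r'e p q : porbit x p = porbit x q -> r' p = r' q.
  move=> e; rewrite /r' e; case: pickP => //= e0.
  have := card_porbit_gt0 x q; rewrite -Bcard card_gt0 => /set0Pn[w].
  by rewrite e0.
pose f p := iter (findex x (r p) p) y (r' p).
have rK p : iter (findex x (r p) p) x (r p) = p.
  by rewrite iter_findex // (perm_connect_sym x) connect_root.
have ltr p : (findex x (r p) p < #|porbit x p|)%N.
  have -> : #|porbit x p| = #|porbit x (r p)|.
    by rewrite (card_porbit_in (froot_porbit x p)).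
  by rewrite card_porbit_order findex_max // (perm_connect_sym x) connect_root.
have card' p : #|porbit y (r' p)| = #|porbit x p| by rewrite -r'P Bcard.
have f_inj : injective f.
  move=> p q e; have epq : porbit x p = porbit x q.
    apply: Binj; rewrite !r'P; apply/eqP; rewrite eq_porbit_mem.
    have /(congr1 (fun w => porbit y w)) := e.
    have po a w : porbit y (iter a y w) = porbit y w.
      by apply/eqP; rewrite eq_porbit_mem mem_porbit_iter.
    by rewrite !po -eq_porbit_mem => /eqP.
  have er : r p = r q by apply/eqP; rewrite froot_eqP epq porbit_id.
  have lp := ltr p; have lq := ltr q; rewrite -epq in lq.
  move: e; rewrite /f -(r'e _ _ epq) => /eqP; rewrite iter_eqE card'.
  by rewrite !modn_small // => /eqP e; rewrite -[p]rK -[q]rK e er.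
exists (perm f_inj); apply/permP=> v.
rewrite -[v](permKV (perm f_inj)) permJ; set p := ((perm f_inj)^-1)%g v.
rewrite !permE /f /r froot_step -/(r p).
have -> : r' (x p) = r' p.
  by apply: r'e; apply/eqP; rewrite eq_porbit_mem (mem_porbit_iter x 1).
rewrite -iterS; apply/eqP; rewrite iter_eqE card'.
have -> : x p = iter (findex x (r p) p).+1 x (r p) by rewrite iterS rK.
rewrite findex_iter_mod (card_porbit_in (froot_porbit x p)) modn_mod.
exact: eqxx.
Qed.

Lemma has_cycle_type_conj x y l : has_cycle_type x l -> has_cycle_type y l ->
  exists h, y = (x ^ h)%g.
Proof.
move=> hx hy; apply: cycle_sizes_conj; apply: perm_trans hx _.
by rewrite perm_sym.
Qed.

End CycleType.

(** * The linear characters as weights *)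

Section Transport.

Variables (zeta : nat -> algC) (hz : prim_roots zeta).

(** A phase on blocks amounts to a t-invariant function on points, which is what the labels of the
    linear characters provide. *)
Lemma wtE (T P : finType) (t x g : {perm T}) (R : {pred P}) (j : P -> T)
    (phi : T -> algC) :
  involutive t -> (forall v, t (x v) = x (t v)) ->
  (forall v, t (g v) = g (t v)) -> (forall v, g (x v) = x (g v)) ->
  (forall v, phi v != 0) -> (forall v, phi (t v) = phi v) ->
  (forall v, phi (x v) = zeta #|porbit (hat x) (blk t v)| * phi v) ->
  {in R &, forall p q, blk t (j q) \in porbit (hat x) (blk t (j p)) -> p = q} ->
  (forall v, exists2 p, p \in R & blk t (j p) \in porbit (hat x) (blk t v)) ->
  wt zeta t x g = \prod_(p in R) (phi (g (j p)) / phi (j p)).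
Proof.
move=> tt tx tg gx phi0 phit phix jinj jsurj.
(* The default value 1 concerns only the empty set, which is not a block. *)
pose theta (A : {set T}) := if [pick v in A] is Some v then phi v else 1.
have thetaE v : theta (blk t v) = phi v.
  rewrite /theta; case: pickP => [w|/(_ v)]; last by rewrite !inE eqxx.
  by rewrite !inE => /orP[]/eqP->.
rewrite /wt (@weightE _ zeta hz P (hat x) (hat g) _ R (fun p => blk t (j p)) theta).
- by apply: eq_bigr => p _; rewrite hat_blk // !thetaE.
- exact: hat_comm.
- exact: hat_preservesT.
- exact: hat_preservesT.
- by move=> _ /imsetP[v _ ->]; rewrite hat_blk // !thetaE.
- by move=> p _; apply: blk_in.
- exact: jinj.
by move=> _ /imsetP[v _ ->]; apply: jsurj.
Qed.

Lemma card_porbit_blk1 (T : finType) (x : {perm T}) v :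
  #|porbit (hat x) (blk 1%g v)| = #|porbit x v|.
Proof.
have tt : involutive (1%g : {perm T}) by move=> w; rewrite !perm1.
have tx w : (1%g : {perm T}) (x w) = x ((1%g : {perm T}) w) by rewrite !perm1.
apply/eqP; rewrite eqn_dvd dvdn_card_porbit_blk //= -iter_fixE.
have /eqP := iter_porbit (hat x) (blk 1%g v); rewrite iter_hat_blk //.
by case/(blk_eqP _ _ tt) => ->; rewrite ?perm1.
Qed.

Lemma omegaS_wt (T : finType) (x g : {perm T}) : (forall v, g (x v) = x (g v)) ->
  omegaS zeta x g = wt zeta 1%g x g.
Proof.
move=> gx; have tt : involutive (1%g : {perm T}) by move=> w; rewrite !perm1.
have tc (z : {perm T}) w : (1%g : {perm T}) (z w) = z ((1%g : {perm T}) w) by rewrite !perm1.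
have blk1 u v : (blk 1%g u \in porbit (hat x) (blk 1%g v)) = (u \in porbit x v).
  apply/porbit_iterP/porbit_iterP => -[a e]; exists a.
    by move/eqP: e; rewrite iter_hat_blk // => /(blk_eqP _ _ tt)[]; rewrite ?perm1.
  by rewrite iter_hat_blk // e.
rewrite (@wtE T T 1%g x g (froots x) id (phase zeta x)) //.
- apply: eq_bigr => p /eqP rp; rewrite (phase_root zeta rp) divr1.
  by rewrite /phase card_porbit_commg.
- by move=> v; rewrite phase_neq0.
- by move=> v; rewrite perm1.
- by move=> v; rewrite card_porbit_blk1 phase_step.
- by move=> p q /eqP rp /eqP rq; rewrite blk1 -froot_eqP rp rq => /eqP.
move=> v; exists (froot x v); last by rewrite blk1 froot_porbit.
by apply/eqP; exact: froot_idem.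
Qed.

(** Points outside the image of j are fixed and contribute 1. This covers both the embedding of B_m
    and, with j a permutation, conjugation. *)
Lemma wt_embed (T T' : finType) (j : T -> T') (t x g : {perm T}) (t' x' g' : {perm T'}) :
  injective j -> involutive t -> (forall v, t (x v) = x (t v)) ->
  (forall v, t (g v) = g (t v)) -> (forall v, g (x v) = x (g v)) ->
  (forall v, t' (j v) = j (t v)) -> (forall v, x' (j v) = j (x v)) ->
  (forall v, g' (j v) = j (g v)) ->
  (forall w, w \notin codom j -> [/\ t' w = w, x' w = w & g' w = w]) ->
  wt zeta t' x' g' = wt zeta t x g.
Proof.
move=> ji tt tx tg gx jt jx jg out.
have onj (P : T' -> Prop) : (forall v, P (j v)) -> (forall w, w \notin codom j -> P w) ->
    forall w, P w.
  by move=> h1 h2 w; case: (boolP (w \in codom j)) => [/codomP[v ->]|/h2].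
have tt' : involutive t'.
  apply: (onj (fun w => t' (t' w) = w)) => [v|w /out[e _ _]]; first by rewrite !jt tt.
  by rewrite !e.
have tx' w : t' (x' w) = x' (t' w).
  apply: (onj (fun w => t' (x' w) = x' (t' w))) => [v|{}w /out[e1 e2 _]]; first by rewrite jx !jt jx tx.
  by rewrite e2 e1 e2.
have tg' w : t' (g' w) = g' (t' w).
  apply: (onj (fun w => t' (g' w) = g' (t' w))) => [v|{}w /out[e1 _ e2]]; first by rewrite jg !jt jg tg.
  by rewrite e2 e1 e2.
have gx' w : g' (x' w) = x' (g' w).
  apply: (onj (fun w => g' (x' w) = x' (g' w))) => [v|{}w /out[_ e1 e2]]; first by rewrite jx !jg jx gx.
  by rewrite e1 e2 e1.
pose U := j @: T.
have UP v : j v \in U by rewrite imset_f.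
have jblk v : blk t' (j v) = j @: blk t v by rewrite imsetU1 imset_set1 -jt.
have Us : blocks t' U \subset blocks t' [set: T'].
  by apply/subsetP=> _ /imsetP[w _ ->]; apply: blk_in.
have xU : preserves x' U by move=> _ /imsetP[v _ ->]; rewrite jx.
have gU : preserves g' U by move=> _ /imsetP[v _ ->]; rewrite jg.
rewrite {1}/wt (weight_split _ _ _ Us) [X in _ * X]big1 ?mulr1; last first.
  move=> _ /andP[/setDP[/imsetP[w _ ->] wU] _]; rewrite hat_blk //.
  suff /out[_ _ ->] : w \notin codom j by rewrite divff // phase_neq0.
  by apply: contra wU => /codomP[v ->]; rewrite imset_f // UP.
pose R := [pred A in blocks t [set: T] | froot (hat x) A == A].
have po v (A : {set T}) : (j @: A \in porbit (hat x') (blk t' (j v))) = (A \in porbit (hat x) (blk t v)).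
  have it a : iter a (hat x') (blk t' (j v)) = j @: iter a (hat x) (blk t v).
    rewrite !iter_hat_blk //; have -> : iter a x' (j v) = j (iter a x v).
      by elim: a => //= a ->; rewrite jx.
    exact: jblk.
  by apply/porbit_iterP/porbit_iterP => -[a e]; exists a; move: e; rewrite it;
     [move/(imset_inj ji)|move=> ->].
pose theta (A : {set T'}) := phase zeta (hat x) (j @^-1: A).
have pre (A : {set T}) : j @^-1: (j @: A) = A.
  by apply/setP=> v; rewrite inE mem_imset.
rewrite (@weightE _ zeta hz _ (hat x') (hat g') _ R (fun A : {set T} => j @: A) theta).
- rewrite /wt /weight; apply: eq_big => [A|A /andP[/imsetP[v _ ->] _]].
    by rewrite !inE.
  by rewrite -jblk hat_blk // jg !jblk /theta !pre hat_blk.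
- exact: hat_comm.
- exact: hat_preserves.
- exact: hat_preserves.
- move=> _ /imsetP[_ /imsetP[v _ ->] ->]; rewrite hat_blk // jx.
  rewrite /theta !jblk !pre phase_neq0 // -hat_blk // phase_step //.
  split=> //; congr (zeta _ * _).
  apply/eqP; rewrite eqn_dvd -!iter_fixE -jblk !iter_hat_blk //.
  have it a : iter a x' (j v) = j (iter a x v) by elim: a => //= a ->; rewrite jx.
  rewrite !it !jblk.
  have := iter_porbit (hat x) (blk t v); rewrite iter_hat_blk // => ->.
  rewrite eqxx andbT; have := iter_porbit (hat x') (blk t' (j v)).
  by rewrite iter_hat_blk // it !jblk => /(imset_inj ji)->.
- by move=> A /andP[/imsetP[v _ ->] _]; rewrite -jblk imset_f ?UP.
- move=> _ _ /andP[/imsetP[v _ ->] /eqP rv] /andP[/= /imsetP[w _ ->] /eqP rw].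
  by rewrite -(jblk v) po -froot_eqP rv rw => /eqP.
move=> _ /imsetP[_ /imsetP[v _ ->] ->]; exists (froot (hat x) (blk t v)).
  rewrite inE /= froot_idem eqxx andbT.
  by apply: (preserves_sub_porbit (hat_preservesT tx) (froot_porbit _ _)); apply: blk_in.
by rewrite po froot_porbit.
Qed.

Lemma wtJ (T : finType) (t x g h : {perm T}) : involutive t ->
  (forall v, t (x v) = x (t v)) -> (forall v, t (g v) = g (t v)) ->
  (forall v, g (x v) = x (g v)) ->
  wt zeta (t ^ h)%g (x ^ h)%g (g ^ h)%g = wt zeta t x g.
Proof.
move=> tt tx tg gx; apply: (@wt_embed _ _ h) => // [|v|v|v|w]; rewrite ?permJ //.
  exact: perm_inj.
by case/codomP; exists (h^-1 w)%g; rewrite permKV.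
Qed.

End Transport.

Section Signed.

Variables (m : nat) (zeta : nat -> algC) (hz : prim_roots zeta).
Variables (x : {perm spoint m}).
Hypotheses (xB : x \in Bgroup m) (xp : all_positive x).

Let e := relU (frel x) (frel (@neg m)).

Let xn v : x (neg v) = neg (x v).
Proof. by have /signed_permsP-> := xB. Qed.

Let csym : connect_sym e.
Proof.
have ninj := inv_inj (@neg_inv m).
by apply: relU_sym; apply: fconnect_sym => //; apply: perm_inj.
Qed.

Lemma sroot_idem v : sroot x (sroot x v) = sroot x v.
Proof. exact: fingraph.root_root. Qed.

Lemma sroot_x v : sroot x (x v) = sroot x v.
Proof.
apply/esym/fingraph.rootP => //; apply: connect1.
by rewrite /e /= eqxx.
Qed.

Lemma sroot_neg v : sroot x (neg v) = sroot x v.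
Proof.
apply/esym/fingraph.rootP => //; apply: connect1.
by rewrite /e /= eqxx orbT.
Qed.

Let nxn n v : neg (iter n x v) = iter n x (neg v).
Proof. by elim: n => //= n <-. Qed.

Lemma sroot_span v : exists n, v = iter n x (sroot x v) \/ v = neg (iter n x (sroot x v)).
Proof.
have /connectP[p] : connect e (sroot x v) v by rewrite csym connect_root.
elim/last_ind: p v (sroot x v) => [|p u IHp] v q /=.
  by move=> _ ->; exists 0%N; left.
rewrite rcons_path last_rcons => /andP[pp /orP /= lu] ->.
have [n eq_l] := IHp _ q pp erefl.
case: lu => /eqP <-.
  by exists n.+1; case: eq_l => ->; [left|right; rewrite xn].
by exists n; case: eq_l => ->; [right|left; rewrite neg_inv].
Qed.

Lemma slabel_iter q n : slabel x q (iter n x q) = (n %% #|porbit x q|)%N.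
Proof. by rewrite /slabel mem_porbit_iter findex_iter_mod. Qed.

Lemma slabel_neg_iter q n : slabel x q (neg (iter n x q)) = (n %% #|porbit x q|)%N.
Proof.
rewrite -findex_iter_mod /slabel neg_inv ifN // nxn.
apply: contra (forallP xp q); rewrite -!eq_porbit_mem => /eqP <-.
by rewrite -permX porbit_perm.
Qed.

(** The label ignores the sign, so this phase is constant on the pairs v, -v, as [wtE] requires. *)
Definition sphase v : algC := zeta #|porbit x v| ^+ slabel x (sroot x v) v.

Let porbit_neg v : #|porbit x (neg v)| = #|porbit x v|.
Proof. by apply: card_porbit_comm; [apply: inv_inj (@neg_inv m)|move=> w; rewrite xn]. Qed.

Lemma sphase_neg v : sphase (neg v) = sphase v.
Proof.
rewrite /sphase porbit_neg sroot_neg; congr (_ ^+ _).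
have [n en] := sroot_span v; set q := sroot x v in en *.
by case: en => ->; rewrite ?neg_inv slabel_iter slabel_neg_iter.
Qed.

Lemma sphase_x v : sphase (x v) = zeta #|porbit x v| * sphase v.
Proof.
rewrite /sphase porbit_step sroot_x -exprS.
have [n en] := sroot_span v; set q := sroot x v in en *.
have ei : #|porbit x v| = #|porbit x q|.
  by case: en => ->; rewrite ?porbit_neg porbit_iter.
have i0 := card_porbit_gt0 x q.
have -> : slabel x q v = (n %% #|porbit x q|)%N.
  by case: en => ->; rewrite ?slabel_iter ?slabel_neg_iter.
have -> : slabel x q (x v) = (n.+1 %% #|porbit x q|)%N.
  by case: en => ->; rewrite ?xn -iterS ?slabel_iter ?slabel_neg_iter.
by rewrite ei exprS !prim_roots_mod // -exprS.
Qed.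

Lemma omegaB_wt u : u \in Bgroup m -> (forall v, u (x v) = x (u v)) ->
  omegaB zeta x u = wt zeta (neg_perm m) x u.
Proof.
move=> uB ux; have nE v : neg_perm m v = neg v by rewrite permE.
have nn : involutive (neg_perm m) by move=> v; rewrite !nE neg_inv.
have nx v : neg_perm m (x v) = x (neg_perm m v) by rewrite !nE xn.
have nu v : neg_perm m (u v) = u (neg_perm m v).
  by rewrite !nE; have /signed_permsP-> := uB.
have srb v A : A \in porbit (hat x) (blk (neg_perm m) v) -> forall w, w \in A ->
    sroot x w = sroot x v.
  case/porbit_iterP=> a ->; rewrite iter_hat_blk // => w.
  have it : sroot x (iter a x v) = sroot x v by elim: a => //= a <-; rewrite sroot_x.
  by rewrite !inE nE => /orP[]/eqP->; rewrite ?sroot_neg.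
rewrite (@wtE zeta hz _ _ (neg_perm m) x u [pred p | sroot x p == p] id sphase) //.
- apply: eq_bigr => p /eqP rp.
  have -> : sphase p = 1 by rewrite /sphase rp /slabel porbit_id findex0 expr0.
  by rewrite divr1 /sphase card_porbit_commg.
- by move=> v; rewrite prim_rootX_neq0 ?card_porbit_gt0.
- by move=> v; rewrite nE sphase_neg.
- move=> v; rewrite sphase_x card_porbit_blk // nE; exact: (forallP xp v).
- move=> p q /eqP rp /eqP rq h; rewrite -rp -rq; apply/esym/(srb _ _ h).
  by rewrite !inE eqxx.
move=> v; exists (sroot x v); first by rewrite inE sroot_idem.
have [n [en|en]] := sroot_span v; rewrite porbit_sym; apply/porbit_iterP; exists n;
  rewrite iter_hat_blk //; apply/eqP/blk_eqP => //; first by left.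
by right; rewrite nE.
Qed.

End Signed.

Lemma sum_conj (gT : finGroupType) (G : {group gT}) (y : gT) (f : gT -> algC) :
  \sum_(b in G) f (y ^ b)%g = #|'C_G[y]%g|%:R * \sum_(z in (y ^: G)%g) f z.
Proof.
rewrite (partition_big (fun b => y ^ b)%g [in (y ^: G)%g]) /=; last first.
  by move=> b Gb; apply: imset_f.
rewrite mulr_sumr; apply: eq_bigr => _ /imsetP[h Gh ->].
rewrite (eq_bigr (fun=> f (y ^ h)%g)) => [|b /andP[_ /eqP->] //].
rewrite sumr_const mulr_natl; congr (_ *+ _).
rewrite -(card_rcoset 'C_G[y]%g h); apply: eq_card => b.
rewrite mem_rcoset in_setI groupMr ?groupV // cent1C; congr (_ && _).
apply/eqP/cent1P => [e|e].
  apply/commgP/conjg_fixP; by rewrite conjgM e conjgK.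
by move/commgP/conjg_fixP: e; rewrite conjgM => /(canRL (conjgKV _)).
Qed.

Lemma sum_conjV (gT : finGroupType) (G : {group gT}) (y : gT) (f : gT -> algC) :
  \sum_(b in G) f (y ^ b^-1)%g = #|'C_G[y]%g|%:R * \sum_(z in (y ^: G)%g) f z.
Proof.
rewrite -sum_conj (reindex_inj invg_inj) /=.
by apply: eq_big => [b|b _]; rewrite ?groupV ?invgK.
Qed.

(** * The left-hand side as a sum of weights *)

Section Symmetric.

Variables (n : nat) (zeta : nat -> algC) (hz : prim_roots zeta).

Lemma perm_on_setT (s : 'S_n) : perm_on [set: 'I_n] s.
Proof. by apply/subsetP. Qed.

Lemma omegaS_conj (x g b : 'S_n) : (g ^ b)%g \in 'C[x]%g ->
  omegaS zeta x (g ^ b)%g = wt zeta 1%g (x ^ b^-1)%g g.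
Proof.
move=> gx; have gx' v : (g ^ b)%g (x v) = x ((g ^ b)%g v) by move/perm_commP: gx.
have e1 (p : 'S_n) v : (1%g : 'S_n) (p v) = p ((1%g : 'S_n) v) by rewrite !perm1.
rewrite (omegaS_wt hz) // -{1}(wtJ hz b^-1%g) //; last by move=> v; rewrite !perm1.
by rewrite conj1g conjgK.
Qed.

(** The induction formula sums over conjugating elements; each z in the class arises from |C(x)| of
    them, which cancels the normalization. *)
Lemma psiSE (x g : 'S_n) :
  psiS hz x g = \sum_(z in (x ^: [set: 'S_n])%g | g \in 'C[z]%g) wt zeta 1%g z g.
Proof.
rewrite /psiS cfIndE ?subsetT //.
pose f z := if g \in 'C[z]%g then wt zeta 1%g z g else 0.
transitivity (#|'C[x]%g|%:R^-1 * \sum_(b in [set: 'S_n]) f (x ^ b^-1)%g).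
  congr (_ * _); apply: eq_bigr => b _; rewrite cfunE /f.
  have e : (g \in 'C[x ^ b^-1]%g) = ((g ^ b)%g \in 'C[x]%g).
    by rewrite cent1J mem_conjgV.
  rewrite e; case: (boolP (_ \in _)) => [h|_]; last by rewrite mulr0n.
  by rewrite mulr1n omegaS_conj.
rewrite sum_conjV setTI mulKf; last by rewrite Num.Theory.pnatr_eq0 -lt0n cardG_gt0.
by rewrite -big_mkcondr.
Qed.

Lemma sum_psiS (x : intpart n -> 'S_n) (hx : forall l, has_cycle_type (x l) l) g :
  (\sum_(l : intpart n | odd_parts l) psiS hz (x l)) g = odd_sum zeta [set: 'I_n] g.
Proof.
rewrite sum_cfunE; under eq_bigr do rewrite psiSE.
have cl l z : (z \in (x l ^: [set: 'S_n])%g) = has_cycle_type z l.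
  apply/imsetP/idP => [[b _ ->]|h]; first by rewrite has_cycle_typeJ.
  by have [b ->] := has_cycle_type_conj (hx l) h; exists b; rewrite ?inE.
rewrite (exchange_big_dep (fun z => (g \in 'C[z]%g) && [forall p, odd #|porbit z p|])) /=; last first.
  by move=> l z ol /andP[zl ->]; rewrite cl in zl; rewrite -(odd_partsE zl).
rewrite /odd_sum; apply: eq_big => [z|z /andP[gz oz]].
  by rewrite [RHS]inE perm_on_setT cent1C.
have [l zl] := has_cycle_type_exists z.
rewrite (big_pred1 l) // => k; rewrite gz andbT cl.
apply/andP/eqP => [[_ zk]|->]; first exact: has_cycle_type_uniq zk zl.
by rewrite (odd_partsE zl).
Qed.

End Symmetric.

(** * Positive classes and their characters in the group of signed permutations *)

Section SignedClasses.

Variable m : nat.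
Implicit Types (s t : 'S_m) (l : intpart m) (x y u b : {perm spoint m}).

Lemma ord_spermE s v : ord_sperm s v = (s v.1, v.2).
Proof. by rewrite permE. Qed.

Lemma ord_sperm_signed s : ord_sperm s \in Bgroup m.
Proof. by apply/signed_permsP=> v; rewrite !ord_spermE. Qed.

Lemma ord_spermJ s t : ord_sperm (s ^ t)%g = (ord_sperm s ^ ord_sperm t)%g.
Proof.
apply/permP=> v; rewrite -[v](permKV (ord_sperm t)) permJ.
by rewrite !ord_spermE /= permJ.
Qed.

(** Forgetting signs turns a conjugating element of B_m into one of S_m. Hence the partition
    attached to a positive class is unique. *)
Lemma ord_sperm_conj s t b : b \in Bgroup m -> ord_sperm t = (ord_sperm s ^ b)%g ->
  exists h : 'S_m, t = (s ^ h)%g.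
Proof.
move=> /signed_permsP bB e; pose f i := (b (i, false)).1.
have bE v : (b v).1 = f v.1.
  by case: v => i [] //; rewrite -[(i, true)]/(neg (i, false)) bB.
have f_inj : injective f.
  move=> i j eij; have [e1|e1] : b (i, false) = b (j, false) \/ b (i, false) = b (neg (j, false)).
  - rewrite bB; move: eij; rewrite /f; case: (b (i, false)) (b (j, false)) => i1 c [j1 d] /= ->.
    by rewrite /neg /=; case: c d => [] []; auto.
  - by move/perm_inj: e1 => -[].
  by move/perm_inj: e1 => -[].
exists (perm f_inj); apply/permP=> i; rewrite -[i](permKV (perm f_inj)) permJ.
set j := ((perm f_inj)^-1)%g i; rewrite !permE.
have := congr1 (fun z : {perm spoint m} => (z (b (j, false))).1) e.
by rewrite permJ !ord_spermE.
Qed.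

Section Straighten.

Variable x : {perm spoint m}.
Hypotheses (xB : x \in Bgroup m) (xp : all_positive x).

(** Because the cycles are positive, exactly one of v and -v lies in the cycle of their common base
    point, and this choice is stable under x. *)
Let pl v := v \in porbit x (sroot x v).

Let pl_neg v : pl (neg v) = ~~ pl v.
Proof.
have [a e] := sroot_span xB v; rewrite /pl sroot_neg //; set q := sroot x v in e *.
have np w : neg w \notin porbit x w by apply: (forallP xp).
have nm : neg (iter a x q) \notin porbit x q.
  apply: contra (np (iter a x q)); rewrite -!eq_porbit_mem => /eqP->.
  by rewrite eq_porbit_mem porbit_sym mem_porbit_iter.
by case: e => ->; rewrite ?neg_inv mem_porbit_iter (negPf nm).
Qed.

Let pl_x v : pl (x v) = pl v.
Proof.
rewrite /pl sroot_x // -!eq_porbit_mem; congr (_ == _); apply/eqP.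
by rewrite eq_porbit_mem (mem_porbit_iter x 1).
Qed.

(** This sign change exchanges the chosen points with those of positive sign, so the conjugate of x
    by it preserves signs and comes from S_m. *)
Let hf (v : spoint m) : spoint m := if pl (v.1, false) then v else neg v.

Let hfK : involutive hf.
Proof. by move=> v; rewrite /hf; case h: (pl (v.1, false)); rewrite /= h ?neg_inv. Qed.

Let hf_neg v : hf (neg v) = neg (hf v).
Proof. by rewrite /hf /=; case: ifP. Qed.

Let pl_hf v : pl (hf v) = ~~ v.2.
Proof.
case: v => i [] /=; rewrite /hf /=; case: ifP => // h.
- by rewrite -[(i, true)]/(neg (i, false)) pl_neg h.
- by rewrite -[neg (i, false)]/(i, true) -[(i, true)]/(neg (i, false)) pl_neg h.
Qed.

Let hf2 v : (hf v).2 = ~~ pl v.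
Proof. by rewrite -[v in RHS]hfK pl_hf negbK. Qed.

Let xh v : hf (x (hf v)) = ((hf (x (hf (v.1, false)))).1, v.2).
Proof.
have e w : w.2 = false -> hf (x (hf w)) = ((hf (x (hf w))).1, false).
  move=> w2; rewrite [LHS]surjective_pairing; congr (_, _).
  by rewrite hf2 pl_x pl_hf w2.
case: v => i []; last by rewrite e.
have xn w : x (neg w) = neg (x w) by have /signed_permsP-> := xB.
rewrite -[(i, true)]/(neg (i, false)) hf_neg xn hf_neg e //=.
Qed.

Lemma straighten : exists s, x \in (ord_sperm s ^: Bgroup m)%g.
Proof.
pose f i := (hf (x (hf (i, false)))).1.
have f_inj : injective f.
  move=> i j e; have : hf (x (hf (i, false))) = hf (x (hf (j, false))).
    by rewrite (xh (i, false)) (xh (j, false)) /= -/(f i) e.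
  by move/(inv_inj hfK)/perm_inj/(inv_inj hfK) => -[].
have sE v : ord_sperm (perm f_inj) v = hf (x (hf v)).
  by rewrite ord_spermE permE -xh.
exists (perm f_inj); apply/imsetP; exists (perm (inv_inj hfK)).
  by apply/signed_permsP=> v; rewrite !permE hf_neg.
apply/permP=> v; rewrite -[v](permKV (perm (inv_inj hfK))) permJ.
by rewrite [in RHS]permE sE hfK [in LHS]permE.
Qed.

End Straighten.

Lemma pos_class_ex x : x \in Bgroup m -> all_positive x -> exists l, in_pos_class l x.
Proof.
move=> xB xp; have [s xs] := straighten xB xp.
have [l sl] := has_cycle_type_exists s; exists l.
by rewrite /in_pos_class xB xp; apply/existsP; exists s; rewrite sl.
Qed.

Lemma pos_class_uniq l k x : in_pos_class l x -> in_pos_class k x -> l = k.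
Proof.
case/and3P=> _ _ /existsP[s /andP[sl /imsetP[b bB e]]].
case/and3P=> _ _ /existsP[t /andP[tk /imsetP[c cB e']]].
have [||h eh] := @ord_sperm_conj s t (b * c^-1)%g; first by rewrite groupM ?groupV.
  by rewrite conjgM -e e' conjgK.
by apply: (has_cycle_type_uniq _ tk); rewrite eh has_cycle_typeJ.
Qed.

Lemma all_positiveJ x b : b \in Bgroup m -> all_positive x -> all_positive (x ^ b)%g.
Proof.
move=> /signed_permsP bB /forallP xp; apply/forallP=> v; apply/negP.
rewrite -[v](permKV b) -bB => /porbit_iterP[a].
have -> w : iter a (x ^ b)%g (b w) = b (iter a x w).
  by elim: a => //= a ->; rewrite permJ.
move/perm_inj=> e; have /negP[] := xp ((b^-1)%g v).
by rewrite e mem_porbit_iter.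
Qed.

Lemma pos_class_conjE l x y : in_pos_class l y ->
  (x \in (y ^: Bgroup m)%g) = in_pos_class l x.
Proof.
case/and3P=> yB yp /existsP[s /andP[sl ys]]; apply/imsetP/and3P.
  case=> b bB ->; split; [by rewrite groupJ|exact: all_positiveJ|].
  apply/existsP; exists s; rewrite sl; case/imsetP: ys => c cB ->.
  by apply/imsetP; exists (c * b)%g; rewrite ?groupM // conjgM.
case=> xB xp /existsP[t /andP[tl xt]].
have [h e] := has_cycle_type_conj sl tl.
move: xt ys => /imsetP[b bB ->] /imsetP[c cB ->].
exists (c^-1 * ord_sperm h * b)%g; first by rewrite !groupM ?groupV ?ord_sperm_signed.
by rewrite e ord_spermJ !conjgM conjgK.
Qed.

Variables (xi : nat -> algC) (hx : prim_roots xi).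

Lemma neg_permJ b : b \in Bgroup m -> (neg_perm m ^ b)%g = neg_perm m.
Proof.
move/signed_permsP=> bB; apply/permP=> v.
by rewrite -[v](permKV b) permJ !permE bB.
Qed.

Lemma psiBE l y (hy : in_pos_class l y) u : u \in Bgroup m ->
  psiB hx hy u = \sum_(z | in_pos_class l z && (u \in 'C[z]%g)) wt xi (neg_perm m) z u.
Proof.
move=> uB; rewrite /psiB cfIndE ?subsetIl //.
have [yB yp _] := and3P hy.
pose f z := if u \in 'C[z]%g then wt xi (neg_perm m) z u else 0.
transitivity (#|'C_(Bgroup m)[y]%g|%:R^-1 * \sum_(b in Bgroup m) f (y ^ b^-1)%g).
  congr (_ * _); apply: eq_bigr => b bB; rewrite cfunE /f.
  have -> : (u \in 'C[y ^ b^-1]%g) = ((u ^ b)%g \in 'C_(Bgroup m)[y]%g).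
    by rewrite in_setI groupJ // cent1J mem_conjgV.
  case: (boolP (_ \in _)) => [|_]; last by rewrite mulr0n.
  case/setIP=> ubB /perm_commP uy; rewrite mulr1n (omegaB_wt hx) //.
  have /signed_permsP yn := yB; have /signed_permsP un := ubB.
  have nE v : neg_perm m v = neg v by rewrite permE.
  rewrite -(@wtJ xi hx _ _ _ _ b^-1%g) //.
  + by rewrite neg_permJ ?groupV // conjgK.
  + by move=> v; rewrite !nE neg_inv.
  + by move=> v; rewrite !nE yn.
  by move=> v; rewrite !nE un.
rewrite sum_conjV mulKf; last by rewrite Num.Theory.pnatr_eq0 -lt0n cardG_gt0.
by rewrite -big_mkcondr; apply: eq_bigl => z; rewrite (pos_class_conjE _ hy).
Qed.

Lemma etaBE (y : intpart m -> {perm spoint m}) (hy : forall l, in_pos_class l (y l)) u :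
  u \in Bgroup m -> etaB hx hy u =
  \sum_(z | [&& z \in Bgroup m, all_positive z & u \in 'C[z]%g]) wt xi (neg_perm m) z u.
Proof.
move=> uB; rewrite /etaB sum_cfunE; under eq_bigr do rewrite psiBE //.
rewrite (exchange_big_dep (fun z => [&& z \in Bgroup m, all_positive z & u \in 'C[z]%g])) /=.
  apply: eq_bigr => z /and3P[zB zp uz]; have [l zl] := pos_class_ex zB zp.
  rewrite (big_pred1 l) // => k; rewrite uz andbT.
  by apply/idP/eqP => [zk|->//]; apply: pos_class_uniq zk zl.
by move=> l z _ /andP[/and3P[-> -> _] ->].
Qed.

End SignedClasses.

(** * The induced character as a sum over commuting pairs *)

Section Induced.

Variables (n : nat) (xi : nat -> algC) (hx : prim_roots xi).
Variables (y : intpart n./2 -> {perm spoint n./2}) (hy : forall l, in_pos_class l (y l)).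
Variables (iota : spoint n./2 -> 'I_n) (ii : injective iota).

Let tau := extend ii (neg_perm n./2).

Let tauP v : (tau v == v) = (v \notin codom iota).
Proof.
rewrite permE; case: (boolP (v \in codom iota)) => [/codomP[q ->]|h].
  by rewrite extend_fun_iota // permE (inj_eq ii) /neg -pair_eqE /= andbC; case: q.2.
by rewrite extend_fun_out // eqxx.
Qed.

Let extendE u v : extend ii u (iota v) = iota (u v).
Proof. by rewrite permE extend_fun_iota. Qed.

Let tauE v : tau (iota v) = iota (neg v).
Proof. by rewrite extendE permE. Qed.

Let ext_inj : injective (extend ii).
Proof. by move=> u w e; apply/permP=> q; apply: ii; rewrite -!extendE e. Qed.

Lemma extend_pairing : pairing [set: 'I_n] tau.
Proof.
apply/pairingP; split; first exact: perm_on_setT.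
  move=> v; case: (boolP (v \in codom iota)) => [/codomP[q ->]|h].
    by rewrite !tauE neg_inv.
  by have /eqP e : tau v == v; rewrite ?tauP // !e.
have e : [set v in [set: 'I_n] | tau v == v] = ~: [set v in codom iota].
  by apply/setP=> v; rewrite !inE tauP.
rewrite e cardsCs setCK cardsE card_codom // card_prod !card_ord card_bool.
by rewrite muln2 -{1}(odd_double_half n) addnK; case: odd.
Qed.

Lemma extend_positive u : u \in Bgroup n./2 ->
  positive (extend ii u) tau = all_positive u.
Proof.
move=> uB; have it a q : iter a (extend ii u) (iota q) = iota (iter a u q).
  by elim: a => //= a ->; rewrite extendE.
apply/forallP/forallP => h v.
  apply/negP=> /porbit_iterP[a e].
  have /implyP := h (iota v); rewrite tauE e -it mem_porbit_iter.
  move/(_ isT); rewrite extendE (inj_eq ii) => /eqP uv.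
  have : neg v = v by rewrite e; elim: a {e} => //= a ->.
  by case: v {h e uv} => i [] [].
apply/implyP; case: (boolP (v \in codom iota)) => [/codomP[q ->]|vi _].
  rewrite tauE => /porbit_iterP[a]; rewrite it => /ii e.
  by have /negP[] := h q; rewrite e mem_porbit_iter.
by rewrite permE extend_fun_out.
Qed.

(** The image of B_m is the centralizer of the pairing [tau], and the conjugates of [tau] are all
    the pairings, so inducing amounts to letting the involution vary. *)
Lemma ind_etaBE (g : 'S_n) :
  ('Ind[[set: 'S_n]] (embed_cfun ii (etaB hx hy))) g = pair_sum xi [set: 'I_n] g.
Proof.
have im := im_extend ii erefl; rewrite -/tau in im.
rewrite cfIndE ?subsetT //.
(* [f t] is the value at g of the character transported to the centralizer of t, extended by 0. *)
pose f t := if g \in 'C[t]%g then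
  \sum_(z | [&& positive z t, z \in 'C[t]%g & z \in 'C[g]%g]) wt xi t z g else 0.
transitivity (#|'C[tau]%g|%:R^-1 * \sum_(h in [set: 'S_n]) f (tau ^ h^-1)%g).
  rewrite -im; congr (_ * _); apply: eq_bigr => h _.
  have e : (g \in 'C[tau ^ h^-1]%g) = ((g ^ h)%g \in extend_morphism ii @* Bgroup n./2).
    by rewrite im cent1J mem_conjgV.
  rewrite /f e; case: ifPn => [|nh]; last by rewrite cfun0.
  case/morphimP=> u _ uB eu; rewrite eu /embed_cfun cfIsomE // etaBE //.
  have {}eu : g = (extend ii u ^ h^-1)%g by rewrite -[LHS](conjgK h) eu.
  pose phi z := (extend ii z ^ h^-1)%g.
  pose A := [set z | [&& z \in Bgroup n./2, all_positive z & u \in 'C[z]%g]].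
  have phi_inj : {in A &, injective phi} by move=> z w _ _ /conjg_inj/ext_inj.
  transitivity (\sum_(z in A) wt xi (tau ^ h^-1)%g (phi z) g).
    apply: eq_big => [z|z /and3P[zB zp /perm_commP uz]]; first by rewrite [RHS]inE.
    have /signed_permsP zn := zB; have /signed_permsP un := uB.
    have nn : involutive (neg_perm n./2) by move=> v; rewrite !permE neg_inv.
    have nz v : neg_perm n./2 (z v) = z (neg_perm n./2 v) by rewrite !permE zn.
    have nu v : neg_perm n./2 (u v) = u (neg_perm n./2 v) by rewrite !permE un.
    rewrite eu; symmetry.
    have co (p q : {perm spoint n./2}) : (forall v, p (q v) = q (p v)) ->
        forall v, extend ii p (extend ii q v) = extend ii q (extend ii p v).
      move=> pq v; case: (boolP (v \in codom iota)) => [/codomP[w ->]|vi].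
        by rewrite !extendE pq.
      by rewrite !permE !extend_fun_out.
    have /pairingP[_ tt _] := extend_pairing.
    rewrite wtJ //; try exact: co.
    apply: (@wt_embed xi hx _ _ iota) => // [v|v vi]; first exact: extendE.
    by split; rewrite permE extend_fun_out.
  rewrite -(big_imset (fun z => wt xi (tau ^ h^-1)%g z g) phi_inj) /=.
  apply: eq_bigl => z; apply/imsetP/and3P => [[w]|[zp zt zg]].
    rewrite inE => /and3P[wB wp uw] ->; split.
    - rewrite -(extend_positive wB) in wp; apply/forallP=> v; apply/implyP.
      rewrite -[v](permKV h^-1) permJ => /porbit_iterP[a].
      have -> w' : iter a (phi w) (h^-1 w')%g = (h^-1 (iter a (extend ii w) w'))%g.
        by elim: a => //= a ->; rewrite permJ.
      move/perm_inj=> ev; rewrite permJ (inj_eq perm_inj).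
      by have /implyP := forallP wp ((h^-1)^-1 v)%g; apply; rewrite ev mem_porbit_iter.
    - by rewrite cent1J memJ_conjg -im mem_morphim.
    rewrite eu cent1J memJ_conjg; apply/cent1P; rewrite /commute -!extendM //.
    by congr extend; apply/esym/cent1P.
  have : (z ^ h)%g \in extend_morphism ii @* Bgroup n./2.
    by rewrite im; rewrite cent1J mem_conjgV in zt.
  case/morphimP=> w _ wB ew.
  have ez : z = phi w by rewrite /phi -[LHS](conjgK h) ew.
  exists w => //; rewrite inE; apply/and3P; split=> //.
    rewrite -extend_positive //; apply/forallP=> v; apply/implyP=> /porbit_iterP[a ev].
    have /implyP := forallP zp (h^-1 v)%g; rewrite ez permJ ev permJ (inj_eq perm_inj).
    apply; apply/porbit_iterP; exists a.
    by elim: a {ev} => //= a <-; rewrite permJ.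
  apply/cent1P/ext_inj.
  rewrite [LHS](extendM ii) // [RHS](extendM ii) //.
  by move: zg; rewrite ez eu cent1J memJ_conjg => /cent1P.
rewrite sum_conjV setTI mulKf; last by rewrite Num.Theory.pnatr_eq0 -lt0n cardG_gt0.
have [t0 p0 th] := pairing_class [set: 'I_n].
have [h0 _ e0] := th _ extend_pairing.
have cl t : (t \in (tau ^: [set: 'S_n])%g) = pairing [set: 'I_n] t.
  apply/imsetP/idP => [[h _ ->]|/th[h _ ->]].
    by apply: pairingJ; [apply: perm_on_setT|apply: extend_pairing].
  by exists (h0^-1 * h)%g; rewrite ?inE // e0 conjgM conjgK.
rewrite (eq_bigl _ _ cl) /f -big_mkcondr pair_big_dep /pair_sum.
apply: eq_bigl => -[t z] /=; apply/andP/pairsP.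
  case=> /andP[/pairingP[tD tt t1] /perm_commP gt] /and3P[zp /perm_commP zt /perm_commP zg].
  by split=> //; split=> //; apply: perm_on_setT.
case=> tD tt t1 [tg zD gz tz zp]; split; last first.
  by apply/and3P; split=> //; apply/perm_commP.
by apply/andP; split; [apply/pairingP|apply/perm_commP].
Qed.

End Induced.

Theorem theorem1p6 (n : nat)
    (zeta xi : nat -> algC) (hzeta : prim_roots zeta) (hxi : prim_roots xi)
    (x : intpart n -> 'S_n) (hx : forall l, has_cycle_type (x l) l)
    (y : intpart n./2 -> {perm spoint n./2}) (hy : forall l, in_pos_class l (y l))
    (iota : spoint n./2 -> 'I_n) (hiota : injective iota) :
  \sum_(l : intpart n | odd_parts l) psiS hzeta (x l) =
    'Ind[[set: 'S_n]] (embed_cfun hiota (etaB hxi hy)).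
Proof.
apply/cfunP=> g; rewrite sum_psiS // ind_etaBE.
by apply: odd_sum_pair_sum; rewrite ?perm_on_setT.
Qed.
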